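(* Let $(u,i)$ and $(v,j)$ be in $\mathbb{Z}_n^2$ such that $d$ does not divide $2i+u-1$ or $2j+v-1$ (i.e. divides neither of them), and let $\ell$ and $t$ be any positive integers. (1) For any $\lambda,\mu\in k\setminus\{0\}$ with $\lambda\neq\mu$, the $\mathcal{D}$-module $C_\lambda^\ell(u,i)\otimes C_\mu^t(v,j)$ is projective. (2) For any $\lambda\in k\setminus\{0\}$, the $\mathcal{D}$-modules $C_\lambda^\ell(u,i)\otimes M_{2t}^{+}(v,j)$ and $C_\lambda^\ell(u,i)\otimes M_{2t}^{-}(v,j)$ are projective.
   Context: Setting. $k$ is an algebraically closed field; $d\geq 2$ and $n$ are integers with $d\mid n$ and $n$ invertible in $k$; $q\in k$ is a primitive $d$-th root of unity; $\mathbb{Z}_n=\mathbb{Z}/n\mathbb{Z}$ (so $q^i$ and congruences mod $d$ make sense for $i\in\mathbb{Z}_n$). $\mathcal{D}=\mathcal{D}(\Lambda_{n,d})$ is the Drinfeld double of the dual $\Lambda_{n,d}$ of the extended Taft algebra: the $n^2d^2$-dimensional Hopf algebra generated by $e_i,a_i$ ($i\in\mathbb{Z}_n$), $G$, $X$ with relations $e_ie_j=\delta_{ij}e_i$, $\sum_ie_i=1$, $a_i=e_{i+1}a_ie_i$, $a_{i+d-1}\cdots a_{i+1}a_i=0$, $G^n=1$, $X^d=0$, $GX=q^{-1}XG$, $Ge_i=e_iG$, $a_iG=q^{-1}Ga_i$, $e_iX=Xe_{i+1}$, $a_iX=q^{-1}(Xa_{i+1}-e_{i+1}+q^{i+1}Ge_{i+1})$;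 coproduct $\Delta(e_i)=\sum_{j+l=i}e_j\otimes e_l$, $\Delta(a_i)=\sum_{j+l=i}(e_j\otimes a_l+q^la_j\otimes e_l)$, $\Delta(G)=G\otimes G$, $\Delta(X)=X\otimes G+1\otimes X$; counit $\varepsilon(e_i)=\delta_{i0}$, $\varepsilon(a_i)=0$, $\varepsilon(G)=1$, $\varepsilon(X)=0$; antipode $S(e_i)=e_{-i}$, $S(a_i)=-q^{i+1}a_{-i-1}$, $S(G)=G^{-1}$, $S(X)=-XG^{-1}$. Write $\gamma_i^m=a_{i+m-1}\cdots a_{i+1}a_i$. Modules are finite-dimensional left modules; $\otimes=\otimes_k$ with action via $\Delta$. $\operatorname{core}(M)$ is the direct sum of the non-projective indecomposable summands of $M$. Simple modules. For $r$ an integer (or element of $\mathbb{Z}_n$), $\langle r\rangle\in\{1,\dots,d\}$ is its residue mod $d$; for $u\in\mathbb{Z}_n$, $\sigma_u$ is the permutation $\sigma_u(j)=d+j-\langle 2j+u-1\rangle$ of $\mathbb{Z}_n$. For $(u,i)\in\mathbb{Z}_n^2$ with $2i+u-1\not\equiv0\pmod d$, $L(u,i)$ is the simple $\mathcal{D}$-module, unique up to isomorphism, of dimension $d-\langle2i+u-1\rangle$, such that $G$ acts on $e_jL(u,i)$ as $q^{u+j}$ for all $j$, and the kernel of $X$ on $L(u,i)$ is a line contained in $e_iL(u,i)$. These are exactly the non-projective simple modules. Blocks. $\mathbb{B}_{u,i}$ is the block of $\mathcal{D}$ containing $L(u,i)$; its simples are $L(u,\sigma_u^p(i))$, $p\in\mathbb{Z}_{2n/d}$.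 It is Morita equivalent to the path algebra of the quiver with vertices $\epsilon_p$ ($p\in\mathbb{Z}_{2n/d}$) and arrows $b_p:\epsilon_p\to\epsilon_{p+1}$, $\bar b_p:\epsilon_{p+1}\to\epsilon_p$, modulo $b_{p+1}b_p$, $\bar b_p\bar b_{p+1}$, $\bar b_pb_p-b_{p-1}\bar b_{p-1}$ for all $p$. The equivalence is fixed so that the simple at $\epsilon_p$ corresponds to $L(u,\sigma_u^p(i))$ and, with $j=\sigma_u^p(i)$, $N=\dim L(u,j)$: the length-2 representation with only $b_p$ acting non-trivially corresponds to a module $M$ with $\gamma_j^Ne_jM\neq0$, $X^Ne_{j+N-1}M=0$; the one with only $\bar b_{p-1}$ acting non-trivially to a module $M$ with $\gamma_j^Ne_jM=0$, $X^Ne_{j+N-1}M\neq0$. String modules of even length. For $\ell\geq1$, $M_{2\ell}^+(u,i)$ corresponds to the representation with basis $x_0,\dots,x_{\ell-1},y_0,\dots,y_{\ell-1}$, $x_r$ at $\epsilon_{2r}$, $y_r$ at $\epsilon_{2r+1}$, $b_{2r}x_r=y_r$, $\bar b_{2r-1}x_r=y_{r-1}$ ($r\geq1$), all other arrow actions on basis elements zero. $M_{2\ell}^-(u,i)$ corresponds to the representation with $x_r$ at $\epsilon_{-2r}$, $y_r$ at $\epsilon_{-2r-1}$, $\bar b_{-2r-1}x_r=y_r$, $b_{-2r}x_r=y_{r-1}$ ($r\geq1$), all others zero. Band modules. For $\lambda\in k\setminus\{0\}$, $\ell\geq1$, $C_\lambda^\ell(0,0)$ corresponds (in $\mathbb{B}_{0,0}$,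 with $\epsilon_0$ corresponding to $L(0,0)$) to the representation with $V=k^\ell$ at every vertex, where $b_0$ acts as the Jordan block $J_\ell(\lambda)$, $b_{2p}$ ($2p\neq0$ in $\mathbb{Z}_{2n/d}$) and all $\bar b_{2p+1}$ act as the identity, and all $\bar b_{2p}$, $b_{2p+1}$ act as zero. For every $(v,j)\in\mathbb{Z}_n^2$ with $2j+v-1\not\equiv0\pmod d$, one sets (convention) $C_\lambda^\ell(v,j)=\operatorname{core}(C_\lambda^\ell(0,0)\otimes L(v,j))$. *)

(* Defs.v *)
From HB Require Import structures.
From mathcomp Require Import all_boot all_order all_algebra ring.
From mathcomp.real_closed Require Import mxtens.

Set Implicit Arguments.
Unset Strict Implicit.
Unset Printing Implicit Defensive.

Import GRing.Theory.
Local Open Scope ring_scope.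

Section QBinomial.
Variables (k : fieldType) (q : k).

Fixpoint qbin (n i : nat) : k :=
  match n, i with
  | 0, 0 => 1
  | 0, _.+1 => 0
  | n'.+1, 0 => 1
  | n'.+1, i'.+1 => qbin n' i' + q ^+ i'.+1 * qbin n' i'.+1
  end.

Lemma qbin0 n : qbin n 0 = 1. Proof. by case: n. Qed.

Lemma qbin_small n i : (n < i)%N -> qbin n i = 0.
Proof.
elim: n i => [|n IH] [|i] //= lt_ni.
by rewrite !IH ?mulr0 ?addr0 // ltnW.
Qed.

Lemma qbin_diag n : qbin n n = 1.
Proof. by elim: n => //= n ->; rewrite qbin_small // mulr0 addr0. Qed.

Lemma qbin_ratio n i : (i <= n)%N ->
  qbin n i.+1 * (q ^+ i.+1 - 1) = qbin n i * (q ^+ (n - i) - 1).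
Proof.
elim: n i => [|n IH] i; first by case: i => //= _; rewrite subrr mul0r mulr0.
rewrite leq_eqVlt => /predU1P[->|lt_in].
  by rewrite qbin_small // subnn subrr mul0r mulr0.
rewrite ltnS in lt_in.
have IHi := IH _ lt_in; rewrite /= subSn //.
case: i lt_in IHi => [|i] lt_in IHi /=.
  move: IHi; rewrite !qbin0 subn0 expr1 mul1r => IHi.
  by rewrite mulrDl -mulrA IHi exprS; ring.
have := IH i (ltnW lt_in); rewrite -subSn // subSS => IHi'.
rewrite mulrDl -mulrA IHi mulrDl -IHi' -(subnSK lt_in).
by rewrite ?exprS; ring.
Qed.

Lemma qbin_prim d i : d.-primitive_root q -> (0 < i < d)%N -> qbin d i = 0.
Proof.
move=> prq; case: i => // i /= lt_id.
have neq1 j : (j.+1 < d)%N -> q ^+ j.+1 - 1 != 0.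
  by move=> lt_jd; rewrite subr_eq0 -(prim_order_dvd prq) gtnNdvd.
have step j : (j.+1 < d)%N -> qbin d j * (q ^+ (d - j) - 1) = 0 ->
    qbin d j.+1 = 0.
  move=> lt_jd; rewrite -(qbin_ratio (ltnW (ltnW lt_jd))) => /eqP.
  by rewrite mulf_eq0 (negPf (neq1 j lt_jd)) orbF => /eqP.
elim: i lt_id => [|i IH] lt_id; apply: step => //.
  by rewrite subn0 (prim_expr_order prq) subrr mulr0.
by rewrite IH ?mul0r // ltnW.
Qed.

Lemma mxZl m (c : k) (A B : 'M[k]_m) : (c *: A) * B = c *: (A * B).
Proof. by rewrite -!mulmxE -scalemxAl. Qed.

Lemma mxZr m (c : k) (A B : 'M[k]_m) : A * (c *: B) = c *: (A * B).
Proof. by rewrite -!mulmxE -scalemxAr. Qed.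

Lemma qbinomial m (A B : 'M[k]_m) n : B * A = q *: (A * B) ->
  (A + B) ^+ n = \sum_(i < n.+1) qbin n i *: (A ^+ i * B ^+ (n - i)).
Proof.
move=> qAB.
have qBA i : B * A ^+ i = q ^+ i *: (A ^+ i * B).
  elim: i => [|i IH]; first by rewrite !expr0 mulr1 mul1r scale1r.
  by rewrite exprSr mulrA IH mxZl -mulrA qAB mxZr scalerA -exprSr mulrA.
elim: n => [|n IH]; first by rewrite big_ord1 /= !expr0 mulr1 scale1r.
rewrite exprS IH mulrDl !mulr_sumr.
rewrite [RHS]big_ord_recl /= scale1r expr0 mul1r subn0.
rewrite [X in _ + X]big_ord_recl /= qbin0 scale1r expr0 mul1r subn0 -exprS.
rewrite addrCA; congr (_ + _).
under [RHS]eq_bigr => i _ do rewrite /bump leq0n add1n /= subSS scalerDl.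
rewrite big_split /=; congr (_ + _).
  by apply: eq_bigr => i _; rewrite mxZr mulrA -exprS.
rewrite [RHS]big_ord_recr /= qbin_small // mulr0 scale0r addr0.
apply: eq_bigr => i _; rewrite /bump leq0n add1n mxZr mulrA qBA mxZl scalerA.
by rewrite -mulrA -exprS subnSK // mulrC.
Qed.

Lemma qbinomial_nilp m (A B : 'M[k]_m) d : d.-primitive_root q ->
  B * A = q *: (A * B) -> A ^+ d = 0 -> B ^+ d = 0 -> (A + B) ^+ d = 0.
Proof.
move=> prq qAB A0 B0; rewrite (qbinomial _ qAB) big1 // => -[i /= lt_i] _.
have [->|i_gt0] := posnP i; first by rewrite subn0 B0 mulr0 scaler0.
have [->|neq_id] := eqVneq i d; first by rewrite A0 mul0r scaler0.
by rewrite qbin_prim ?scale0r // i_gt0 ltn_neqAle neq_id -ltnS.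
Qed.
End QBinomial.

Record taft_data (k : closedFieldType) := TaftData {
  tn : nat;
  td : nat;
  tq : k;
  td_ge2 : (2 <= td)%N;
  td_dvd_n : (td %| tn)%N;
  tn_inv : tn%:R != 0 :> k;
  tq_prim : td.-primitive_root tq }.

Section DrinfeldDouble.
Variables (k : closedFieldType) (T : taft_data k).
Local Notation n := (tn T).
Local Notation d := (td T).
Local Notation q := (tq T).
Local Notation Zn := ('Z_(tn T)).

Lemma tn_gt1 : (1 < n)%N.
Proof.
have n_gt0 : (0 < n)%N.
  by rewrite lt0n; apply: contraNneq (tn_inv T) => ->; rewrite mulr0n.
exact: leq_trans (td_ge2 T) (dvdn_leq n_gt0 (td_dvd_n T)).
Qed.

(* Since q ^+ d = 1 and d %| n, the residue mod d of the representative of an *)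
(* element of Z_n in [0, n[ does not depend on choices.                       *)
Definition qpow (i : Zn) : k := q ^+ i.

Lemma qpowD i j : qpow (i + j) = qpow i * qpow j.
Proof.
have valD : (i + j)%R = ((i + j)%N %% n)%N :> nat.
  by congr (_ %% _)%N; apply: Zp_cast tn_gt1.
have mod_q := expr_mod _ (prim_expr_order (tq_prim T)).
by rewrite /qpow valD -exprD -mod_q modn_dvdm ?td_dvd_n ?mod_q.
Qed.

Lemma qpow1 : qpow 1 = q.
Proof. by rewrite /qpow -[1]/(1%:R : Zn) val_Zp_nat ?modn_small ?expr1 ?tn_gt1. Qed.

Lemma qpow0 : qpow 0 = 1.
Proof. by rewrite /qpow expr0. Qed.

Lemma tq_neq0 : q != 0.
Proof.
apply: contraTneq (td_ge2 T) => q0; have := prim_expr_order (tq_prim T).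
by rewrite q0 expr0n; case: d => [|d'] //= /eqP; rewrite eq_sym oner_eq0.
Qed.

(* a_(i+r-1) ... a_(i+1) a_i *)
Fixpoint gamma m (a : Zn -> 'M[k]_m) (i : Zn) (r : nat) : 'M[k]_m :=
  if r is r'.+1 then a (i + r'%:R) * gamma a i r' else 1.

(* A finite-dimensional left D-module: a vector space, given by its dimension, *)
(* with an action of the generators satisfying the defining relations.        *)
(* Matrices act on column vectors, so that products read as in D, and a       *)
(* linear map M -> N is a matrix with ddim N rows and ddim M columns.         *)
Record dmod := DMod {
  ddim : nat;
  de : Zn -> 'M[k]_ddim;
  da : Zn -> 'M[k]_ddim;
  dG : 'M[k]_ddim;
  dX : 'M[k]_ddim;
  de_orth : forall i j, de i * de j = if i == j then de i else 0;
  de_sum : \sum_i de i = 1;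
  da_vert : forall i, da i = de (i + 1) * da i * de i;
  da_nilp : forall i, gamma da i d = 0;
  dG_order : dG ^+ n = 1;
  dX_nilp : dX ^+ d = 0;
  dGX : dG * dX = q^-1 *: (dX * dG);
  dGe : forall i, dG * de i = de i * dG;
  daG : forall i, da i * dG = q^-1 *: (dG * da i);
  deX : forall i, de i * dX = dX * de (i + 1);
  daX : forall i, da i * dX =
    q^-1 *: (dX * da (i + 1) - de (i + 1) + qpow (i + 1) *: (dG * de (i + 1))) }.

Section DirectSum.
Variables m1 m2 : nat.
Let D (A : 'M[k]_m1) (B : 'M[k]_m2) := block_mx A 0 0 B.

Lemma diag2M A B A' B' : D A B * D A' B' = D (A * A') (B * B').
Proof.
by rewrite -!mulmxE mulmx_block !mul0mx !mulmx0 !addr0 !add0r.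
Qed.

Lemma diag21 : D 1 1 = 1.
Proof. by rewrite /D -scalar_mx_block. Qed.

Lemma diag20 : D 0 0 = 0.
Proof. by rewrite /D block_mx0. Qed.

Lemma diag2D A B A' B' : D A B + D A' B' = D (A + A') (B + B').
Proof. by rewrite add_block_mx !addr0. Qed.

Lemma diag2N A B : - D A B = D (- A) (- B).
Proof. by rewrite opp_block_mx !oppr0. Qed.

Lemma diag2Z c A B : c *: D A B = D (c *: A) (c *: B).
Proof. by rewrite scale_block_mx !scaler0. Qed.

Lemma diag2X A B r : D A B ^+ r = D (A ^+ r) (B ^+ r).
Proof.
by elim: r => [|r IH]; rewrite ?expr0 ?diag21 // !exprS IH diag2M.
Qed.

Lemma diag2_sum (A : Zn -> 'M[k]_m1) B :
  \sum_i D (A i) (B i) = D (\sum_i A i) (\sum_i B i).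
Proof.
by apply/esym/(big_rec3 (fun x y z => D x y = z)) => [|i x y z _ <-];
  rewrite ?diag20 ?diag2D.
Qed.

Lemma diag2_gamma a b i r :
  gamma (fun j => D (a j) (b j)) i r = D (gamma a i r) (gamma b i r).
Proof. by elim: r => [|r IH] /=; rewrite ?diag21 // IH diag2M. Qed.
End DirectSum.

Program Definition dsum (M N : dmod) : dmod := {|
  ddim := ddim M + ddim N;
  de i := block_mx (de M i) 0 0 (de N i);
  da i := block_mx (da M i) 0 0 (da N i);
  dG := block_mx (dG M) 0 0 (dG N);
  dX := block_mx (dX M) 0 0 (dX N) |}.
Next Obligation. by rewrite diag2M !de_orth; case: ifP; rewrite ?diag20. Qed.
Next Obligation. by rewrite diag2_sum !de_sum diag21. Qed.
Next Obligation. by rewrite !diag2M -!da_vert. Qed.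
Next Obligation. by rewrite diag2_gamma !da_nilp diag20. Qed.
Next Obligation. by rewrite diag2X !dG_order diag21. Qed.
Next Obligation. by rewrite diag2X !dX_nilp diag20. Qed.
Next Obligation. by rewrite !diag2M diag2Z !dGX. Qed.
Next Obligation. by rewrite !diag2M !dGe. Qed.
Next Obligation. by rewrite !diag2M diag2Z !daG. Qed.
Next Obligation. by rewrite !diag2M !deX. Qed.
Next Obligation. by rewrite !(diag2M, diag2Z, diag2N, diag2D) !daX. Qed.

Program Definition dzero : dmod :=
  {| ddim := 0; de _ := 0; da _ := 0; dG := 0; dX := 0 |}.
Solve All Obligations with by move=> *; apply/matrixP => -[].

(* The action of a = \sum_i a_i and of \sum_i q^i e_i; the relations of D are *)
(* equivalent to relations between these, the e_i, G and X.                   *)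
Section Total.
Variables (m : nat) (e : Zn -> 'M[k]_m) (A G X : 'M[k]_m).
Let K := \sum_i qpow i *: e i.
Hypothesis orthE : forall i j, e i * e j = if i == j then e i else 0.
Hypothesis sumE : \sum_i e i = 1.

Lemma totKe i : K * e i = qpow i *: e i.
Proof.
rewrite mulr_suml (bigD1 i) //= mxZl orthE eqxx big1 ?addr0 // => j neq_ji.
by rewrite mxZl orthE (negPf neq_ji) scaler0.
Qed.

Lemma toteK i : e i * K = qpow i *: e i.
Proof.
rewrite mulr_sumr (bigD1 i) //= mxZr orthE eqxx big1 ?addr0 // => j neq_ji.
by rewrite mxZr orthE eq_sym (negPf neq_ji) scaler0.
Qed.

Lemma totP (B C : 'M[k]_m) : (forall i, B * e i = C * e i) -> B = C.
Proof.
move=> eqBC; rewrite -[B]mulr1 -[C]mulr1 -sumE !mulr_sumr.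
by apply: eq_bigr => i _.
Qed.

Section TotalA.
Hypothesis eA : forall i, e (i + 1) * A = A * e i.

Lemma tot_vert i : A * e i = e (i + 1) * (A * e i) * e i.
Proof. by rewrite mulrA eA -!mulrA !orthE eqxx orthE eqxx. Qed.

Lemma tot_eX i r : e (i + r%:R) * A ^+ r = A ^+ r * e i.
Proof.
elim: r => [|r IH]; first by rewrite mulr0n addr0 mulr1 mul1r.
by rewrite exprS mulrA -natr1 addrA eA -mulrA IH mulrA.
Qed.

Lemma tot_gamma i r : gamma (fun j => A * e j) i r.+1 = A ^+ r.+1 * e i.
Proof.
elim: r => [|r IH]; first by rewrite /= mulr0n addr0 mulr1 expr1.
rewrite [LHS]/= -/(gamma (fun j => A * e j) i r.+1) IH -mulrA (mulrA (e _)).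
by rewrite tot_eX -mulrA orthE eqxx mulrA -exprS.
Qed.

Lemma totKA : K * A = q *: (A * K).
Proof.
apply: totP => i; rewrite -mulrA -eA mulrA totKe mxZl eA qpowD qpow1.
by rewrite mxZl -mulrA totKe mxZr scalerA mulrC.
Qed.
End TotalA.

Lemma totKG : (forall i, G * e i = e i * G) -> G * K = K * G.
Proof.
move=> Ge; rewrite mulr_sumr mulr_suml; apply: eq_bigr => i _.
by rewrite mxZr mxZl Ge.
Qed.
End Total.

Lemma eq_gamma m (a b : Zn -> 'M[k]_m) : a =1 b -> gamma a =2 gamma b.
Proof. by move=> eq_ab i; elim=> //= r ->; rewrite eq_ab. Qed.

Section TotalOf.
Variable M : dmod.
Definition sumA := \sum_i da M i.
Definition sumK := \sum_i qpow i *: de M i.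

Lemma da_eq i : da M i = sumA * de M i.
Proof.
rewrite mulr_suml (bigD1 i) //= big1 ?addr0 => [|j neq_ji].
  by rewrite {2}da_vert -mulrA de_orth eqxx -da_vert.
by rewrite da_vert -mulrA de_orth (negPf neq_ji) mulr0.
Qed.

Lemma deA i : de M (i + 1) * sumA = sumA * de M i.
Proof.
rewrite -da_eq mulr_sumr (bigD1 i) //= big1 ?addr0 => [|j neq_ji].
  by rewrite {1}da_vert -mulrA mulrA de_orth eqxx mulrA -da_vert.
rewrite da_vert !mulrA de_orth (inj_eq (addIr 1)) eq_sym (negPf neq_ji).
by rewrite !mul0r.
Qed.

Lemma dA_nilp : sumA ^+ d = 0.
Proof.
apply: (totP (@de_sum M)) => i; rewrite mul0r -(da_nilp M i).
case: d (td_ge2 T) => // d' _.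
by rewrite -(tot_gamma (@de_orth M) deA) (eq_gamma da_eq).
Qed.

Lemma dAG : sumA * dG M = q^-1 *: (dG M * sumA).
Proof.
by rewrite mulr_suml mulr_sumr scaler_sumr; apply: eq_bigr => i _; apply: daG.
Qed.

Lemma dAX : sumA * dX M = q^-1 *: (dX M * sumA - 1 + dG M * sumK).
Proof.
apply: (totP (@de_sum M)) => i; rewrite -[i](subrK 1) -mulrA -deX mulrA -da_eq.
rewrite daX mxZl !mulrDl mulNr mul1r -!mulrA -da_eq.
by rewrite (totKe (@de_orth M)) mxZr.
Qed.

Lemma dKX : sumK * dX M = q^-1 *: (dX M * sumK).
Proof.
apply: (totP (@de_sum M)) => i; rewrite -[i](subrK 1) -mulrA -deX mulrA.
rewrite (totKe (@de_orth M)) mxZl deX mxZl -!mulrA (totKe (@de_orth M)).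
rewrite mxZr scalerA; move: (i - 1) => j.
by rewrite qpowD qpow1 [_ * q]mulrC mulrA mulVf ?mul1r // tq_neq0.
Qed.

Lemma dKA : sumK * sumA = q *: (sumA * sumK).
Proof. exact: totKA (@de_orth M) (@de_sum M) deA. Qed.

Lemma dGK : dG M * sumK = sumK * dG M.
Proof. exact: totKG (dGe M). Qed.
End TotalOf.

Section OfTotal.
Variables (m : nat) (e a : Zn -> 'M[k]_m) (A G X : 'M[k]_m).
Hypothesis orthE : forall i j, e i * e j = if i == j then e i else 0.
Hypothesis sumE : \sum_i e i = 1.
Hypothesis aE : forall i, a i = A * e i.
Hypothesis eA : forall i, e (i + 1) * A = A * e i.
Hypothesis A_nilp : A ^+ d = 0.
Hypothesis G_order : G ^+ n = 1.
Hypothesis X_nilp : X ^+ d = 0.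
Hypothesis GX : G * X = q^-1 *: (X * G).
Hypothesis Ge : forall i, G * e i = e i * G.
Hypothesis AG : A * G = q^-1 *: (G * A).
Hypothesis eX : forall i, e i * X = X * e (i + 1).
Hypothesis AX : A * X = q^-1 *: (X * A - 1 + G * \sum_i qpow i *: e i).

Lemma oft_vert i : a i = e (i + 1) * a i * e i.
Proof. by rewrite !aE; apply: tot_vert. Qed.

Lemma oft_nilp i : gamma a i d = 0.
Proof.
rewrite (eq_gamma aE) -[RHS](mul0r (e i)) -A_nilp.
by case: d (td_ge2 T) => // d' _; apply: tot_gamma.
Qed.

Lemma oftG i : a i * G = q^-1 *: (G * a i).
Proof. by rewrite aE -mulrA -Ge mulrA AG mxZl mulrA. Qed.

Lemma oftX i : a i * X =
  q^-1 *: (X * a (i + 1) - e (i + 1) + qpow (i + 1) *: (G * e (i + 1))).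
Proof.
rewrite !aE -mulrA eX mulrA AX mxZl !mulrDl mulNr mul1r -!mulrA.
by rewrite (totKe orthE) mxZr.
Qed.

Definition dmod_of_total : dmod :=
  DMod orthE sumE oft_vert oft_nilp G_order X_nilp GX Ge oftG eX oftX.
End OfTotal.

Section Tensor.
Variables m1 m2 : nat.
Implicit Types (A : 'M[k]_m1) (B : 'M[k]_m2).

Lemma tensM A B A' B' : (A *t B) * (A' *t B') = (A * A') *t (B * B').
Proof. by rewrite -!mulmxE tensmx_mul. Qed.

Lemma tensDl A A' B : (A + A') *t B = A *t B + A' *t B.
Proof.
by apply/matrixP=> i j; case: (mxtens_indexP i) => i0 i1;
   case: (mxtens_indexP j) => j0 j1; rewrite [RHS]mxE !tensmxE [in LHS]mxE mulrDl.
Qed.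

Lemma tensDr A B B' : A *t (B + B') = A *t B + A *t B'.
Proof.
by apply/matrixP=> i j; case: (mxtens_indexP i) => i0 i1;
   case: (mxtens_indexP j) => j0 j1; rewrite [RHS]mxE !tensmxE [in LHS]mxE mulrDr.
Qed.

Lemma tensZl c A B : (c *: A) *t B = c *: (A *t B).
Proof.
by apply/matrixP=> i j; case: (mxtens_indexP i) => i0 i1;
   case: (mxtens_indexP j) => j0 j1; rewrite [RHS]mxE !tensmxE [in LHS]mxE mulrA.
Qed.

Lemma tensZr c A B : A *t (c *: B) = c *: (A *t B).
Proof.
by apply/matrixP=> i j; case: (mxtens_indexP i) => i0 i1;
   case: (mxtens_indexP j) => j0 j1; rewrite [RHS]mxE !tensmxE [in LHS]mxE mulrCA.
Qed.

Lemma tens11 : (1 : 'M[k]_m1) *t (1 : 'M[k]_m2) = 1.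
Proof.
apply/matrixP=> i j; case: (mxtens_indexP i) => i0 i1.
case: (mxtens_indexP j) => j0 j1; rewrite tensmxE !mxE.
rewrite (can_eq (@mxtens_indexK m1 m2)) xpair_eqE.
by case: eqP; case: eqP; rewrite ?mulr1 ?mulr0.
Qed.

Lemma tensX A B r : (A *t B) ^+ r = (A ^+ r) *t (B ^+ r).
Proof. by elim: r => [|r IH]; rewrite ?expr0 ?tens11 // !exprS IH tensM. Qed.

Lemma tens_suml (A : Zn -> 'M[k]_m1) B :
  (\sum_i A i) *t B = \sum_i (A i *t B).
Proof.
by apply: (big_rec2 (fun x y => x *t B = y)) => [|i x y _ <-];
  rewrite ?tens0mx ?tensDl.
Qed.

Lemma tens_sumr A (B : Zn -> 'M[k]_m2) :
  A *t (\sum_i B i) = \sum_i (A *t B i).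
Proof.
by apply: (big_rec2 (fun x y => A *t x = y)) => [|i x y _ <-];
  rewrite ?tensmx0 ?tensDr.
Qed.
End Tensor.

(* M (x) N, with D acting through                                             *)
(*   Delta(e_i) = \sum_(j + l = i) e_j (x) e_l                                *)
(*   Delta(a_i) = \sum_(j + l = i) (e_j (x) a_l + q^l a_j (x) e_l)            *)
(*   Delta(G) = G (x) G,  Delta(X) = X (x) G + 1 (x) X                        *)
Section TensorModule.
Variables M N : dmod.
Let m := (ddim M * ddim N)%N.
Definition tens_e (i : Zn) : 'M[k]_m :=
  \sum_j de M j *t de N (i - j).
Definition tens_a (i : Zn) : 'M[k]_m :=
  \sum_j (de M j *t da N (i - j) + qpow (i - j) *: (da M j *t de N (i - j))).
Definition tens_G : 'M[k]_m := dG M *t dG N.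
Definition tens_X : 'M[k]_m := dX M *t dG N + 1 *t dX N.

Let A : 'M[k]_m := 1 *t sumA N + sumA M *t sumK N.

Lemma tens_orth i j : tens_e i * tens_e j = if i == j then tens_e i else 0.
Proof.
have tens_eM u : (de M u *t de N (i - u)) * tens_e j =
    if i == j then de M u *t de N (i - u) else 0.
  rewrite mulr_sumr (bigD1 u) //= tensM !de_orth eqxx (inj_eq (addIr _)).
  rewrite big1 ?addr0 => [|v neq_vu]; first by case: eqP; rewrite ?tensmx0.
  by rewrite tensM de_orth eq_sym (negPf neq_vu) tens0mx.
rewrite mulr_suml (eq_bigr _ (fun u _ => tens_eM u)).
by case: eqP => // _; rewrite big1_eq.
Qed.

Lemma tens_sum : \sum_i tens_e i = 1.
Proof.
rewrite exchange_big /= -tens11 -(de_sum M) tens_suml; apply: eq_bigr => j _.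
rewrite -(de_sum N) tens_sumr [RHS](reindex_inj (addIr (- j))) /=.
by apply: eq_bigr.
Qed.

Lemma tens_aE i : tens_a i = A * tens_e i.
Proof.
rewrite mulr_sumr; apply: eq_bigr => j _.
rewrite mulrDl !tensM mul1r (totKe (@de_orth N)) tensZr -!da_eq.
by [].
Qed.

Lemma tens_eA i : tens_e (i + 1) * A = A * tens_e i.
Proof.
rewrite mulrDr mulrDl !mulr_suml !mulr_sumr; congr (_ + _).
  by apply: eq_bigr => j _; rewrite !tensM mul1r mulr1 addrAC deA.
rewrite (reindex_inj (addIr 1)) /=; apply: eq_bigr => j _.
rewrite !tensM deA (totKe (@de_orth N)) (toteK (@de_orth N)).
by rewrite opprD addrACA subrr addr0.
Qed.

Lemma tens_A_nilp : A ^+ d = 0.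
Proof.
apply: qbinomial_nilp (tq_prim T) _ _ _.
- by rewrite !tensM mul1r mulr1 dKA tensZr.
- by rewrite tensX dA_nilp tensmx0.
- by rewrite tensX dA_nilp tens0mx.
Qed.

Lemma tens_G_order : tens_G ^+ n = 1.
Proof. by rewrite tensX !dG_order tens11. Qed.

Lemma tens_X_nilp : tens_X ^+ d = 0.
Proof.
apply: qbinomial_nilp (tq_prim T) _ _ _.
- by rewrite !tensM mul1r mulr1 dGX tensZr scalerA mulfV ?scale1r ?tq_neq0.
- by rewrite tensX dX_nilp tens0mx.
- by rewrite tensX dX_nilp tensmx0.
Qed.

Lemma tens_GX : tens_G * tens_X = q^-1 *: (tens_X * tens_G).
Proof.
by rewrite mulrDr mulrDl !tensM mul1r mulr1 !dGX tensZl tensZr scalerDr.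
Qed.

Lemma tens_Ge i : tens_G * tens_e i = tens_e i * tens_G.
Proof.
rewrite mulr_suml mulr_sumr; apply: eq_bigr => j _.
by rewrite !tensM !dGe.
Qed.

Lemma tens_AG : A * tens_G = q^-1 *: (tens_G * A).
Proof.
rewrite mulrDr mulrDl !tensM mul1r mulr1 !dAG tensZl tensZr scalerDr.
by rewrite dGK.
Qed.

Lemma tens_eX i : tens_e i * tens_X = tens_X * tens_e (i + 1).
Proof.
rewrite mulrDr mulrDl !mulr_suml !mulr_sumr; congr (_ + _).
  rewrite [RHS](reindex_inj (addIr 1)) /=; apply: eq_bigr => j _.
  by rewrite !tensM deX dGe opprD addrACA subrr addr0.
by apply: eq_bigr => j _; rewrite !tensM mul1r mulr1 addrAC deX.
Qed.

Lemma tens_K : \sum_i qpow i *: tens_e i = sumK M *t sumK N.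
Proof.
under eq_bigr => i _ do rewrite scaler_sumr.
rewrite exchange_big /= tens_suml; apply: eq_bigr => j _.
rewrite tens_sumr [RHS](reindex_inj (addIr (- j))) /=; apply: eq_bigr => i _.
by rewrite tensZl tensZr scalerA -qpowD [j + _]addrC subrK.
Qed.

Lemma tens_AX : A * tens_X =
  q^-1 *: (tens_X * A - 1 + tens_G * \sum_i qpow i *: tens_e i).
Proof.
rewrite tens_K !mulrDr !mulrDl !tensM !mul1r !mulr1 dAG dAX dAX dKX.
rewrite !(tensZl, tensZr, tensDl, tensDr) -!scalerDr; congr (_ *: _).
rewrite !dGK -tens11 -[- (1 : 'M_(ddim M))]scaleN1r -[- (1 : 'M_(ddim N))]scaleN1r.
rewrite tensZl tensZr !scaleN1r.
do !move: (_ *t _) => ?.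
by apply/matrixP => i j; rewrite !mxE; ring.
Qed.

Definition dtens : dmod :=
  dmod_of_total tens_orth tens_sum tens_aE tens_eA tens_A_nilp tens_G_order
    tens_X_nilp tens_GX tens_Ge tens_AG tens_eX tens_AX.
End TensorModule.
Record is_dhom (M N : dmod) (f : 'M[k]_(ddim N, ddim M)) : Prop := IsDHom {
  dhom_e : forall i, f *m de M i = de N i *m f;
  dhom_a : forall i, f *m da M i = da N i *m f;
  dhom_G : f *m dG M = dG N *m f;
  dhom_X : f *m dX M = dX N *m f }.

Definition diso (M N : dmod) : Prop :=
  exists (f : 'M[k]_(ddim N, ddim M)) (g : 'M[k]_(ddim M, ddim N)),
    [/\ is_dhom f, is_dhom g, g *m f = 1%:M & f *m g = 1%:M].

(* [\rank g = ddim B] says that g is surjective. *)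
Definition dprojective (P : dmod) : Prop :=
  forall (A B : dmod) (g : 'M[k]_(ddim B, ddim A)) (f : 'M[k]_(ddim B, ddim P)),
    is_dhom g -> \rank g = ddim B -> is_dhom f ->
    exists2 h : 'M[k]_(ddim A, ddim P), is_dhom h & g *m h = f.

Definition dindecomposable (M : dmod) : Prop :=
  (0 < ddim M)%N /\
  forall A B : dmod, diso M (dsum A B) -> ddim A = 0%N \/ ddim B = 0%N.

(* A subspace of column vectors is the row space of U, transposed. *)
Definition dstable (M : dmod) (U : 'M[k]_(ddim M)) : Prop :=
  [/\ forall i, stablemx U (de M i)^T, forall i, stablemx U (da M i)^T,
      stablemx U (dG M)^T & stablemx U (dX M)^T].

Definition dsimple (M : dmod) : Prop :=
  (0 < ddim M)%N /\
  forall U : 'M[k]_(ddim M), dstable U -> U = 0 \/ row_full U.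

(* C is (isomorphic to) core(M); well defined by the Krull-Schmidt theorem. *)
Definition is_core (M C : dmod) : Prop :=
  exists (r : nat) (N : 'I_r -> dmod) (np : pred 'I_r),
    [/\ forall s, dindecomposable (N s),
        diso M (\big[dsum/dzero]_(s < r) N s),
        forall s, np s <-> ~ dprojective (N s)
      & diso C (\big[dsum/dzero]_(s < r | np s) N s)].

(* <r>, for r given by a natural number. *)
Definition residue (r : nat) : nat := if (d %| r)%N then d else (r %% d)%N.

Definition weight (u i : Zn) : nat := nat_of_ord (i *+ 2 + u - 1)%R.

Definition sigma (u j : Zn) : Zn := d%:R + j - (residue (weight u j))%:R.

Definition nonproj (u i : Zn) : bool := ~~ (d %| weight u i)%N.

Definition Ldim (u i : Zn) : nat := (d - residue (weight u i))%N.

(* L is (isomorphic to) L(u,i). *)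
Definition is_L (u i : Zn) (L : dmod) : Prop :=
  [/\ dsimple L,
      ddim L = Ldim u i,
      forall j, dG L * de L j = qpow (u + j) *: de L j
    & exists v : 'cV[k]_(ddim L),
        [/\ v != 0, dX L *m v = 0, de L i *m v = v
          & forall w : 'cV[k]_(ddim L), dX L *m w = 0 ->
              exists c : k, w = c *: v]].

(* Elements of D are the natural endomorphisms of the forgetful functor from  *)
(* finite-dimensional D-modules to vector spaces; central elements are those  *)
(* which act by D-linear maps.                                                *)
Record central_idem (c : forall M : dmod, 'M[k]_(ddim M)) : Prop :=
  CentralIdem {
    ci_nat : forall M N (f : 'M[k]_(ddim N, ddim M)),
      is_dhom f -> f *m c M = c N *m f;
    ci_lin : forall M, is_dhom (c M);
    ci_idem : forall M, c M *m c M = c M }.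

Definition primitive_central_idem (c : forall M : dmod, 'M[k]_(ddim M)) :=
  [/\ central_idem c,
      exists M, c M != 0
    & forall c1 c2, central_idem c1 -> central_idem c2 ->
        (forall M, c1 M *m c2 M = 0) -> (forall M, c M = c1 M + c2 M) ->
        (forall M, c1 M = 0) \/ (forall M, c2 M = 0)].

(* M is a module over the block of D containing L(u,i). *)
Definition in_block (u i : Zn) (M : dmod) : Prop :=
  exists c : forall N : dmod, 'M[k]_(ddim N),
    [/\ primitive_central_idem c,
        exists2 L, is_L u i L & c L = 1%:M
      & c M = 1%:M].

(* Modules over the quiver algebra: the total space of a representation, with *)
(* the action of the idempotents \epsilon_p (qe) and of the arrows b_p (qb)   *)
(* and \bar b_p (qbb). Here nv is the number of vertices.                     *)
Local Notation nv := ((2 * tn T) %/ td T)%N.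
Local Notation Zv := ('Z_((2 * tn T) %/ td T)).

Lemma nv_eq : nv = (2 * (n %/ d))%N.
Proof. by rewrite muln_divA ?td_dvd_n. Qed.

Lemma nv_gt1 : (1 < nv)%N.
Proof.
have n_gt0 := ltnW tn_gt1; have d_gt0 := ltnW (td_ge2 T).
by rewrite nv_eq leq_pmulr // divn_gt0 // dvdn_leq ?td_dvd_n.
Qed.

Record qmod := QMod {
  qdim : nat;
  qe : Zv -> 'M[k]_qdim;
  qb : Zv -> 'M[k]_qdim;
  qbb : Zv -> 'M[k]_qdim;
  qe_orth : forall p r, qe p * qe r = if p == r then qe p else 0;
  qe_sum : \sum_p qe p = 1;
  qb_vert : forall p, qb p = qe (p + 1) * qb p * qe p;
  qbb_vert : forall p, qbb p = qe p * qbb p * qe (p + 1);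
  qbb_zero : forall p, qb (p + 1) * qb p = 0;
  qbbb_zero : forall p, qbb p * qbb (p + 1) = 0;
  q_comm : forall p, qbb p * qb p = qb (p - 1) * qbb (p - 1) }.

Record is_qhom (V W : qmod) (f : 'M[k]_(qdim W, qdim V)) : Prop := IsQHom {
  qhom_e : forall p, f *m qe V p = qe W p *m f;
  qhom_b : forall p, f *m qb V p = qb W p *m f;
  qhom_bb : forall p, f *m qbb V p = qbb W p *m f }.

(* Representations with a basis x_0, x_1, ..., y_0, y_1, ... such that the    *)
(* arrows map each x to a sum of y's and each y to 0: [b s r] says that y_s   *)
(* occurs in the image of x_r by an arrow b_p, and [bb s r] that it occurs in *)
(* its image by an arrow \bar b_p.                                            *)
Section Bipartite.
Variables (nx ny : nat) (posx : 'I_nx -> Zv) (posy : 'I_ny -> Zv).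
Variables (b bb : 'I_ny -> 'I_nx -> bool).

Definition bip_e (p : Zv) : 'M[k]_(nx + ny) :=
  block_mx (diag_mx (\row_r (posx r == p)%:R)) 0
           0 (diag_mx (\row_s (posy s == p)%:R)).
Definition bip_b (p : Zv) : 'M[k]_(nx + ny) :=
  block_mx 0 0
    (\matrix_(s, r) [&& b s r, posx r == p & posy s == p + 1]%:R) 0.
Definition bip_bb (p : Zv) : 'M[k]_(nx + ny) :=
  block_mx 0 0
    (\matrix_(s, r) [&& bb s r, posx r == p + 1 & posy s == p]%:R) 0.

Lemma diag_indicM N (pos : 'I_N -> Zv) p r :
  diag_mx (\row_s (pos s == p)%:R) * diag_mx (\row_s (pos s == r)%:R) =
  if p == r then diag_mx (\row_s (pos s == p)%:R) else 0 :> 'M[k]_N.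
Proof.
rewrite -mulmxE mulmx_diag; apply/matrixP => s t; rewrite !mxE.
case: (eqVneq p r) => [<-|neq_pr]; rewrite !mxE.
  by case: (pos s == p); rewrite ?mulr1 ?mulr0.
have [->|] := eqVneq (pos s) p; last by rewrite mul0r mul0rn.
by rewrite (negPf neq_pr) mulr0 mul0rn.
Qed.

Lemma diag_indic_sum N (pos : 'I_N -> Zv) :
  \sum_p diag_mx (\row_s (pos s == p)%:R) = 1 :> 'M[k]_N.
Proof.
apply/matrixP => s t; rewrite summxE (bigD1 (pos s)) //= big1 ?addr0.
  by rewrite !mxE eqxx.
by move=> p neq_p; rewrite !mxE eq_sym (negPf neq_p) mul0rn.
Qed.

Lemma bip_orth p r : bip_e p * bip_e r = if p == r then bip_e p else 0.
Proof.
by rewrite diag2M !diag_indicM; case: ifP => // _; rewrite diag20.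
Qed.

Lemma bip_sum : \sum_p bip_e p = 1.
Proof.
rewrite /bip_e -diag21 -!(diag_indic_sum posx, diag_indic_sum posy).
by apply/esym/(big_rec3 (fun x y z => block_mx x 0 0 y = z)) => [|i x y z _ <-];
  rewrite ?diag20 ?diag2D.
Qed.

Lemma bip_b_vert p : bip_b p = bip_e (p + 1) * bip_b p * bip_e p.
Proof.
rewrite -!mulmxE !mulmx_block !(mul0mx, mulmx0, addr0, add0r).
rewrite mul_diag_mx mul_mx_diag; congr block_mx.
apply/matrixP => s r; rewrite !mxE.
by case: (posx r == _); case: (posy s == _); case: (b s r);
  rewrite ?mulr0 ?mul0r ?mulr1.
Qed.

Lemma bip_bb_vert p : bip_bb p = bip_e p * bip_bb p * bip_e (p + 1).
Proof.
rewrite -!mulmxE !mulmx_block !(mul0mx, mulmx0, addr0, add0r).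
rewrite mul_diag_mx mul_mx_diag; congr block_mx.
apply/matrixP => s r; rewrite !mxE.
by case: (posx r == _); case: (posy s == _); case: (bb s r);
  rewrite ?mulr0 ?mul0r ?mulr1.
Qed.

Lemma bip_mul0 (B C : 'M[k]_(ny, nx)) :
  block_mx 0 0 B 0 * block_mx 0 0 C 0 = 0 :> 'M[k]_(nx + ny).
Proof.
by rewrite -mulmxE mulmx_block !(mul0mx, mulmx0, addr0) block_mx0.
Qed.

Lemma bip_comm p : bip_bb p * bip_b p = bip_b (p - 1) * bip_bb (p - 1).
Proof. by rewrite !bip_mul0. Qed.

Definition bipartite : qmod :=
  QMod bip_orth bip_sum bip_b_vert bip_bb_vert
    (fun p => bip_mul0 _ _) (fun p => bip_mul0 _ _) bip_comm.
End Bipartite.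

Definition qsimple (p : Zv) : qmod :=
  @bipartite 1 0 (fun _ => p) (fun _ => 0) (fun _ _ => false)
    (fun _ _ => false).

(* The length-2 representation with top at p on which only b_p acts. *)
Definition qlen2_b (p : Zv) : qmod :=
  @bipartite 1 1 (fun _ => p) (fun _ => p + 1) (fun _ _ => true)
    (fun _ _ => false).

(* The length-2 representation with top at p on which only \bar b_(p-1) acts. *)
Definition qlen2_bb (p : Zv) : qmod :=
  @bipartite 1 1 (fun _ => p) (fun _ => p - 1) (fun _ _ => false)
    (fun _ _ => true).

Definition qstring_plus (l : nat) : qmod :=
  @bipartite l l (fun r => (2 * r)%:R) (fun r => (2 * r + 1)%:R)
    (fun s r => s == r) (fun s r => s.+1 == r :> nat).

Definition qstring_minus (l : nat) : qmod :=
  @bipartite l l (fun r => - (2 * r)%:R) (fun r => - (2 * r + 1)%:R)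
    (fun s r => s.+1 == r :> nat) (fun s r => s == r).

Definition jordan (l : nat) (lam : k) : 'M[k]_l :=
  \matrix_(r, s) (if r == s then lam else (r.+1 == s :> nat)%:R).

(* The total space of the band representation is k^nv (x) k^l. *)
Section Band.
Variables (lam : k) (l : nat).

Definition band_e (p : Zv) : 'M[k]_((Zp_trunc nv).+2 * l) :=
  delta_mx p p *t 1%:M.
Definition band_b (p : Zv) : 'M[k]_((Zp_trunc nv).+2 * l) :=
  if odd p then 0
  else delta_mx (p + 1) p *t (if p == 0 then jordan l lam else 1%:M).
Definition band_bb (p : Zv) : 'M[k]_((Zp_trunc nv).+2 * l) :=
  if odd p then delta_mx p (p + 1) *t 1%:M else 0.

Lemma odd_Zv1 (p : Zv) : odd (p + 1)%R = ~~ odd p.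
Proof.
have -> : (p + 1)%R = ((p + 1)%N %% nv)%N :> nat.
  rewrite -[in LHS](natr_Zp p) natr1 val_Zp_nat ?nv_gt1 //.
  by rewrite addn1.
by rewrite odd_mod ?nv_eq ?oddM // addn1.
Qed.

Lemma band_orth p r : band_e p * band_e r = if p == r then band_e p else 0.
Proof.
rewrite tensM mulr1 -mulmxE mul_delta_mx_cond; case: eqP => [->|_] //.
by rewrite mulr0n tens0mx.
Qed.

Lemma band_sum : \sum_p band_e p = 1.
Proof.
have E1 : 1 = \sum_p delta_mx p p :> 'M[k]_((Zp_trunc nv).+2).
  exact: mx1_sum_delta.
rewrite -tens11 {}E1.
by apply/esym/(big_rec2 (fun x y => x *t _ = y)) => [|i x y _ <-];
  rewrite ?tens0mx ?tensDl.
Qed.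

Lemma band_b_vert p : band_b p = band_e (p + 1) * band_b p * band_e p.
Proof.
rewrite /band_b; case: ifP => _; first by rewrite mulr0 mul0r.
by rewrite !tensM mul1r mulr1 -!mulmxE !mul_delta_mx.
Qed.

Lemma band_bb_vert p : band_bb p = band_e p * band_bb p * band_e (p + 1).
Proof.
rewrite /band_bb; case: ifP => _; last by rewrite mulr0 mul0r.
by rewrite !tensM !mulr1 -!mulmxE !mul_delta_mx.
Qed.

Lemma band_bb0 p : band_b (p + 1) * band_b p = 0.
Proof.
by rewrite /band_b odd_Zv1; case: (odd p); rewrite ?mulr0 ?mul0r.
Qed.

Lemma band_bbbb0 p : band_bb p * band_bb (p + 1) = 0.
Proof.
by rewrite /band_bb odd_Zv1; case: (odd p); rewrite ?mulr0 ?mul0r.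
Qed.

Lemma band_comm p : band_bb p * band_b p = band_b (p - 1) * band_bb (p - 1).
Proof.
rewrite /band_bb /band_b.
by case: (odd p); case: (odd (p - 1)%R); rewrite ?mulr0 ?mul0r.
Qed.

Definition qband : qmod :=
  QMod band_orth band_sum band_b_vert band_bb_vert band_bb0 band_bbbb0
    band_comm.
End Band.

(* A k-linear equivalence between modules over the quiver algebra and modules *)
(* over the block containing L(u,i); be_simple numbers the vertices, and      *)
(* be_len2_b, be_len2_bb tell b_p apart from \bar b_(p-1). This determines    *)
(* the equivalence up to rescaling the arrows.                                *)
Record block_equiv (u i : Zn) := BlockEquiv {
  be_obj : qmod -> dmod;
  be_mor : forall V W : qmod,
    'M[k]_(qdim W, qdim V) -> 'M[k]_(ddim (be_obj W), ddim (be_obj V));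
  be_hom : forall V W (f : 'M[k]_(qdim W, qdim V)),
    is_qhom f -> is_dhom (be_mor f);
  be_id : forall V : qmod, be_mor (1%:M : 'M[k]_(qdim V)) = 1%:M;
  be_comp : forall U V W (f : 'M[k]_(qdim V, qdim U))
                   (g : 'M[k]_(qdim W, qdim V)),
    is_qhom f -> is_qhom g -> be_mor (g *m f) = be_mor g *m be_mor f;
  be_linear : forall V W (c : k) (f g : 'M[k]_(qdim W, qdim V)),
    is_qhom f -> is_qhom g -> be_mor (c *: f + g) = c *: be_mor f + be_mor g;
  be_faithful : forall V W (f g : 'M[k]_(qdim W, qdim V)),
    is_qhom f -> is_qhom g -> be_mor f = be_mor g -> f = g;
  be_full : forall V W (h : 'M[k]_(ddim (be_obj W), ddim (be_obj V))),
    is_dhom h -> exists2 f : 'M[k]_(qdim W, qdim V), is_qhom f & be_mor f = h;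
  be_block : forall V, in_block u i (be_obj V);
  be_surj : forall M, in_block u i M -> exists V, diso M (be_obj V);
  be_simple : forall p : Zv, is_L u (iter p (sigma u) i) (be_obj (qsimple p));
  be_len2_b : forall p : Zv,
    let j := iter p (sigma u) i in let N := Ldim u j in
    let M := be_obj (qlen2_b p) in
    gamma (da M) j N * de M j != 0 /\ dX M ^+ N * de M (j + N%:R - 1) = 0;
  be_len2_bb : forall p : Zv,
    let j := iter p (sigma u) i in let N := Ldim u j in
    let M := be_obj (qlen2_bb p) in
    gamma (da M) j N * de M j = 0 /\ dX M ^+ N * de M (j + N%:R - 1) != 0 }.

Lemma nonproj00 : nonproj 0 0.
Proof.
rewrite /nonproj /weight mul0rn add0r; set w := nat_of_ord _.
have w1_0 : w.+1%:R = 0 :> Zn by rewrite -natr1 natr_Zp subrK.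
have dvd_w1 : (d %| w.+1)%N.
  apply: dvdn_trans (td_dvd_n T) _.
  by have /eqP := congr1 (@nat_of_ord _) w1_0; rewrite val_Zp_nat ?tn_gt1.
apply/negP => dvd_w; move: dvd_w1; rewrite -addn1 dvdn_addr // dvdn1 => /eqP d1.
by have := td_ge2 T; rewrite d1.
Qed.

Section Modules.
Variable E : forall u i : Zn, nonproj u i -> block_equiv u i.

Definition string_plus (l : nat) (u i : Zn) (h : nonproj u i) : dmod :=
  be_obj (E h) (qstring_plus l).

Definition string_minus (l : nat) (u i : Zn) (h : nonproj u i) : dmod :=
  be_obj (E h) (qstring_minus l).

(* C is (isomorphic to) C_lam^l(v,j). *)
Definition is_band (lam : k) (l : nat) (v j : Zn) (C : dmod) : Prop :=
  exists2 L, is_L v j L &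
    is_core (dtens (be_obj (E nonproj00) (qband lam l)) L) C.
End Modules.
End DrinfeldDouble.

(* Main.v *)
Require Import Defs.
From HB Require Import structures.
From mathcomp Require Import all_boot all_order all_algebra ring zify.
From mathcomp.real_closed Require Import mxtens.

(** Let a = \sum_i a_i, K = \sum_i q^i e_i and c0 = (1 - q)^-1. For s <> 0 the
elements x = X + s G and y = a + c0 s^-1 K satisfy y x = q^-1 (x y - 1) and
generate, with the central K^-1 G, a right coideal subalgebra over which D is
free. On modules with G^d = 1, z = x y - c0 satisfies z^d = 0, and a module
induced from the subalgebra is projective when the inducing module is free over
k[z]/z^d. The band C_lam^1(0,0) is induced from a one-dimensional module on which
x acts by some s, and s^n determines lam. So C_lam^l(0,0) (x) L (x) N, which is
filtered by induced modules, is projective as soon as N is free over k[z]/z^d for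
every parameter xi with xi^d = s^d. For N = C_mu^t(0,0) (x) L' this holds when xi^n
differs from the n-th power of the parameter of mu; for a string module it follows
from the case of length two, where z is a single Jordan block. The modules in the
theorem are direct summands of these tensor products. *)

Set Implicit Arguments.
Unset Strict Implicit.
Unset Printing Implicit Defensive.

Import GRing.Theory.
Local Open Scope ring_scope.

(** * Relative traces *)

(** The constant [c0] is forced: it makes the terms in G K cancel in y x - q^-1 (x y - 1), and x y
    equals it on one-dimensional modules, where z vanishes. The summand s G makes x invertible, so y
    can be recovered from x and z, and a map commuting with x and z commutes with y. The condition
    xi^d = s^d enters because the restriction of L has one-dimensional factors on which only the
    d-th power of x is known.

    The main obstacle is that the equivalence with quiver representations is arbitrary: it is pinned
    down only on simple and length-two modules, hence only up to rescaling the arrows. The action of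
    D on a band must be recovered from this by exactness. The dependence of s on lam is never
    computed either: modules induced with the same s^n admit a nonzero homomorphism, bands with
    distinct lam admit none, so distinct lam have distinct s^n. String modules need less, since they
    are iterated extensions of length-two modules, and freeness over k[z]/z^d passes to
    extensions. *)

Section MatrixPowers.
Variable k : fieldType.

Lemma expmxS m (A : 'M[k]_m) r : A ^+ r.+1 = A *m A ^+ r.
Proof. by rewrite exprS mulmxE. Qed.

Lemma expmxSr m (A : 'M[k]_m) r : A ^+ r.+1 = A ^+ r *m A.
Proof. by rewrite exprSr mulmxE. Qed.

Lemma expmxZ m c (A : 'M[k]_m) r : (c *: A) ^+ r = c ^+ r *: A ^+ r.
Proof.
elim: r => [|r IH]; first by rewrite !expr0 scale1r.
by rewrite !exprS IH mxZl mxZr scalerA.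
Qed.

Lemma expmx_intertwine m p (A : 'M[k]_m) (B : 'M[k]_p) (f : 'M[k]_(m, p)) r :
  A *m f = f *m B -> A ^+ r *m f = f *m B ^+ r.
Proof.
move=> Af; elim: r => [|r IH]; first by rewrite !expr0 mul1mx mulmx1.
by rewrite expmxS expmxSr -mulmxA IH mulmxA Af -mulmxA -expmxS expmxSr.
Qed.

Lemma qcommX m (c : k) (A B : 'M[k]_m) r :
  A * B = c *: (B * A) -> A * B ^+ r = c ^+ r *: (B ^+ r * A).
Proof.
move=> AB; elim: r => [|r IH]; first by rewrite !expr0 mulr1 mul1r scale1r.
by rewrite exprSr mulrA IH mxZl -mulrA AB mxZr scalerA -exprSr mulrA.
Qed.

Lemma qcommMX m (c : k) (A B : 'M[k]_m) r : A * B = c *: (B * A) ->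
  (B * A) ^+ r = c ^+ 'C(r, 2) *: (B ^+ r * A ^+ r).
Proof.
move=> AB; elim: r => [|r IH]; first by rewrite !expr0 mulr1 scale1r.
have AX : A ^+ r * B = c ^+ r *: (B * A ^+ r).
  elim: r {IH} => [|r IH]; first by rewrite !expr0 mulr1 mul1r scale1r.
  by rewrite exprS -mulrA IH mxZr mulrA AB mxZl scalerA -exprSr -mulrA -exprS.
rewrite exprSr IH mxZl [_ * (B * A)]mulrA -[_ * _ * B]mulrA AX mxZr mxZl scalerA.
by rewrite binS bin1 -exprD !mulrA -exprSr -!mulrA -exprSr.
Qed.

(** Since [e] is [col_base e *m row_base e], the injective left factor and the surjective right
    factor can be cancelled in e e = e. The two factors are then the inclusion and the projection of
    the image. *)
Lemma idem_split m (e : 'M[k]_m) : e *m e = e ->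
  row_base e *m col_base e = 1%:M.
Proof.
move=> ee; have cK : pinvmx (col_base e) *m col_base e = 1%:M.
  by rewrite mulVpmx // col_base_full.
have rK : row_base e *m pinvmx (row_base e) = 1%:M.
  by rewrite mulmxVp // row_base_free.
have E : col_base e *m row_base e *m (col_base e *m row_base e) =
  col_base e *m row_base e by rewrite mulmx_base.
move: (col_base _) (row_base _) (pinvmx _) (pinvmx _) E cK rK.
move=> c r c' r' E cK rK; have := congr1 (fun x => r' *m x *m c') E.
by rewrite !mulmxA cK mul1mx -!mulmxA rK mulmx1.
Qed.

Lemma mxZm m n p c (A : 'M[k]_(m, n)) (B : 'M[k]_(n, p)) :
  (c *: A) *m B = c *: (A *m B).
Proof. by rewrite scalemxAl. Qed.

Lemma mxmZ m n p c (A : 'M[k]_(m, n)) (B : 'M[k]_(n, p)) :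
  A *m (c *: B) = c *: (A *m B).
Proof. by rewrite scalemxAr. Qed.

(* trz N is the relative trace from k to k[Z]/Z^N; by Higman's criterion,      *)
(* when Z ^+ N = 0, the predicate zfree below says that the k[Z]/Z^N-module    *)
(* k^m is free.                                                               *)
Definition trz N a b (A : 'M[k]_a) (B : 'M[k]_b) (f : 'M[k]_(a, b)) :=
  \sum_(r < N) A ^+ r *m f *m B ^+ (N - r.+1).

(** The sum telescopes. When A^N and B^N are both zero, or the same scalar, the trace therefore
    intertwines A and B. *)
Lemma trz_comm N a b (A : 'M[k]_a) (B : 'M[k]_b) f :
  A *m trz N A B f - trz N A B f *m B = A ^+ N *m f - f *m B ^+ N.
Proof.
pose F r := A ^+ r *m f *m B ^+ (N - r).
have -> : A ^+ N *m f - f *m B ^+ N = F N - F 0%N.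
  by rewrite /F subnn subn0 !expr0 mulmx1 mul1mx.
rewrite -(telescope_sumr F (leq0n N)) big_mkord sumrB mulmx_sumr mulmx_suml.
congr (_ - _); apply: eq_bigr => -[r lt_r] _; rewrite /F /=.
  by rewrite expmxS !mulmxA.
by rewrite -!mulmxA -expmxSr -subSn // subSS.
Qed.

Lemma trz_mull N a b c (A : 'M[k]_a) (B : 'M[k]_b) (C : 'M[k]_c)
    (u : 'M[k]_(c, a)) f :
  C *m u = u *m A -> trz N C B (u *m f) = u *m trz N A B f.
Proof.
move=> uA; rewrite mulmx_sumr; apply: eq_bigr => r _.
by rewrite !mulmxA (expmx_intertwine _ uA).
Qed.

Lemma trz_mulr N a b c (A : 'M[k]_a) (B : 'M[k]_b) (C : 'M[k]_c)
    (u : 'M[k]_(b, c)) f :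
  B *m u = u *m C -> trz N A C (f *m u) = trz N A B f *m u.
Proof.
move=> uA; rewrite mulmx_suml; apply: eq_bigr => r _.
by rewrite -!mulmxA (expmx_intertwine _ uA).
Qed.

Lemma trz_cst N a b (A : 'M[k]_a) (B : 'M[k]_b) f : A *m f = f *m B ->
  trz N A B f = N%:R *: (f *m B ^+ N.-1).
Proof.
move=> Af; rewrite /trz.
rewrite (eq_bigr (fun _ => f *m B ^+ N.-1)) => [|[r lt_r] _].
  by rewrite sumr_const card_ord scaler_nat.
rewrite (expmx_intertwine _ Af) -mulmxA mulmxE -exprD /= addnC.
by case: N lt_r => //= N lt_r; rewrite subSS subnK.
Qed.

Lemma trz_scale N a b (A : 'M[k]_a) (B : 'M[k]_b) c f :
  trz N A B (c *: f) = c *: trz N A B f.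
Proof.
by rewrite scaler_sumr; apply: eq_bigr => r _; rewrite mxmZ mxZm.
Qed.

Section Free.
Variable N : nat.

Definition zfree m (Z : 'M[k]_m) := exists th, trz N Z Z th = 1%:M.

Lemma zfree_retract m1 m (i : 'M[k]_(m, m1)) (p : 'M[k]_(m1, m)) Z1 Z :
  p *m i = 1%:M -> Z *m i = i *m Z1 -> Z1 *m p = p *m Z ->
  zfree Z -> zfree Z1.
Proof.
move=> pi Zi pZ [th thE]; exists (p *m th *m i).
by rewrite (trz_mulr _ _ _ Zi) (trz_mull _ _ _ pZ) thE mulmx1.
Qed.

(* On the lift of two witnesses for Z1 and Z2, trz is unipotent and commutes   *)
(* with Z; its inverse therefore turns this lift into a witness for Z.         *)
Lemma zfree_ext m1 m m2 (i : 'M[k]_(m, m1)) (p : 'M[k]_(m2, m)) i' p' Z1 Z Z2 :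
  i' *m i = 1%:M -> p *m p' = 1%:M -> i *m i' + p' *m p = 1%:M ->
  Z *m i = i *m Z1 -> p *m Z = Z2 *m p -> Z ^+ N = 0 ->
  zfree Z1 -> zfree Z2 -> zfree Z.
Proof.
move=> i'i pp' ii'pp' Zi pZ ZN [th1 th1E] [th2 th2E].
have pi : p *m i = 0.
  have := congr1 (fun x => p *m x *m i) ii'pp'.
  rewrite mulmxDr mulmxDl mulmx1 -!mulmxA i'i mulmx1.
  by rewrite [p *m (p' *m _)]mulmxA pp' mul1mx -[RHS]add0r => /addIr.
pose th := i *m th1 *m i' + p' *m th2 *m p.
pose U := trz N Z Z th.
have UE : U = trz N Z Z (i *m th1 *m i') + trz N Z Z (p' *m th2 *m p).
  by rewrite -big_split; apply: eq_bigr => r _ /=; rewrite mulmxDr mulmxDl.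
have cU : Z *m U = U *m Z.
  by apply/eqP; rewrite -subr_eq0 trz_comm ZN mul0mx mulmx0 subrr.
have Ui : U *m i = i.
  rewrite UE mulmxDl -!(trz_mulr _ _ _ Zi) -!mulmxA i'i pi !mulmx1 !mulmx0.
  rewrite (trz_mull _ _ _ Zi) th1E mulmx1.
  rewrite (_ : trz N Z Z1 0 = 0) ?addr0 // /trz big1 // => r _.
  by rewrite mulmx0 mul0mx.
have pU : p *m U = p.
  rewrite UE mulmxDr -!(trz_mull _ _ _ (esym pZ)) !mulmxA pi pp' !mul1mx !mul0mx.
  rewrite (trz_mulr _ _ _ (esym pZ)) th2E mul1mx.
  rewrite (_ : trz N Z2 Z 0 = 0) ?add0r // /trz big1 // => r _.
  by rewrite mulmx0 mul0mx.
have [V UV] : exists V, U = V + 1%:M by exists (U - 1%:M); rewrite subrK.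
have Vi : V *m i = 0.
  by apply: (addIr i); rewrite add0r -{3}Ui UV mulmxDl mul1mx.
have pV : p *m V = 0.
  by apply: (addIr p); rewrite add0r -{3}pU UV mulmxDr mulmx1.
have VV : V *m V = 0.
  rewrite -{2}[V]mul1mx -ii'pp' mulmxDl -!mulmxA pV mulmx0 addr0.
  by rewrite mulmxA Vi mul0mx.
have cV : Z *m V = V *m Z.
  by apply: (addIr Z); rewrite -{2}[Z]mulmx1 -mulmxDr -UV cU UV mulmxDl mul1mx.
exists (th *m (1%:M - V)); rewrite (@trz_mulr N _ _ _ Z Z Z) -/U.
  rewrite UV mulmxDl !mulmxBr !mul1mx !mulmx1 VV subr0.
  by rewrite addrC subrK.
by rewrite mulmxBr mulmxBl mulmx1 mul1mx cV.
Qed.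

Lemma zfree_iso m1 m (i : 'M[k]_(m, m1)) (p : 'M[k]_(m1, m)) Z1 Z :
  p *m i = 1%:M -> i *m p = 1%:M -> Z *m i = i *m Z1 ->
  zfree Z -> zfree Z1.
Proof.
move=> pi ip Zi; apply: (zfree_retract pi Zi).
by rewrite -[p *m Z]mulmx1 -ip !mulmxA -[p *m Z *m i]mulmxA Zi mulmxA pi mul1mx.
Qed.

Lemma zfree_scale m c (Z : 'M[k]_m) : c != 0 -> zfree (c *: Z) -> zfree Z.
Proof.
move=> c0 [th thE]; exists (c ^+ N.-1 *: th); rewrite trz_scale -thE.
rewrite scaler_sumr; apply: eq_bigr => -[r /= lt_r] _.
rewrite !expmxZ mxZm mxmZ mxZm scalerA -exprD.
by case: N lt_r => //= n lt_r; rewrite subSS subnK.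
Qed.

(** Z is a single Jordan block with cyclic vector f. The columns Z^j f and the rows g Z^(N-1-i) are
    dual bases up to the factor c, and the resulting expansion of c times the identity is the trace
    of f g. *)
Lemma zfree_cyclic (Z : 'M[k]_N) (f : 'cV[k]_N) (g : 'rV[k]_N) c :
  Z ^+ N = 0 -> c != 0 -> (forall j, (j < N)%N ->
    g *m Z ^+ j *m f = (if j == N.-1 then c else 0)%:M) -> zfree Z.
Proof.
move=> ZN c0 gZf; exists (c^-1 *: (f *m g)); rewrite trz_scale.
pose B : 'M[k]_N := \matrix_(i, j) (Z ^+ j *m f) i 0.
pose R : 'M[k]_N := \matrix_(i, j) (g *m Z ^+ (N - i.+1)) 0 j.
have RB : R *m B = c%:M.
  apply/matrixP => i j.
  have -> : (R *m B) i j = (g *m Z ^+ (N - i.+1 + j) *m f) 0 0.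
    rewrite exprD -mulmxE mulmxA -mulmxA mxE [RHS]mxE; apply: eq_bigr => s _.
    by rewrite !mxE.
  have ltiN := ltn_ord i; have ltjN := ltn_ord j.
  have [leNs|ltsN] := leqP N (N - i.+1 + j).
    rewrite -(subnK leNs) exprD ZN mulr0 mulmx0 mul0mx !mxE.
    by case: eqP => // eq_ij; exfalso; move: leNs; rewrite eq_ij; lia.
  rewrite gZf // mxE eqxx mxE mulr1n.
  rewrite (_ : (_ == N.-1) = (i == j)); first by case: eqP.
  by apply/eqP/eqP => [E|->]; [apply: ord_inj|]; lia.
have BR : B *m R = c%:M.
  have : (c^-1 *: R) *m B = 1%:M.
    by rewrite mxZm RB scale_scalar_mx mulVf.
  move/mulmx1C; rewrite mxmZ => /(congr1 (fun x => c *: x)).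
  by rewrite scalerA mulfV // scale1r scale_scalar_mx mulr1.
suff -> : trz N Z Z (f *m g) = c%:M by rewrite scale_scalar_mx mulVf.
rewrite -BR; apply/matrixP => i j; rewrite [RHS]mxE summxE; apply: eq_bigr => r _.
by rewrite mulmxA -mulmxA mxE big_ord1 !mxE.
Qed.
End Free.
End MatrixPowers.

(** * Pairs of q-commuting operators *)

Section QWeyl.
Variables (k : fieldType) (d : nat) (q : k).
Hypothesis d_gt1 : (1 < d)%N.
Hypothesis d_unit : d%:R != 0 :> k.
Hypothesis prq : d.-primitive_root q.

Let d_gt0 : (0 < d)%N := ltnW d_gt1.

Lemma prim_neq0 : q != 0.
Proof.
apply/eqP => q0; have := prim_expr_order prq.
by rewrite q0 expr0n gtn_eqF // => /eqP; rewrite eq_sym oner_eq0.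
Qed.

Lemma prim_1B : 1 - q != 0.
Proof.
rewrite subr_eq0 eq_sym -[q]expr1 -(prim_order_dvd prq) dvdn1.
by rewrite gtn_eqF.
Qed.

Lemma qbinomial_prim m (A B : 'M[k]_m) :
  B * A = q *: (A * B) -> (A + B) ^+ d = A ^+ d + B ^+ d.
Proof.
move=> qAB; rewrite (qbinomial _ qAB) big_ord_recr /= subnn qbin_diag.
rewrite scale1r expr0 mulr1 addrC; congr (_ + _).
rewrite (bigD1 (Ordinal d_gt0)) //= qbin0 scale1r expr0 mul1r subn0.
rewrite big1 ?addr0 // => i neq_i0; rewrite (qbin_prim prq) ?scale0r //.
by rewrite ltn_ord andbT lt0n.
Qed.

(** Both sides are the constant term of X^d - 1 = \prod_i (X - q^i). *)
Lemma prim_sign : (-1) ^+ d * q ^+ 'C(d, 2) = -1.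
Proof.
have := factor_Xn_sub_1 prq => /(congr1 (fun p : {poly k} => p.[0])).
rewrite hornerD hornerN hornerXn hornerC expr0n gtn_eqF // add0r => E.
rewrite -[RHS]E horner_prod (eq_bigr (fun i => -1 * q ^+ i)) => [|i _]; last first.
  by rewrite !hornerE mulN1r.
rewrite big_split /= prodr_const_nat subn0; congr (_ * _).
rewrite -bin2_sum; apply: (big_ind2 (fun a b => q ^+ a = b)) => //.
by move=> a b a' b' <- <-; rewrite exprD.
Qed.


(** * Powers of z in the q-Weyl algebra *)

Section WeylPair.
Variables (m : nat) (x y : 'M[k]_m) (c : k).
Hypothesis cE : c * (1 - q) = 1.
Hypothesis yx : y * x = q^-1 *: (x * y - 1).
Let z := x * y - c *: (1 : 'M[k]_m).

Lemma weyl_zx : z * x = q^-1 *: (x * z).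
Proof.
have q0 := prim_neq0; have q1 := prim_1B.
rewrite /z; have -> : c = (1 - q)^-1 by rewrite -[c](mulfK q1) cE mul1r.
rewrite mulrBl mxZl mul1r -mulrA yx mulrBr mxZr mxZr mulr1 mulrBr mulr1.
rewrite !scalerBr !scalerA -addrA -opprD -scalerDl; congr (_ - _ *: _).
by field; rewrite q0 q1.
Qed.

(** Since y = c x^-1 + x^-1 z with q-commuting terms, y^d is c^d x^-d plus a nonzero multiple of
    x^-d z^d. Comparison with y^d = s'^d gives z^d. *)
Lemma weyl_zpow s s' (xi : 'M[k]_m) : s * s' = c -> x * xi = 1 -> xi * x = 1 ->
  y ^+ d = s' ^+ d *: (1 : 'M[k]_m) -> exists e, z ^+ d = e *: (x ^+ d - s ^+ d *: (1 : 'M[k]_m)).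
Proof.
move=> ss' xxi xix yd; have q0 := prim_neq0.
have zxi : z * xi = q *: (xi * z).
  rewrite -[z * xi]mul1r -xix -!mulrA [x * _]mulrA.
  have -> : x * z = q *: (z * x) by rewrite weyl_zx scalerA mulfV ?scale1r.
  by rewrite mxZl -mulrA xxi mulr1 mxZr.
have yE : y = c *: xi + xi * z.
  by rewrite /z mulrBr mulrA xix mul1r mxZr mulr1 addrC subrK.
have yd' : y ^+ d = c ^+ d *: xi ^+ d + q ^+ 'C(d, 2) *: (xi ^+ d * z ^+ d).
  rewrite yE qbinomial_prim ?expmxZ ?(qcommMX _ zxi) //.
  by rewrite mxZl mxZr -mulrA zxi mxZr !scalerA mulrC.
have xd : x ^+ d * xi ^+ d = 1.
  elim: {yd yd'} d => [|r IH]; first by rewrite !expr0 mulr1.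
  by rewrite exprSr exprS -mulrA [x * _]mulrA xxi mul1r.
have := congr1 (fun A => x ^+ d * A) yd'.
rewrite /= yd mulrDr !mxZr mulrA xd mul1r mulr1 => E.
exists (q ^- 'C(d, 2) * s' ^+ d).
rewrite -scalerA scalerBr E -{}ss' exprMn scalerA [s' ^+ d * _]mulrC addrC addKr.
by rewrite scalerA mulVf ?scale1r // expf_neq0.
Qed.
End WeylPair.

(** * Eigenspaces of an operator h with h^d = 1 *)

Section Eigenprojections.
Variables (m : nat) (h t t' : 'M[k]_m).
Hypothesis hd : h ^+ d = 1.
Hypothesis th : t * h = q^-1 *: (h * t).
Hypothesis tt' : t * t' = 1.
Hypothesis t't : t' * t = 1.

(** The projection onto the q^r-eigenspace of h. *)
Let E r := d%:R^-1 *: \sum_(j < d) q ^- (r * j) *: h ^+ j.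

Let hE r : h * E r = q ^+ r *: E r.
Proof.
have q0 := prim_neq0.
rewrite mxZr scalerA [_ * d%:R^-1]mulrC -scalerA; congr (_ *: _).
rewrite mulr_sumr scaler_sumr.
case: d d_gt0 hd (prim_expr_order prq) => // e _ he qe.
rewrite big_ord_recr [RHS]big_ord_recl /= addrC; congr (_ + _).
  rewrite mxZr -exprS he muln0 expr0 invr1 expr0 scale1r; congr (_ *: _).
  apply: (mulfI (expf_neq0 (r * e) q0)); rewrite mulfV ?expf_neq0 //.
  by rewrite -exprD -mulnSr mulnC exprM qe expr1n.
apply: eq_bigr => j _; rewrite mxZr -exprS scalerA /bump add1n; congr (_ *: _).
by rewrite mulnSr exprD invfM mulrCA mulfV ?mulr1 // expf_neq0.
Qed.

Let tE r : t * E r = E r.+1 * t.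
Proof.
rewrite mxZr mxZl mulr_sumr mulr_suml; congr (_ *: _); apply: eq_bigr => j _.
rewrite mxZr mxZl (qcommX _ th) scalerA mulSn addnC exprD invfM exprVn.
by [].
Qed.

Let Eh r : E r * h = q ^+ r *: E r.
Proof.
rewrite -hE mxZr mxZl mulr_sumr mulr_suml; congr (_ *: _); apply: eq_bigr => j _.
by rewrite mxZr mxZl -exprS -exprSr.
Qed.

Let sumE : \sum_(r < d) E r = 1.
Proof.
have q0 := prim_neq0.
rewrite -scaler_sumr exchange_big /= (bigD1 (Ordinal d_gt0)) //=.
rewrite [X in _ + X]big1 ?addr0 => [|j neq_j0].
  apply: (canLR (scalerK d_unit)).
  under eq_bigr => r _ do rewrite muln0 expr0 invr1 scale1r.
  by rewrite sumr_const card_ord scaler_nat.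
rewrite -scaler_suml (_ : \sum_(r < d) _ = 0) ?scale0r //.
have qj1 : q ^- j - 1 != 0.
  rewrite subr_eq0 invr_eq1 -(prim_order_dvd prq) gtnNdvd //.
  by rewrite lt0n.
apply: (mulfI qj1); rewrite mulr0.
rewrite (eq_bigr (fun r : 'I_d => (q ^- j) ^+ r)) => [|r _].
  by rewrite -subrX1 exprVn -exprM mulnC exprM (prim_expr_order prq) expr1n invr1 subrr.
by rewrite exprVn -exprM mulnC.
Qed.

Let Z := (1 - h) * t.

Let ZE r : Z ^+ r * E 0 = \prod_(0 <= i < r) (1 - q ^+ i.+1) *: (E r * t ^+ r).
Proof.
elim: r => [|r IH]; first by rewrite big_nil !expr0 mul1r mulr1 scale1r.
rewrite exprS -mulrA IH big_nat_recr //= mxZr -scalerA; congr (_ *: _).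
rewrite mulrA -[_ * t * _]mulrA tE mulrA mulrBl mul1r hE -{1}[E _]scale1r.
by rewrite -scalerBl !mxZl -mulrA -exprS.
Qed.

Let EZ a b : E (a + b) * Z ^+ b =
  \prod_(a <= i < a + b) (1 - q ^+ i.+1) *: (t ^+ b * E a).
Proof.
elim: b => [|b IH].
  by rewrite addn0 big_geq // !expr0 mul1r mulr1 scale1r.
rewrite exprS mulrA /Z addnS mulrA mulrBr mulr1 Eh -{1}[E _]scale1r -scalerBl.
rewrite mxZl -tE mxZl -mulrA IH big_nat_recr ?leq_addr //= mulrC mxZr scalerA.
by rewrite mulrA -exprS.
Qed.

(* (1 - h) t maps the q^r-eigenspace of h to the q^(r+1)-eigenspace, and is    *)
(* invertible there except when r + 1 is divisible by d.                      *)
Lemma zfree_qprod : zfree d ((1 - h) * t).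
Proof.
have q0 := prim_neq0; pose C := \prod_(0 <= i < d.-1) (1 - q ^+ i.+1).
have C0 : C != 0.
  rewrite prodf_seq_neq0; apply/allP => i; rewrite mem_index_iota /= => lt_i.
  rewrite subr_eq0 eq_sym -(prim_order_dvd prq) gtnNdvd //.
  by rewrite -(ltn_predK d_gt1) ltnS.
have t'E r : t' * E r.+1 = E r * t'.
  by rewrite -[t' * _]mulr1 -tt' mulrA -[t' * _ * t]mulrA -tE mulrA t't mul1r.
have t'XE r : t' ^+ r * E r = E 0 * t' ^+ r.
  elim: r => [|r IH]; first by rewrite !expr0 mul1r mulr1.
  by rewrite exprSr -mulrA t'E mulrA IH mulrA.
have ttX r : t ^+ r * t' ^+ r = 1.
  elim: r => [|r IH]; first by rewrite !expr0 mulr1.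
  by rewrite exprSr exprS -mulrA [t * _]mulrA tt' mul1r.
have t'tX a b : t' ^+ (a + b) * t ^+ b = t' ^+ a.
  elim: b => [|b IH]; first by rewrite addn0 expr0 mulr1.
  by rewrite addnS exprSr exprS -mulrA [t' * _]mulrA t't mul1r.
(* This witness carries the q^(d-1)-eigenspace back to the 1-eigenspace and kills the others.
   Multiplied by Z^r on the left and Z^(d-1-r) on the right, it becomes [E r]: the two partial
   products of factors 1 - q^(i+1) combine into [C]. *)
exists (C^-1 *: (t' ^+ d.-1 * E d.-1)).
rewrite trz_scale; apply: (canLR (scalerK C0)).
have -> : 1%:M = \sum_(r < d) E r by rewrite sumE.
rewrite scaler_sumr; apply: eq_bigr => -[r /= lt_r] _.
have [b def_d] : exists b, d = (r + b).+1 by exists (d - r.+1)%N; lia.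
rewrite -/Z /C !mulmxE def_d /= (_ : ((r + b).+1 - r.+1)%N = b); last by lia.
rewrite -[_ * _ * Z ^+ b]mulrA -[_ * _ * Z ^+ b]mulrA EZ mxZr mxZr.
rewrite [t' ^+ _ * _]mulrA t'tX t'XE [Z ^+ r * _]mulrA ZE mxZl.
rewrite -mulrA ttX mulr1 scalerA mulrC.
by rewrite -big_cat_nat ?leq_addr.
Qed.
End Eigenprojections.


(** This operator is z on V (x) L, up to conjugation, when L is replaced by a one-dimensional
    factor: s is the parameter of z, sg that of V, xi and eta are the values of x and y on the
    factor, and gam is the ratio of G to K on L. It factors as (1 - q) z = (1 - h) t with h a
    multiple of x and t = (gam / xi) K (s S - sg). Since S^n = 1 and s^n differs from sg^n, the
    factor t is invertible, and [zfree_qprod] applies. *)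
Lemma zfree_shift n m (S R K : 'M[k]_m) s s' sg sg' xi eta gam c :
  c * (1 - q) = 1 -> s * s' = c -> sg * sg' = c -> xi * eta = c ->
  xi ^+ d = sg ^+ d -> gam ^+ d = 1 -> s ^+ n != sg ^+ n ->
  S * R = 1 -> R * S = 1 -> S ^+ n = 1 -> K ^+ d = 1 -> R * K = q *: (K * R) ->
  zfree d ((xi *: R - (sg * gam) *: (K * R) + (s * gam) *: K) *
           (eta *: S - sg' *: (K * S) + s' *: K) - c *: (1 : 'M[k]_m)).
Proof.
move=> cE sE sgE xiE xid gamd neq_s SR RS Sn Kd RK.
have q0 := prim_neq0; have q1 := prim_1B.
have c0 : c != 0 by apply: contra_eqN cE => /eqP->; rewrite mul0r eq_sym oner_eq0.
have [s0 s'0] : s != 0 /\ s' != 0 by apply/andP; rewrite -negb_or -mulf_eq0 sE.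
have [sg0 sg'0] : sg != 0 /\ sg' != 0.
  by apply/andP; rewrite -negb_or -mulf_eq0 sgE.
have [xi0 eta0] : xi != 0 /\ eta != 0.
  by apply/andP; rewrite -negb_or -mulf_eq0 xiE.
have gam0 : gam != 0.
  by apply: contra_eqN gamd => /eqP->; rewrite expr0n gtn_eqF // eq_sym oner_eq0.
have SK : S * K = q^-1 *: (K * S).
  rewrite -[S * K]mulr1 -RS -!mulrA [K * _]mulrA.
  have -> : K * R = q^-1 *: (R * K) by rewrite RK scalerA mulVf ?scale1r.
  by rewrite mxZl !mxZr !mulrA SR mul1r.
have SKR : S * (K * R) = q^-1 *: K by rewrite mulrA SK mxZl -mulrA SR mulr1.
set x := _ - _ + _; set y := _ - _ + _.
pose t := xi^-1 *: (x * S) - 1; pose h := (xi / (s * sg * gam)) *: x.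
have xS : x * S = xi *: (1 : 'M[k]_m) - (sg * gam) *: K + (s * gam) *: (K * S).
  by rewrite mulrDl mulrBl !mxZl -mulrA RS mulr1.
have Sx : S * x = (xi * (1 - q^-1)) *: (1 : 'M[k]_m) + q^-1 *: (x * S).
  rewrite xS mulrDr mulrBr !mxZr SR SKR SK.
  move: (K * S) (1 : 'M[k]_m) => KS I.
  by apply/matrixP => i j; rewrite !mxE; ring.
have tE : t = (gam / xi) *: (K * (s *: S - sg *: (1 : 'M[k]_m))).
  rewrite /t xS mulrBr !mxZr mulr1.
  move: (K * S) (1 : 'M[k]_m) => KS I.
  by apply/matrixP => i j; rewrite !mxE; field.
have cq : c = (1 - q)^-1 by rewrite -[c](mulfK q1) cE mul1r.
have zE : (1 - q) *: (x * y - c *: (1 : 'M[k]_m)) = (1 - h) * t.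
  rewrite mulrBl mul1r [h * t]mxZl {2}tE mxZr mulrA mulrBr !mxZr mulr1 /t.
  rewrite /y mulrDr mulrBr !mxZr !mulrA.
  have -> : s' = c / s by rewrite -sE mulrAC mulfV // mul1r.
  have -> : sg' = c / sg by rewrite -sgE mulrAC mulfV // mul1r.
  have -> : eta = c / xi by rewrite -xiE mulrAC mulfV // mul1r.
  rewrite cq -[x * K * S]mulrA.
  move: (x * (K * S)) (x * K) (x * S) (1 : 'M[k]_m) => xKS xK xS' I.
  apply/matrixP => i j; rewrite !mxE; field.
  by rewrite q1 s0 sg0 xi0 gam0.
have tx : t * x = q^-1 *: (x * t).
  rewrite mulrBl mul1r mxZl -mulrA Sx mulrDr !mxZr mulr1 /t [in RHS]mulrBr mxZr mulr1.
  move: (x * (x * S)) => xxS.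
  by apply/matrixP => i j; rewrite !mxE; field; rewrite q0 xi0.
have th : t * h = q^-1 *: (h * t) by rewrite mxZr tx mxZl !scalerA mulrC.
pose B := s *: K - sg *: (K * R).
have KRd : (K * R) ^+ d = q ^+ 'C(d, 2) *: R ^+ d.
  by rewrite (qcommMX _ RK) Kd mul1r.
have Bd : B ^+ d = s ^+ d *: (1 : 'M[k]_m) - sg ^+ d *: R ^+ d.
  rewrite /B -scaleNr qbinomial_prim; last first.
    by rewrite !mxZl !mxZr -!mulrA RK mxZr !scalerA; congr (_ *: _); ring.
  rewrite !expmxZ KRd Kd scalerA -mulN1r exprMn mulrAC prim_sign mulN1r scaleNr.
  by [].
(* In x = gam B + xi R the two terms q-commute, and their contributions in R^d cancel because gam^d
   = 1 and xi^d = sg^d. *)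
have xd : x ^+ d = s ^+ d *: (1 : 'M[k]_m).
  have -> : x = gam *: B + xi *: R.
    rewrite /x /B; move: (K * R) => KR.
    by apply/matrixP => i j; rewrite !mxE; ring.
  rewrite qbinomial_prim ?expmxZ ?Bd ?gamd ?xid ?scale1r ?subrK //.
  rewrite !mxZl !mxZr mulrBr mulrBl !mxZr !mxZl RK mulrA RK !mxZl.
  move: (K * R * R) (K * R) => KRR KR.
  by apply/matrixP => i j; rewrite !mxE; ring.
have hd : h ^+ d = 1.
  rewrite expmxZ xd scalerA -exprMn.
  rewrite (_ : _ * s = xi / sg / gam); last by field; rewrite sg0 gam0 s0.
  rewrite !exprMn !exprVn xid gamd mulfV ?expf_neq0 // invr1 mulr1 scale1r //.
have [V UV] : exists V, (s *: S - sg *: (1 : 'M[k]_m)) * V = 1.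
  have cSU : GRing.comm (s *: S) (sg *: (1 : 'M[k]_m)).
    by rewrite /GRing.comm mxZl mxZr mxZr mxZl mulr1 mul1r !scalerA mulrC.
  have := subrXX_comm n cSU; rewrite !expmxZ Sn expr1n -scalerBl => E.
  exists ((s ^+ n - sg ^+ n)^-1 *: \sum_(i < n) (s *: S) ^+ (n.-1 - i) *
    (sg *: (1 : 'M[k]_m)) ^+ i).
  by rewrite mxZr -E scalerA mulVf ?scale1r // subr_eq0.
have [t' tt'] : exists t', t * t' = 1.
  exists ((xi / gam) *: (V * K ^+ d.-1)).
  rewrite tE mxZl mxZr -mulrA [_ * (V * _)]mulrA UV mul1r -exprS prednK // Kd.
  by rewrite scalerA (_ : _ * _ = 1) ?scale1r //; field; rewrite gam0 xi0.
apply: (zfree_scale q1); rewrite zE; apply: (zfree_qprod hd th tt').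
by move: tt'; rewrite -!mulmxE => /mulmx1C.
Qed.
End QWeyl.

(** * Induced modules *)

Section Double.
Variables (k : closedFieldType) (T : taft_data k).
Local Notation n := (tn T).
Local Notation d := (td T).
Local Notation q := (tq T).
Local Notation Zn := ('Z_(tn T)).
Local Notation dmod := (dmod T).
Implicit Types M N L P Y : dmod.

Let q0 : q != 0 := tq_neq0 T.
Let prq : d.-primitive_root q := tq_prim T.
Let q1 : 1 - q != 0 := prim_1B (td_ge2 T) prq.

Definition c0 : k := (1 - q)^-1.

Lemma c0E : c0 * (1 - q) = 1.
Proof. by rewrite mulVf. Qed.

Lemma c0_neq0 : c0 != 0.
Proof. by rewrite invr_neq0. Qed.

Lemma td_unit : d%:R != 0 :> k.
Proof.
apply: contraNneq (tn_inv T) => d0.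
by rewrite -(divnK (td_dvd_n T)) natrM d0 mulr0.
Qed.

Lemma expX_n (x : k) : x ^+ d = 1 -> x ^+ n = 1.
Proof. by move=> xd; rewrite -(divnK (td_dvd_n T)) mulnC exprM xd expr1n. Qed.

Lemma q_expn : q ^+ n = 1.
Proof. exact: expX_n (prim_expr_order prq). Qed.

Lemma qpow_exp_d (i : Zn) : qpow i ^+ d = 1.
Proof. by rewrite /qpow -exprM mulnC exprM (prim_expr_order prq) expr1n. Qed.

Lemma qpow_neq0 (i : Zn) : qpow i != 0.
Proof. exact: expf_neq0. Qed.

Section Homs.
Variables M N : dmod.

Lemma dhom_A f : is_dhom f -> f *m sumA M = sumA N *m f.
Proof.
move=> hf; rewrite mulmx_sumr mulmx_suml; apply: eq_bigr => i _; exact: dhom_a.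
Qed.

Lemma dhom_K f : is_dhom f -> f *m sumK M = sumK N *m f.
Proof.
move=> hf; rewrite mulmx_sumr mulmx_suml; apply: eq_bigr => i _.
by rewrite mxmZ mxZm (dhom_e hf).
Qed.

Lemma dhom_total f : (forall i, f *m de M i = de N i *m f) ->
  f *m sumA M = sumA N *m f -> f *m dG M = dG N *m f ->
  f *m dX M = dX N *m f -> is_dhom f.
Proof.
move=> fe fA fG fX; split=> // i; rewrite !da_eq -!mulmxE mulmxA fA.
by rewrite -!mulmxA fe.
Qed.
End Homs.

Lemma dhom_id M : is_dhom (1%:M : 'M[k]_(ddim M)).
Proof. by split=> *; rewrite mulmx1 mul1mx. Qed.

Lemma dhom_mul M N P (f : 'M[k]_(ddim N, ddim M)) (g : 'M[k]_(ddim P, ddim N)) :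
  is_dhom f -> is_dhom g -> is_dhom (g *m f).
Proof.
move=> hf hg; split=> [i|i||].
- by rewrite -mulmxA (dhom_e hf) !mulmxA (dhom_e hg).
- by rewrite -mulmxA (dhom_a hf) !mulmxA (dhom_a hg).
- by rewrite -mulmxA (dhom_G hf) !mulmxA (dhom_G hg).
- by rewrite -mulmxA (dhom_X hf) !mulmxA (dhom_X hg).
Qed.

Lemma dhom_add M N (f g : 'M[k]_(ddim N, ddim M)) :
  is_dhom f -> is_dhom g -> is_dhom (f + g).
Proof.
move=> hf hg; split=> [i|i||]; rewrite mulmxDl mulmxDr.
- by rewrite (dhom_e hf) (dhom_e hg).
- by rewrite (dhom_a hf) (dhom_a hg).
- by rewrite (dhom_G hf) (dhom_G hg).
- by rewrite (dhom_X hf) (dhom_X hg).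
Qed.

Lemma dhom_opp M N (f : 'M[k]_(ddim N, ddim M)) : is_dhom f -> is_dhom (- f).
Proof.
move=> hf; split=> [i|i||]; rewrite mulNmx mulmxN.
- by rewrite (dhom_e hf).
- by rewrite (dhom_a hf).
- by rewrite (dhom_G hf).
- by rewrite (dhom_X hf).
Qed.

Lemma dhom_inj_l M N P (f : 'M[k]_(ddim N, ddim M)) (g : 'M[k]_(ddim P, ddim N)) g' :
  g' *m g = 1%:M -> is_dhom g -> is_dhom (g *m f) -> is_dhom f.
Proof.
move=> g'g hg hgf; have inj r (a b : 'M[k]_(_, r)) : g *m a = g *m b -> a = b.
  by move=> /(congr1 (mulmx g')); rewrite !mulmxA g'g !mul1mx.
split=> [i|i||]; apply: inj; rewrite mulmxA.
- by rewrite (dhom_e hgf) !mulmxA (dhom_e hg).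
- by rewrite (dhom_a hgf) !mulmxA (dhom_a hg).
- by rewrite (dhom_G hgf) !mulmxA (dhom_G hg).
- by rewrite (dhom_X hgf) !mulmxA (dhom_X hg).
Qed.

Section Operators.
Variable M : dmod.

Lemma e_shift (i : Zn) : de M i *m sumA M = sumA M *m de M (i - 1).
Proof. by rewrite -{1}[i](subrK 1) mulmxE deA. Qed.

Lemma e_shiftX (i : Zn) : de M i *m dX M = dX M *m de M (i + 1).
Proof. by rewrite mulmxE deX. Qed.

Lemma Ke i : sumK M *m de M i = qpow i *: de M i.
Proof. exact: totKe (@de_orth _ _ M) i. Qed.

Lemma eK i : de M i *m sumK M = qpow i *: de M i.
Proof. exact: toteK (@de_orth _ _ M) i. Qed.

Lemma KX_exp r : sumK M ^+ r = \sum_i qpow i ^+ r *: de M i.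
Proof.
elim: r => [|r IH].
  by rewrite expr0 -(de_sum M); apply: eq_bigr => i _; rewrite scale1r.
rewrite exprSr IH mulr_suml; apply: eq_bigr => i _.
by rewrite mxZl -mulmxE eK scalerA -exprSr.
Qed.

Lemma Kd : sumK M ^+ d = 1.
Proof.
rewrite KX_exp -(de_sum M); apply: eq_bigr => i _.
by rewrite qpow_exp_d scale1r.
Qed.

Definition opx s := dX M + s *: dG M.
Definition opy s := sumA M + (c0 / s) *: sumK M.
Definition zop s := opx s * opy s - c0 *: (1 : 'M[k]_(ddim M)).

Lemma op_yx s : s != 0 -> opy s * opx s = q^-1 *: (opx s * opy s - 1).
Proof.
move=> s0; rewrite /opx /opy !mulrDl !mulrDr !mxZl !mxZr dAX dAG dKX -dGK /c0.
move: (dX M * sumA M) (dG M * sumK M) (dG M * sumA M) (dX M * sumK M).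
move=> XA GK GA XK; apply/matrixP => i j; rewrite !mxE; field.
by rewrite q0 q1 s0.
Qed.

Lemma opx_d s : opx s ^+ d = s ^+ d *: dG M ^+ d.
Proof.
rewrite /opx addrC (qbinomial_prim (td_ge2 T) prq) ?expmxZ ?dX_nilp ?addr0 //.
by rewrite mxZl mxZr dGX !scalerA; congr (_ *: _); field.
Qed.

Lemma opx_n s : opx s ^+ n = s ^+ n *: (1 : 'M[k]_(ddim M)).
Proof.
rewrite -(divnK (td_dvd_n T)) mulnC exprM opx_d expmxZ -!exprM.
by rewrite mulnC divnK ?td_dvd_n // dG_order.
Qed.

Lemma opy_d s : opy s ^+ d = (c0 / s) ^+ d *: (1 : 'M[k]_(ddim M)).
Proof.
rewrite /opy (qbinomial_prim (td_ge2 T) prq) ?expmxZ ?dA_nilp ?Kd ?add0r //.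
by rewrite mxZl mxZr dKA !scalerA mulrC.
Qed.

(** By [weyl_zpow] z^d is a multiple of x^d - s^d, and x^d = s^d G^d because X and s G q-commute and
    X^d = 0. *)
Lemma zop_d s : s != 0 ->
  exists e, zop s ^+ d = e *: (dG M ^+ d - 1).
Proof.
move=> s0; have [u xu ux] : exists2 u, opx s * u = 1 & u * opx s = 1.
  have n_gt0 := ltnW (tn_gt1 T).
  have sn0 : s ^+ n != 0 by rewrite expf_neq0.
  exists (s ^- n *: opx s ^+ n.-1).
    by rewrite mxZr -exprS prednK // opx_n scalerA mulVf ?scale1r.
  by rewrite mxZl -exprSr prednK // opx_n scalerA mulVf ?scale1r.
have sc : s * (c0 / s) = c0 by rewrite mulrC mulfVK.
have [e zE] := weyl_zpow (td_ge2 T) prq c0E (op_yx s0) sc xu ux (opy_d s).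
by exists (e * s ^+ d); rewrite /zop zE opx_d -scalerBr scalerA.
Qed.

(** This makes z nilpotent of order d for every parameter. It holds for the simple modules L(u,i)
    and is inherited by tensor products and extensions. *)
Definition tame := dG M ^+ d = 1.

Lemma tame_zop s : tame -> s != 0 -> zop s ^+ d = 0.
Proof. by move=> tM /zop_d[e ->]; rewrite tM subrr scaler0. Qed.
End Operators.

Lemma dhom_opx M N (f : 'M[k]_(ddim N, ddim M)) s : is_dhom f ->
  f *m opx M s = opx N s *m f.
Proof.
move=> hf; rewrite /opx mulmxDr mulmxDl mxmZ mxZm.
by rewrite (dhom_X hf) (dhom_G hf).
Qed.

Lemma dhom_opy M N (f : 'M[k]_(ddim N, ddim M)) s : is_dhom f ->
  f *m opy M s = opy N s *m f.
Proof.
move=> hf; rewrite /opy mulmxDr mulmxDl mxmZ mxZm.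
by rewrite (dhom_A hf) (dhom_K hf).
Qed.

Lemma dhom_zop M N (f : 'M[k]_(ddim N, ddim M)) s : is_dhom f ->
  f *m zop M s = zop N s *m f.
Proof.
move=> hf; rewrite /zop -!mulmxE mulmxBr mulmxBl mxmZ mxZm mulmx1 mul1mx.
by rewrite mulmxA (dhom_opx _ hf) -!mulmxA (dhom_opy _ hf).
Qed.

Lemma sumA_tens M N :
  sumA (dtens M N) = 1 *t sumA N + sumA M *t sumK N.
Proof.
rewrite /sumA /= (eq_bigr _ (fun i _ => tens_aE M N i)).
by rewrite -mulr_sumr tens_sum mulr1.
Qed.

Lemma sumK_tens M N : sumK (dtens M N) = sumK M *t sumK N.
Proof. exact: tens_K. Qed.

Lemma dtens_e M N i : de (dtens M N) i = \sum_j de M j *t de N (i - j).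
Proof. by []. Qed.

Lemma dtens_G M N : dG (dtens M N) = dG M *t dG N.
Proof. by []. Qed.

Lemma dtens_X M N : dX (dtens M N) = dX M *t dG N + 1 *t dX N.
Proof. by []. Qed.

Lemma tame_tens M N : tame M -> tame N -> tame (dtens M N).
Proof. by rewrite /tame dtens_G tensX => -> ->; rewrite tens11. Qed.

Lemma e_dec M r (A B : 'M[k]_(ddim M, r)) :
  (forall i, de M i *m A = de M i *m B) -> A = B.
Proof.
move=> AB; rewrite -[A]mul1mx -[B]mul1mx -[1%:M](de_sum M) !mulmx_suml.
by apply: eq_bigr => i _.
Qed.

Lemma ee M i j : de M i *m de M j = if i == j then de M i else 0.
Proof. by rewrite mulmxE de_orth. Qed.

Lemma eeM M i j r (A : 'M[k]_(ddim M, r)) :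
  de M i *m (de M j *m A) = if i == j then de M i *m A else 0.
Proof. by rewrite mulmxA mulmxE de_orth; case: eqP; rewrite ?mul0mx. Qed.

Lemma Ge_mx M i r (A : 'M[k]_(ddim M, r)) :
  dG M *m (de M i *m A) = de M i *m (dG M *m A).
Proof. by rewrite !mulmxA !mulmxE dGe. Qed.

(** * Frobenius reciprocity for the coideal subalgebra *)

Section Induced.
Variable s : k.

(* P is induced, along w, from a module over the right coideal subalgebra of D *)
(* generated by X + s G, a + c0 s^-1 K and K^-1 G, on which these three       *)
(* elements act by x, y and c.                                                *)
Record induced P m (w : 'M[k]_(ddim P, m)) (rho : Zn -> 'M[k]_(m, ddim P))
    (x y c : 'M[k]_m) : Prop := Induced {
  ind_x : opx P s *m w = w *m x;
  ind_y : opy P s *m w = w *m y;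
  ind_c : dG P *m w = sumK P *m w *m c;
  ind_rho : forall i j, rho i *m de P j *m w = if i == j then 1%:M else 0;
  ind_sum : \sum_i de P i *m w *m rho i = 1%:M }.

Section Frobenius.
Variables (P : dmod) (m : nat) (w : 'M[k]_(ddim P, m)).
Variables (rho : Zn -> 'M[k]_(m, ddim P)) (x y c : 'M[k]_m).
Hypothesis indP : induced w rho x y c.

Lemma ind_inj r (A B : 'M[k]_(m, r)) : w *m A = w *m B -> A = B.
Proof.
move=> /(congr1 (mulmx (rho 0 *m de P 0))); rewrite !mulmxA (ind_rho indP) eqxx.
by rewrite !mul1mx.
Qed.

Lemma ind_ext Y (f g : 'M[k]_(ddim Y, ddim P)) :
  (forall i, f *m de P i *m w = g *m de P i *m w) -> f = g.
Proof.
move=> fg; rewrite -[f]mulmx1 -[g]mulmx1 -(ind_sum indP) !mulmx_sumr.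
by apply: eq_bigr => i _; rewrite !mulmxA fg.
Qed.

Variables (Y : dmod) (phi : 'M[k]_(ddim Y, m)).
Hypothesis phi_x : opx Y s *m phi = phi *m x.
Hypothesis phi_y : opy Y s *m phi = phi *m y.
Hypothesis phi_c : dG Y *m phi = sumK Y *m phi *m c.

(** The map sending e_i w to e_i phi. By [ind_rho] and [ind_sum], P is the direct sum over i of
    copies of the inducing space embedded by e_i w. *)
Definition extend := \sum_i de Y i *m phi *m rho i.

Lemma extend_e i : extend *m de P i *m w = de Y i *m phi.
Proof.
rewrite -mulmxA mulmx_suml (bigD1 i) //= -mulmxA (mulmxA (rho i)).
rewrite (ind_rho indP) eqxx mulmx1.
rewrite big1 ?addr0 // => j neq_ji.
by rewrite -mulmxA (mulmxA (rho j)) (ind_rho indP) (negPf neq_ji) mulmx0.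
Qed.

Lemma extend_w : extend *m w = phi.
Proof.
have E M r (u : 'M[k]_(ddim M, r)) : \sum_j de M j *m u = u.
  by rewrite -mulmx_suml de_sum mul1mx.
rewrite -{1}[w]E mulmx_sumr -[RHS]E.
by apply: eq_bigr => i _; rewrite mulmxA extend_e.
Qed.

Lemma eG_w (M : dmod) r (u : 'M[k]_(ddim M, r)) e i :
  dG M *m u = sumK M *m u *m e ->
  de M i *m (dG M *m u) = qpow i *: (de M i *m u *m e).
Proof. by move=> ->; rewrite !mulmxA eK !mxZm. Qed.

Lemma eX_w (M : dmod) r (u : 'M[k]_(ddim M, r)) a e i :
  opx M s *m u = u *m a -> dG M *m u = sumK M *m u *m e ->
  dX M *m (de M (i + 1) *m u) =
    de M i *m u *m a - (s * qpow i) *: (de M i *m u *m e).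
Proof.
move=> ua ue; rewrite mulmxA -e_shiftX -mulmxA.
have -> : dX M *m u = u *m a - s *: (dG M *m u).
  by rewrite -ua mulmxDl mxZm addrK.
by rewrite mulmxBr mxmZ (eG_w _ ue) scalerA mulmxA.
Qed.

Lemma eA_w (M : dmod) r (u : 'M[k]_(ddim M, r)) b i :
  opy M s *m u = u *m b ->
  sumA M *m (de M i *m u) =
    de M (i + 1) *m u *m b - (c0 / s * qpow (i + 1)) *: (de M (i + 1) *m u).
Proof.
move=> ub; rewrite -[i in LHS](addrK 1) mulmxA -e_shift -mulmxA.
have -> : sumA M *m u = u *m b - (c0 / s) *: (sumK M *m u).
  by rewrite -ub mulmxDl mxZm addrK.
by rewrite mulmxBr mxmZ [_ *m (sumK _ *m _)]mulmxA eK mxZm scalerA mulmxA.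
Qed.

(** Moving e_i past G, X and a expresses their action on e_i w through x, y and c alone; the
    formulas [eG_w], [eX_w] and [eA_w] hold verbatim for phi. *)
Lemma extend_dhom : is_dhom extend.
Proof.
have Fe i : extend *m (de P i *m w) = de Y i *m phi.
  by rewrite mulmxA extend_e.
apply: dhom_total => [i|||]; apply: ind_ext => j; rewrite -!mulmxA.
- by rewrite Fe !eeM; case: eqP => _; rewrite ?mulmx0 ?Fe.
- rewrite (eA_w _ (ind_y indP)) mulmxBr mxmZ [extend *m (_ *m y)]mulmxA !Fe.
  by rewrite (eA_w _ phi_y).
- rewrite Ge_mx (eG_w _ (ind_c indP)) mxmZ [extend *m (_ *m c)]mulmxA !Fe Ge_mx.
  by rewrite (eG_w _ phi_c).
- rewrite -[j](subrK 1) (eX_w _ (ind_x indP) (ind_c indP)) mulmxBr mxmZ.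
  rewrite [extend *m (_ *m x)]mulmxA [extend *m (_ *m c)]mulmxA !Fe.
  by rewrite (eX_w _ phi_x phi_c).
Qed.
End Frobenius.
End Induced.
End Double.

(** * A projectivity criterion *)

Section Average.
Variables (k : fieldType) (n : nat) (kap : k).
Hypothesis n0 : n%:R != 0 :> k.
Hypothesis kap0 : kap != 0.

(** When u^n = kap, this is the mean of the conjugates U^r f u^-r over r < n, written without
    inverses. *)
Definition avg a b (U : 'M[k]_a) (u : 'M[k]_b) (f : 'M[k]_(a, b)) :=
  (n%:R * kap)^-1 *: (trz n U u f *m u).

Let n_gt0 : (0 < n)%N.
Proof. by case: n n0 => //; rewrite eqxx. Qed.

Lemma avg_comm a b (U : 'M[k]_a) (u : 'M[k]_b) f :
  U ^+ n = kap%:M -> u ^+ n = kap%:M -> U *m avg U u f = avg U u f *m u.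
Proof.
move=> Un un; rewrite mxmZ mxZm mulmxA; congr (_ *: (_ *m _)).
apply/eqP; rewrite -subr_eq0 trz_comm Un un mul_scalar_mx mul_mx_scalar.
by rewrite subrr.
Qed.

Lemma avg_cst a b (U : 'M[k]_a) (u : 'M[k]_b) f :
  u ^+ n = kap%:M -> U *m f = f *m u -> avg U u f = f.
Proof.
move=> un Uf; rewrite /avg trz_cst // mxZm -mulmxA -expmxSr prednK //.
by rewrite un mul_mx_scalar !scalerA -mulrA mulVf ?scale1r // mulf_neq0.
Qed.

Lemma avg_mull a b c (U : 'M[k]_a) (u : 'M[k]_b) (V : 'M[k]_c) g f :
  V *m g = g *m U -> g *m avg U u f = avg V u (g *m f).
Proof. by move=> Vg; rewrite /avg (trz_mull _ _ _ Vg) mxmZ mulmxA. Qed.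

(** Passing V through the term U^r f u^(n-r) costs lam^r on one side and lam^(n-r) on the other, in
    all lam^n = 1. *)
Lemma avg_qcomm a b lam (U V : 'M[k]_a) (u v : 'M[k]_b) f :
  lam ^+ n = 1 -> V * U = lam *: (U * V) -> v * u = lam *: (u * v) ->
  V *m f = f *m v -> V *m avg U u f = avg U u f *m v.
Proof.
move=> lamn VU vu Vf; rewrite mxmZ mxZm; congr (_ *: _).
rewrite !mulmx_suml mulmx_sumr; apply: eq_bigr => -[r /= lt_r] _.
rewrite -(mulmxA _ _ u) -expmxSr -subSn // subSS.
have vX := qcommX (n - r) vu; rewrite -!mulmxE in vX.
have VX := qcommX r VU; rewrite -!mulmxE in VX.
rewrite !mulmxA VX !mxZm -(mulmxA _ V f) Vf -(mulmxA _ _ (u ^+ _)).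
rewrite -(mulmxA _ v) vX !mxmZ scalerA -exprD subnKC 1?ltnW // lamn scale1r.
by rewrite !mulmxA.
Qed.
End Average.

Lemma comm_descends (k : fieldType) p m (A B : 'M[k]_p) (w : 'M_(p, m)) a b :
  (forall r (f g : 'M_(m, r)), w *m f = w *m g -> f = g) ->
  A *m w = w *m a -> B *m w = w *m b -> GRing.comm A B -> GRing.comm a b.
Proof.
move=> inj wa wb AB; apply: inj; rewrite -!mulmxE !mulmxA -wa -wb -!mulmxA.
by rewrite -wa -wb !mulmxA !mulmxE AB.
Qed.

Section Induction.
Variables (k : closedFieldType) (T : taft_data k).
Local Notation n := (tn T).
Local Notation d := (td T).
Local Notation q := (tq T).
Local Notation c0 := (c0 T).
Local Notation Zn := ('Z_(tn T)).
Local Notation dmod := (dmod T).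
Implicit Types M N L P Y : dmod.

Let q0 : q != 0 := tq_neq0 T.
Let prq : d.-primitive_root q := tq_prim T.
Let n_gt0 : (0 < n)%N := ltnW (tn_gt1 T).
Let d_gt0 : (0 < d)%N := ltnW (td_ge2 T).

(* The action of the central group-like element K^-1 G, as K^d = 1. *)
Definition opC M := sumK M ^+ d.-1 * dG M.

Lemma opCE M : sumK M * opC M = dG M.
Proof. by rewrite mulrA -exprS prednK // Kd mul1r. Qed.

Lemma GK_comm M : GRing.comm (dG M) (sumK M).
Proof. exact: dGK. Qed.

Lemma opC_d M : opC M ^+ d = dG M ^+ d.
Proof.
rewrite exprMn_comm; last exact/commr_sym/commrX/GK_comm.
by rewrite -exprM mulnC exprM Kd expr1n mul1r.
Qed.

Lemma opC_n M : opC M ^+ n = 1.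
Proof.
rewrite -(divnK (td_dvd_n T)) mulnC exprM opC_d -exprM mulnC divnK ?td_dvd_n //.
exact: dG_order.
Qed.

Lemma opC_K M : GRing.comm (opC M) (sumK M).
Proof.
apply/commr_sym/commrM; first exact/commrX.
exact/commr_sym/GK_comm.
Qed.

Lemma opC_G M : GRing.comm (opC M) (dG M).
Proof.
apply/commr_sym/commrM; last exact: commr_refl.
exact/commrX/GK_comm.
Qed.

Lemma opC_X M : GRing.comm (opC M) (dX M).
Proof.
have KX r : sumK M ^+ r * dX M = q^-1 ^+ r *: (dX M * sumK M ^+ r).
  elim: r => [|r IH]; first by rewrite !expr0 mulr1 mul1r scale1r.
  by rewrite exprSr -mulrA dKX mxZr [in LHS]mulrA IH mxZl scalerA -exprS -mulrA.
rewrite /GRing.comm /opC -mulrA dGX mxZr [in LHS]mulrA KX mxZl scalerA -exprS prednK //.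
by rewrite exprVn (prim_expr_order prq) invr1 scale1r mulrA.
Qed.

Lemma opC_A M : GRing.comm (opC M) (sumA M).
Proof.
have KA r : sumK M ^+ r * sumA M = q ^+ r *: (sumA M * sumK M ^+ r).
  elim: r => [|r IH]; first by rewrite !expr0 mulr1 mul1r scale1r.
  by rewrite exprSr -mulrA dKA mxZr [in LHS]mulrA IH mxZl scalerA -exprS -mulrA.
have GA : dG M * sumA M = q *: (sumA M * dG M).
  by rewrite dAG scalerA mulfV ?scale1r.
rewrite /GRing.comm /opC -mulrA GA mxZr [in LHS]mulrA KA mxZl scalerA -exprS prednK //.
by rewrite (prim_expr_order prq) scale1r mulrA.
Qed.

Lemma opC_opx M s : GRing.comm (opC M) (opx M s).
Proof.
by rewrite /GRing.comm /opx mulrDr mulrDl mxZr mxZl opC_X opC_G.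
Qed.

Lemma opC_opy M s : GRing.comm (opC M) (opy M s).
Proof.
by rewrite /GRing.comm /opy mulrDr mulrDl mxZr mxZl opC_A opC_K.
Qed.

Lemma opC_zop M s : GRing.comm (opC M) (zop M s).
Proof.
apply: commrB; first exact/commrM/opC_opy/opC_opx.
by rewrite /GRing.comm mxZr mxZl mulr1 mul1r.
Qed.

Lemma opC_w M r (w : 'M[k]_(ddim M, r)) c : dG M *m w = sumK M *m w *m c ->
  opC M *m w = w *m c.
Proof.
move=> wc; rewrite /opC -mulmxE -mulmxA wc !mulmxA -expmxSr prednK // Kd.
by rewrite mul1mx.
Qed.

Lemma dhom_opC M N (f : 'M[k]_(ddim N, ddim M)) :
  is_dhom f -> f *m opC M = opC N *m f.
Proof.
move=> hf; rewrite /opC -!mulmxE mulmxA -(expmx_intertwine _ (esym (dhom_K hf))).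
by rewrite -!mulmxA (dhom_G hf).
Qed.

Local Opaque opC opx opy zop.

Section Projective.
Variables (s : k) (P : dmod) (m : nat) (w : 'M[k]_(ddim P, m)).
Variables (rho : Zn -> 'M[k]_(m, ddim P)) (x y c : 'M[k]_m).
Hypothesis s0 : s != 0.
Hypothesis tP : tame P.
Hypothesis indP : induced s w rho x y c.

Lemma ind_d : x ^+ d = s ^+ d *: 1%:M /\ y ^+ d = (c0 / s) ^+ d *: 1%:M.
Proof.
split; apply: (ind_inj indP); rewrite mxmZ mulmx1.
  by rewrite -(expmx_intertwine _ (ind_x indP)) opx_d tP mxZm mul1mx.
by rewrite -(expmx_intertwine _ (ind_y indP)) opy_d mxZm mul1mx.
Qed.

Lemma ind_yx : y * x = q^-1 *: (x * y - 1).
Proof.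
apply: (ind_inj indP); rewrite mxmZ mulmxBr mulmx1 -!mulmxE !mulmxA.
rewrite -(ind_x indP) -(ind_y indP) -!mulmxA -(ind_x indP) -(ind_y indP).
rewrite !mulmxA !mulmxE op_yx // mxZm mulmxBl.
by rewrite mul1mx.
Qed.

Definition indz := x * y - c0 *: (1 : 'M[k]_m).

Lemma ind_z Y (phi : 'M[k]_(ddim Y, m)) :
  opx Y s *m phi = phi *m x -> opy Y s *m phi = phi *m y ->
  zop Y s *m phi = phi *m indz.
Proof.
move=> px py; rewrite [zop _ _]/(_ - _) /indz -!mulmxE mulmxBl mulmxBr mxZm mxmZ mul1mx mulmx1.
by rewrite -mulmxA py !mulmxA px.
Qed.

Lemma ind_cz : GRing.comm c indz.
Proof.
apply: (comm_descends (ind_inj indP) (opC_w (ind_c indP))); last exact: opC_zop.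
exact: ind_z (ind_x indP) (ind_y indP).
Qed.

Lemma ind_cx : GRing.comm c x.
Proof.
apply: (comm_descends (ind_inj indP) (opC_w (ind_c indP)) (ind_x indP)).
exact: opC_opx.
Qed.

Lemma ind_zd : indz ^+ d = 0.
Proof.
apply: (ind_inj indP).
rewrite -(expmx_intertwine _ (ind_z (ind_x indP) (ind_y indP))).
by rewrite (tame_zop tP s0) mul0mx mulmx0.
Qed.

Lemma ind_cn : c ^+ n = 1.
Proof.
apply: (ind_inj indP).
by rewrite -(expmx_intertwine _ (opC_w (ind_c indP))) opC_n mul1mx mulmx1.
Qed.

Lemma ind_cd : c ^+ d = 1.
Proof.
apply: (ind_inj indP).
rewrite -(expmx_intertwine _ (opC_w (ind_c indP))) opC_d tP.
by rewrite mul1mx mulmx1.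
Qed.

Lemma ind_xn : x ^+ n = (s ^+ n)%:M.
Proof.
apply: (ind_inj indP); rewrite mul_mx_scalar.
by rewrite -(expmx_intertwine _ (ind_x indP)) opx_n mxZm mul1mx.
Qed.

(* A linear lift along g of the restriction of f to the inducing space is made *)
(* to commute with c by averaging over the powers of c, then with z by the     *)
(* relative trace of its product with a witness of freeness, and then with x by*)
(* averaging over the powers of x; as x is invertible, it commutes with y.     *)
Lemma ind_proj : zfree d indz -> dprojective P.
Proof.
move=> [th thE] A B g f hg rg hf; pose phi := f *m w.
have phi_x : opx B s *m phi = phi *m x.
  by rewrite mulmxA -(dhom_opx _ hf) -!mulmxA (ind_x indP).
have phi_y : opy B s *m phi = phi *m y.
  by rewrite mulmxA -(dhom_opy _ hf) -!mulmxA (ind_y indP).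
have phi_c : dG B *m phi = sumK B *m phi *m c.
  rewrite mulmxA -(dhom_G hf) -!mulmxA (ind_c indP) !mulmxA.
  by rewrite (dhom_K hf).
have gg' : g *m pinvmx g = 1%:M by rewrite mulmxVp // /row_free rg.
have gC : opC B *m g = g *m opC A by rewrite dhom_opC.
have gx : opx B s *m g = g *m opx A s by rewrite (dhom_opx _ hg).
have gz : zop B s *m g = g *m zop A s by rewrite (dhom_zop _ hg).
have sn0 : s ^+ n != 0 by rewrite expf_neq0.
have n0 := tn_inv T; have o0 := oner_neq0 k.
pose Cavg M (p : 'M[k]_(ddim M, m)) := avg n 1 (opC M) c p.
pose Xavg M (p : 'M[k]_(ddim M, m)) := avg n (s ^+ n) (opx M s) x p.
have CavgP M p : opC M *m Cavg M p = Cavg M p *m c.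
  by apply: avg_comm; rewrite ?opC_n ?ind_cn.
have xnM M : opx M s ^+ n = (s ^+ n)%:M by rewrite opx_n -scalemx1.
pose p1 := Cavg A (pinvmx g *m phi).
pose p2 := trz d (zop A s) indz (p1 *m th).
(* The witness [th] need not commute with c, so [p2] may have lost that property and is averaged
   over c again. This keeps the relation with z, as c commutes with z. *)
pose p3 := Cavg A p2; pose p4 := Xavg A p3.
have gp1 : g *m p1 = phi.
  rewrite (avg_mull _ _ _ _ gC) mulmxA gg' mul1mx avg_cst ?ind_cn //.
  exact: opC_w.
have gp2 : g *m p2 = phi.
  rewrite -(trz_mull _ _ _ gz) mulmxA gp1 (trz_mull _ _ _ (ind_z phi_x phi_y)).
  by rewrite thE mulmx1.
have gp3 : g *m p3 = phi.
  by rewrite (avg_mull _ _ _ _ gC) gp2 avg_cst ?ind_cn //; apply: opC_w.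
have gp4 : g *m p4 = phi.
  by rewrite (avg_mull _ _ _ _ gx) gp3 avg_cst ?ind_xn.
(* A is arbitrary and its z may fail to be nilpotent. But z^d is a multiple of G^d - 1, where G^d is
   the d-th power of [opC A]; as [p1] intertwines [opC A] with c and c^d = 1, z^d vanishes on the
   image of [p1]. *)
have z2 : zop A s *m p2 = p2 *m indz.
  apply/eqP; rewrite -subr_eq0 trz_comm ind_zd mulmx0 subr0 mulmxA.
  have [e ->] := zop_d A s0; rewrite mxZm mulmxBl mul1mx -opC_d.
  rewrite (expmx_intertwine _ (CavgP _ _)) ind_cd mulmx1 subrr scaler0.
  by rewrite mul0mx.
have z3 : zop A s *m p3 = p3 *m indz.
  apply: (@avg_qcomm _ _ _ _ _ 1 _ _ _ _ _ _ _ _ z2); rewrite ?expr1n ?scale1r //.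
    by rewrite opC_zop.
  by rewrite ind_cz.
have z4 : zop A s *m p4 = p4 *m indz.
  apply: (@avg_qcomm _ _ _ _ _ q^-1 _ _ _ _ _ _ _ _ z3).
  - by rewrite exprVn q_expn invr1.
  - apply: (weyl_zx (td_ge2 T) prq (c0E T)); exact: op_yx.
  - apply: (weyl_zx (td_ge2 T) prq (c0E T)); exact: ind_yx.
have c4 : opC A *m p4 = p4 *m c.
  apply: (@avg_qcomm _ _ _ _ _ 1 _ _ _ _ _ _ _ _ (CavgP _ _)); rewrite ?expr1n ?scale1r //.
    by rewrite opC_opx.
  by rewrite ind_cx.
have x4 : opx A s *m p4 = p4 *m x by apply: avg_comm; rewrite ?ind_xn.
move: p4 gp4 z4 c4 x4 => p4 gp4 z4 c4 x4.
have y4 : opy A s *m p4 = p4 *m y.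
  have inj r (a b : 'M[k]_(_, r)) : opx A s *m a = opx A s *m b -> a = b.
    move=> /(congr1 (mulmx (opx A s ^+ n.-1))).
    rewrite !mulmxA -!expmxSr prednK // xnM !mul_scalar_mx.
    exact: scalerI.
  have zE : opx A s *m opy A s = zop A s + c0 *: 1%:M.
    by rewrite [zop _ _]/(_ - _) subrK.
  have xyE : x *m y = indz + c0 *: 1%:M by rewrite /indz subrK.
  apply: inj; rewrite [LHS]mulmxA [RHS]mulmxA x4 -[RHS]mulmxA zE xyE.
  by rewrite mulmxDl mulmxDr z4 mxZm mxmZ mul1mx mulmx1.
have G4 : dG A *m p4 = sumK A *m p4 *m c.
  by rewrite -mulmxA -c4 mulmxA mulmxE opCE.
exists (extend rho p4); first exact: (extend_dhom indP).
apply: (ind_ext indP) => i.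
rewrite -!mulmxA [extend _ _ *m _]mulmxA (extend_e indP).
by rewrite !mulmxA (dhom_e hg) -mulmxA gp4 (dhom_e hf) -mulmxA.
Qed.
End Projective.
End Induction.

(** * Tensor products of induced modules *)

Section RectangularTensor.
Variable k : closedFieldType.

Lemma tensmxDl m n p r (A A' : 'M[k]_(m, n)) (B : 'M[k]_(p, r)) :
  (A + A') *t B = A *t B + A' *t B.
Proof.
by apply/matrixP=> i j; case: (mxtens_indexP i) => i0 i1;
   case: (mxtens_indexP j) => j0 j1; rewrite [RHS]mxE !tensmxE [in LHS]mxE mulrDl.
Qed.

Lemma tensmxDr m n p r (A : 'M[k]_(m, n)) (B B' : 'M[k]_(p, r)) :
  A *t (B + B') = A *t B + A *t B'.
Proof.
by apply/matrixP=> i j; case: (mxtens_indexP i) => i0 i1;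
   case: (mxtens_indexP j) => j0 j1; rewrite [RHS]mxE !tensmxE [in LHS]mxE mulrDr.
Qed.

Lemma tensmxZl m n p r c (A : 'M[k]_(m, n)) (B : 'M[k]_(p, r)) :
  (c *: A) *t B = c *: (A *t B).
Proof.
by apply/matrixP=> i j; case: (mxtens_indexP i) => i0 i1;
   case: (mxtens_indexP j) => j0 j1; rewrite [RHS]mxE !tensmxE [in LHS]mxE mulrA.
Qed.

Lemma tensmxZr m n p r c (A : 'M[k]_(m, n)) (B : 'M[k]_(p, r)) :
  A *t (c *: B) = c *: (A *t B).
Proof.
by apply/matrixP=> i j; case: (mxtens_indexP i) => i0 i1;
   case: (mxtens_indexP j) => j0 j1; rewrite [RHS]mxE !tensmxE [in LHS]mxE mulrCA.
Qed.

Lemma tensmxNl m n p r (A : 'M[k]_(m, n)) (B : 'M[k]_(p, r)) :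
  (- A) *t B = - (A *t B).
Proof. by rewrite -scaleN1r tensmxZl scaleN1r. Qed.

Lemma tensmx_suml (I : Type) (s : seq I) P m n p r (A : I -> 'M[k]_(m, n))
    (B : 'M[k]_(p, r)) :
  (\sum_(i <- s | P i) A i) *t B = \sum_(i <- s | P i) (A i *t B).
Proof.
apply: (big_morph (fun X => X *t B)); last exact: tens0mx.
by move=> *; rewrite tensmxDl.
Qed.

Lemma tensmx_sumr (I : Type) (s : seq I) P m n p r (A : 'M[k]_(m, n))
    (B : I -> 'M[k]_(p, r)) :
  A *t (\sum_(i <- s | P i) B i) = \sum_(i <- s | P i) (A *t B i).
Proof.
apply: (big_morph (fun X => A *t X)); last exact: tensmx0.
by move=> *; rewrite tensmxDr.
Qed.

Lemma tensmx11 m p : (1%:M : 'M[k]_m) *t (1%:M : 'M[k]_p) = 1%:M.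
Proof. exact: tens11. Qed.

Lemma zfree_tens1 N m p (Z : 'M[k]_p) :
  zfree N Z -> zfree N ((1%:M : 'M[k]_m) *t Z).
Proof.
move=> [th thE]; exists (1%:M *t th); rewrite -tensmx11 -thE tensmx_sumr.
have one r : (1%:M : 'M[k]_m) ^+ r = 1%:M by rewrite expr1n.
by apply: eq_bigr => r _; rewrite !tensX !tensmx_mul !one !mulmx1.
Qed.
End RectangularTensor.

Lemma exp_Zn (k : fieldType) m n (U : 'M[k]_m) (i j : 'Z_n) : (1 < n)%N ->
  U ^+ n = 1 -> U ^+ (i + j)%R = U ^+ i * U ^+ j.
Proof.
move=> n_gt1 Un; have -> : (i + j)%R = ((i + j)%N %% n)%N :> nat.
  by congr (_ %% _)%N; apply: Zp_cast.
by rewrite expr_mod // exprD.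
Qed.

(** * Composition series over the q-Weyl algebra *)

Section Flags.
Variables (k : closedFieldType) (T : taft_data k).
Local Notation d := (td T).
Local Notation q := (tq T).
Local Notation c0 := (c0 T).
Variable s : k.
Hypothesis s0 : s != 0.

Let d_gt0 : (0 < d)%N := ltnW (td_ge2 T).
Let prq : d.-primitive_root q := tq_prim T.

Record weyl m (x y : 'M[k]_m) : Prop := Weyl {
  weyl_yx : y * x = q^-1 *: (x * y - 1);
  weyl_xd : x ^+ d = s ^+ d *: 1%:M;
  weyl_yd : y ^+ d = (c0 / s) ^+ d *: 1%:M }.

Lemma weyl_zd m (x y : 'M[k]_m) : weyl x y ->
  (x * y - c0 *: (1 : 'M[k]_m)) ^+ d = 0.
Proof.
move=> [yx xd yd]; have sd0 : s ^+ d != 0 by rewrite expf_neq0.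
have sc : s * (c0 / s) = c0 by rewrite mulrC mulfVK.
pose u := s ^- d *: x ^+ d.-1.
have xu : x * u = 1.
  by rewrite mxZr -exprS prednK // xd scalerA mulVf ?scale1r.
have ux : u * x = 1.
  by rewrite mxZl -exprSr prednK // xd scalerA mulVf ?scale1r.
have [e ->] := weyl_zpow (td_ge2 T) prq (c0E T) yx sc xu ux yd.
by rewrite xd subrr scaler0.
Qed.

Lemma weyl_sub m m1 (x y : 'M[k]_m) (x1 y1 : 'M[k]_m1) i i' :
  i' *m i = 1%:M -> x *m i = i *m x1 -> y *m i = i *m y1 ->
  weyl x y -> weyl x1 y1.
Proof.
move=> i'i xi yi [yx xd yd].
have inj r (a b : 'M[k]_(_, r)) : i *m a = i *m b -> a = b.
  by move=> /(congr1 (mulmx i')); rewrite !mulmxA i'i !mul1mx.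
split; apply: inj; rewrite mxmZ.
- rewrite -!mulmxE mulmxBr !mulmxA -xi -yi -!mulmxA -xi -yi mulmxA mulmx1.
  by rewrite mulmxE yx mxZm mulmxBl mul1mx -mulmxE mulmxA.
- by rewrite -(expmx_intertwine _ xi) xd mxZm mul1mx mulmx1.
- by rewrite -(expmx_intertwine _ yi) yd mxZm mul1mx mulmx1.
Qed.

(** For a row eigenvector v of x, the last nonzero v z^r is again an eigenvector, because z and x
    q-commute. It is killed by z = x y - c0, which determines the action of y. A row vector is
    wanted because it defines a one-dimensional quotient. *)
Lemma weyl_eigen m (x y : 'M[k]_m) : (0 < m)%N -> weyl x y ->
  exists xi (g : 'rV[k]_m), [/\ g != 0, xi ^+ d = s ^+ d, g *m x = xi *: g
    & g *m y = (c0 / xi) *: g].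
Proof.
move=> m_gt0 W; have [yx xd yd] := W.
have [xi /eigenvalueP[v vx v0]] : exists xi, eigenvalue x xi.
  have /closed_rootP[xi rxi] : size (char_poly x) != 1%N.
    by rewrite size_char_poly eqSS -lt0n.
  by exists xi; rewrite eigenvalue_root_char.
pose z := x * y - c0 *: (1 : 'M[k]_m).
have zx : z * x = q^-1 *: (x * z) := weyl_zx (td_ge2 T) prq (c0E T) yx.
have zd : z ^+ d = 0 := weyl_zd W.
have ex : exists r, v *m z ^+ r == 0 by exists d; rewrite zd mulmx0.
have [[|r] /eqP vz0 min_r] := ex_minnP ex.
  by move: vz0 v0; rewrite expr0 mulmx1 => ->; rewrite eqxx.
have g0 : v *m z ^+ r != 0 by apply/negP => /min_r; rewrite ltnn.
have zXx : z ^+ r *m x = q^-1 ^+ r *: (x *m z ^+ r).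
  elim: r {vz0 min_r g0} => [|r IH].
    by rewrite !expr0 mulmx1 mul1mx scale1r.
  rewrite {1}expmxSr -mulmxA mulmxE zx mxZr -mulmxE mulmxA IH mxZm scalerA.
  by rewrite -exprS -mulmxA -expmxSr.
have gx : v *m z ^+ r *m x = (q^-1 ^+ r * xi) *: (v *m z ^+ r).
  by rewrite -mulmxA zXx mxmZ mulmxA vx mxZm scalerA.
set e := q^-1 ^+ r * xi in gx; exists e, (v *m z ^+ r).
have gxX j : v *m z ^+ r *m x ^+ j = e ^+ j *: (v *m z ^+ r).
  elim: j => [|j IH]; first by rewrite !expr0 mulmx1 scale1r.
  by rewrite expmxSr mulmxA IH mxZm gx scalerA -exprSr.
have ed : e ^+ d = s ^+ d.
  have := gxX d; rewrite xd mxmZ mulmx1 => /eqP.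
  by rewrite -subr_eq0 -scalerBl scaler_eq0 (negPf g0) orbF subr_eq0 eq_sym => /eqP.
have e0 : e != 0.
  apply/eqP => e0; move: ed; rewrite e0 expr0n gtn_eqF // => /esym/eqP.
  by rewrite expf_eq0 (negPf s0) andbF.
split=> //; have gz : v *m z ^+ r *m z = 0 by rewrite -mulmxA -expmxSr.
have : v *m z ^+ r *m (x *m y) = c0 *: (v *m z ^+ r).
  have -> : x *m y = z + c0 *: 1%:M by rewrite subrK.
  by rewrite mulmxDr gz add0r mxmZ mulmx1.
rewrite mulmxA gx mxZm => /(congr1 (fun u => e^-1 *: u)).
by rewrite !scalerA mulVf // scale1r mulrC.
Qed.

(** [F] and [lift] give the values on objects and morphisms of an additive functor defined on pairs
    (x, y). It will be tensoring with N on the right, or with V on the left. *)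
Variables (size : nat -> nat).
Variable lift : forall a b, 'M[k]_(a, b) -> 'M[k]_(size a, size b).
Variable F : forall m, 'M[k]_m -> 'M[k]_m -> 'M[k]_(size m).
Hypothesis lift1 : forall a, lift (1%:M : 'M_a) = 1%:M.
Hypothesis liftM : forall a b c (f : 'M_(a, b)) (g : 'M_(b, c)),
  lift (f *m g) = lift f *m lift g.
Hypothesis liftD : forall a b (f g : 'M_(a, b)), lift (f + g) = lift f + lift g.
Hypothesis F_nat : forall a b (f : 'M_(a, b)) x y x' y',
  x *m f = f *m x' -> y *m f = f *m y' ->
  F x y *m lift f = lift f *m F x' y'.
Hypothesis F_base : forall xi, xi ^+ d = s ^+ d ->
  zfree d (F (xi%:M : 'M_1) (c0 / xi)%:M).

(* A module over the q-Weyl algebra yx = q^-1 (xy - 1) with x^d and y^d as in *)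
(* [weyl] has a composition series with one-dimensional factors.              *)
Lemma zfree_flag m (x y : 'M[k]_m) :
  weyl x y -> F x y ^+ d = 0 -> zfree d (F x y).
Proof.
have [N] := ubnP m; elim: N m x y => // N IH m x y lt_mN W Fd.
have [m0|m_gt0] := posnP m.
  (* [size 0] is not assumed to be 0; instead [lift] transports the equality 1 = 0 of the empty
     matrices. *)
  have lift0 : lift (0 : 'M[k]_m) = 0.
    by apply: (addIr (lift (0 : 'M_m))); rewrite -liftD !add0r.
  have E : 1%:M = 0 :> 'M[k]_(size m).
    by rewrite -lift1 -lift0; congr lift; apply/matrixP => -[i]; rewrite m0.
  exists 0; rewrite -[LHS]mul1mx -[RHS]mul1mx E !mul0mx.
  by [].
have [xi [g [g0 xid gx gy]]] := weyl_eigen m_gt0 W.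
have [p' gp'] : exists p', g *m p' = 1%:M.
  exists (pinvmx g); rewrite mulmxVp // -row_leq_rank lt0n mxrank_eq0.
  by [].
(* [e] projects onto the kernel of g, which is stable under x and y and has smaller dimension, while
   g is the quotient of dimension one. *)
pose e := 1%:M - p' *m g.
have ee : e *m e = e.
  rewrite mulmxBl mul1mx mulmxBr mulmx1 -!mulmxA [g *m (_ *m g)]mulmxA gp'.
  by rewrite mul1mx subrr subr0.
have ge : g *m e = 0 by rewrite mulmxBr mulmx1 mulmxA gp' mul1mx subrr.
have := idem_split ee; have := mulmx_base e.
move: (col_base e) (row_base e) => i i' ii' i'i.
have gi : g *m i = 0 by rewrite -[i]mulmx1 -i'i !mulmxA -(mulmxA g) ii' ge mul0mx.
have lt_e : (\rank e < m)%N.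
  rewrite ltn_neqAle rank_leq_row andbT; apply: contraNneq g0 => re.
  have ue : e \in unitmx by rewrite -row_free_unit /row_free re.
  by rewrite -[g]mulmx1 -(mulmxV ue) mulmxA ge mul0mx.
pose x1 := i' *m x *m i; pose y1 := i' *m y *m i.
have stab u c : g *m u = c *: g -> u *m i = i *m (i' *m u *m i).
  move=> gu; rewrite !mulmxA ii' /e !mulmxBl mul1mx -!mulmxA.
  by rewrite [g *m (u *m _)]mulmxA gu mxZm gi scaler0 mulmx0 subr0.
have xi1 := stab _ _ gx; have yi1 := stab _ _ gy.
have W1 : weyl x1 y1 := weyl_sub i'i xi1 yi1 W.
have Fi : F x y *m lift i = lift i *m F x1 y1 := F_nat xi1 yi1.
have li : lift i' *m lift i = 1%:M by rewrite -liftM i'i lift1.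
have F1d : F x1 y1 ^+ d = 0.
  rewrite -[LHS]mul1mx -li -mulmxA -(expmx_intertwine _ Fi) Fd.
  by rewrite mul0mx mulmx0.
apply: (zfree_ext li (p := lift g) (p' := lift p') (Z1 := F x1 y1)
  (Z2 := F (xi%:M : 'M_1) (c0 / xi)%:M)) => //.
- by rewrite -liftM gp' lift1.
- by rewrite -!liftM -liftD ii' subrK lift1.
- by apply/esym/F_nat; rewrite mul_scalar_mx ?gx ?gy.
- by apply: IH => //; apply: leq_trans lt_e _.
- exact: F_base.
Qed.
End Flags.

Section InducedTensor.
Variables (k : closedFieldType) (T : taft_data k).
Local Notation d := (td T).
Local Notation c0 := (c0 T).
Local Notation dmod := (dmod T).
Implicit Types M N L P V Y : dmod.


Lemma opx_tens M N s :
  opx (dtens M N) s = opx M s *t dG N + 1%:M *t dX N.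
Proof. by rewrite /opx dtens_X dtens_G tensmxDl tensmxZl addrAC. Qed.

Lemma opy_tens M N s :
  opy (dtens M N) s = opy M s *t sumK N + 1%:M *t sumA N.
Proof.
by rewrite /opy sumA_tens sumK_tens tensmxDl tensmxZl -addrA addrC.
Qed.

(** The tensor identity. The generators have coproducts x (x) G + 1 (x) X, y (x) K + 1 (x) a and C
    (x) C for C = K^-1 G, with first factors in the subalgebra. The decomposition by the e_i
    persists since e_i acts on the tensor product by the sum of the e_(i-j) (x) e_j. *)
Lemma ind_tens s P m (w : 'M[k]_(ddim P, m)) rho x y c N :
  induced s w rho x y c ->
  induced s (P := dtens P N) (w *t 1%:M)
    (fun i => \sum_j rho (i - j) *t de N j)
    (x *t dG N + 1%:M *t dX N) (y *t sumK N + 1%:M *t sumA N) (c *t opC N).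
Proof.
move=> indP; split=> [||||].
- rewrite opx_tens mulmxDl mulmxDr !tensmx_mul (ind_x indP).
  by rewrite !mulmx1 !mul1mx.
- rewrite opy_tens mulmxDl mulmxDr !tensmx_mul (ind_y indP).
  by rewrite !mulmx1 !mul1mx.
- rewrite dtens_G sumK_tens !tensmx_mul (ind_c indP) !mulmx1.
  by rewrite mulmxE opCE.
- move=> i j; rewrite dtens_e mulmx_suml mulmx_suml.
  rewrite (eq_bigr (fun u => if i == j then 1%:M *t de N u else 0)).
    case: eqP => _; last by rewrite big1_eq.
    by rewrite -tensmx_sumr de_sum tensmx11.
  move=> u _; rewrite mulmx_sumr mulmx_suml.
  rewrite (bigD1 (j - u)) //= big1 ?addr0 => [|v neq_v].
    rewrite subKr !tensmx_mul (ind_rho indP) mulmx1 mulmxE de_orth eqxx.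
    by rewrite (inj_eq (addIr _)); case: eqP; rewrite ?tens0mx.
  rewrite !tensmx_mul mulmx1 mulmxE de_orth ifN ?tensmx0 //.
  by apply: contraNneq neq_v => ->; rewrite subKr.
- have E i : de (dtens P N) i *m (w *t 1%:M) *m
      (\sum_j rho (i - j) *t de N j) =
      \sum_j (de P (i - j) *m w *m rho (i - j)) *t de N j.
    rewrite mulmx_sumr; apply: eq_bigr => j _.
    rewrite dtens_e !mulmx_suml (bigD1 (i - j)) //= big1 ?addr0 => [|v neq_v].
      by rewrite !tensmx_mul subKr mulmx1 mulmxE de_orth eqxx.
    rewrite !tensmx_mul mulmx1 mulmxE de_orth ifN ?tensmx0 //.
    by apply: contraNneq neq_v => <-; rewrite subKr.
  rewrite (eq_bigr _ (fun i _ => E i)) exchange_big /= -tensmx11.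
  rewrite -[in RHS](de_sum N : _ = 1%:M) tensmx_sumr; apply: eq_bigr => j _.
  rewrite -tensmx_suml -(ind_sum indP) [in RHS](reindex_inj (addIr (- j))).
  by [].
Qed.

(** The tensor product is induced from a module with underlying space L (x) N. There L enters only
    through its pair x, y, so [zfree_flag] replaces it by one-dimensional factors; on the factor
    where x acts by xi, the operator z becomes that of N at the parameter xi. *)
Lemma proj_tens s V (w : 'cV[k]_(ddim V)) rho L N :
  s != 0 -> tame V -> tame L -> tame N ->
  induced s w rho s%:M (c0 / s)%:M 1%:M ->
  (forall xi, xi ^+ d = s ^+ d -> zfree d (zop N xi)) ->
  dprojective (dtens (dtens V L) N).
Proof.
move=> s0 tV tL tN indV freeN.
have indL := ind_tens L indV.
have tP : tame (dtens (dtens V L) N) by apply: tame_tens => //; apply: tame_tens.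
have indN := ind_tens N indL; apply: (ind_proj s0 tP indN).
have zd := ind_zd s0 tP indN; rewrite /indz in zd *.
move: zd; set x := _ + _ *t dX L; set y := _ + _ *t sumA L => zd.
have W : weyl T s x y.
  have tVL : tame (dtens V L) by apply: tame_tens.
  have [xd yd] := ind_d tVL indL.
  by split; [apply: (ind_yx s0 indL)|apply: xd|apply: yd].
apply: (@zfree_flag _ T s s0 (fun m => m * ddim N)%N
   (fun a b f => f *t (1%:M : 'M_(ddim N)))
   (fun m x y => (x *t dG N + 1%:M *t dX N) * (y *t sumK N + 1%:M *t sumA N)
     - c0 *: (1 : 'M[k]_(m * ddim N))) _ _ _ _ _ _ _ _ W zd).
- by move=> a; rewrite tensmx11.
- by move=> *; rewrite tensmx_mul mulmx1.
- by move=> *; rewrite tensmxDl.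
- move=> a b f u v u' v' uf vf.
  rewrite mulmxBl mulmxBr mxZm mxmZ mul1mx mulmx1; congr (_ - _).
  rewrite -!mulmxE -mulmxA [_ *m (f *t _)]mulmxDl !tensmx_mul vf.
  rewrite !mul1mx !mulmx1 mulmxDr.
  have -> : (f *m v') *t sumK N = (f *t 1%:M) *m (v' *t sumK N).
    by rewrite tensmx_mul mul1mx.
  have -> : f *t sumA N = (f *t 1%:M) *m (1%:M *t sumA N).
    by rewrite tensmx_mul mul1mx mulmx1.
  rewrite !mulmxA -mulmxDr; congr (_ *m _).
  by rewrite mulmxDl mulmxDr !tensmx_mul uf !mul1mx !mulmx1.
- move=> xi xid; have xi0 : xi != 0.
    apply: contra_neq s0 => xi0; apply/eqP; move: xid.
    rewrite xi0 expr0n gtn_eqF ?(ltnW (td_ge2 T)) // => /esym/eqP.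
    by rewrite expf_eq0 => /andP[].
  have -> : (xi%:M *t dG N + 1%:M *t dX N) *
      ((c0 / xi)%:M *t sumK N + 1%:M *t sumA N)
      - c0 *: (1 : 'M[k]_(1 * ddim N)) = (1%:M : 'M_1) *t zop N xi.
    have one : (1 : 'M[k]_(1 * ddim N)) = 1%:M *t 1%:M by rewrite tensmx11.
    rewrite one -[xi%:M]scalemx1 -[(c0 / xi)%:M]scalemx1.
    rewrite !tensmxZl -!tensmxZr -!tensmxDr -!mulmxE tensmx_mul mulmx1.
    rewrite -scaleN1r -tensmxZr -tensmxDr scaleN1r.
    by rewrite /zop /opx /opy [dX N + _]addrC [sumA N + _]addrC.
  exact/zfree_tens1/freeN.
Qed.
End InducedTensor.

(** * Freeness over k[z]/z^d of an induced module tensored with a module where G = gam K *)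

Section BandTensor.
Variables (k : closedFieldType) (T : taft_data k).
Local Notation n := (tn T).
Local Notation d := (td T).
Local Notation q := (tq T).
Local Notation c0 := (c0 T).
Local Notation Zn := ('Z_(tn T)).
Local Notation dmod := (dmod T).

Let prq : d.-primitive_root q := tq_prim T.

Variables (V L : dmod) (w : 'cV[k]_(ddim V)) (rho : Zn -> 'rV[k]_(ddim V)).
Variables sg gam : k.
Hypothesis sg0 : sg != 0.
Hypothesis indV : induced sg w rho sg%:M (c0 / sg)%:M 1%:M.
Hypothesis gamd : gam ^+ d = 1.
Hypothesis GL : dG L = gam *: sumK L.

Let ev i := de V i *m w.

(** Shift of the basis e_i w of V by c. The operators X and a of V are polynomials in K and the
    shifts by -1 and 1. *)
Let shift c := \sum_i ev (i + c) *m rho i.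

Let shift_ev c i : shift c *m ev i = ev (i + c).
Proof.
rewrite mulmx_suml (bigD1 i) //= -!mulmxA [rho i *m _]mulmxA (ind_rho indV).
rewrite eqxx mulmx1 big1 ?addr0 // => j neq_ji.
rewrite -!mulmxA [rho j *m _]mulmxA (ind_rho indV) (negPf neq_ji).
by rewrite !mulmx0.
Qed.

Let ext (f g : 'M[k]_(ddim V)) : (forall i, f *m ev i = g *m ev i) -> f = g.
Proof.
by move=> fg; apply: (ind_ext indV) => i; rewrite -!mulmxA -/(ev i) fg.
Qed.

Let shiftX c r i : shift c ^+ r *m ev i = ev (i + c *+ r).
Proof.
elim: r i => [|r IH] i; first by rewrite expr0 mul1mx mulr0n addr0.
by rewrite expmxS -mulmxA IH shift_ev mulrSr addrA.
Qed.

Local Notation S := (shift 1).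
Local Notation R := (shift (-1)).
Local Notation K := (sumK V).

Let SR : S *m R = 1%:M.
Proof. by apply: ext => i; rewrite -mulmxA !shift_ev subrK mul1mx. Qed.

Let RS : R *m S = 1%:M.
Proof. by apply: ext => i; rewrite -mulmxA !shift_ev addrK mul1mx. Qed.

Let Zn_n (c : Zn) : c *+ n = 0.
Proof.
have n0 : n%:R = 0 :> Zn.
  by apply: val_inj; rewrite /= val_Zp_nat ?tn_gt1 // modnn.
by rewrite -mulr_natr n0 mulr0.
Qed.

Let shift_n c : shift c ^+ n = 1.
Proof. by apply: ext => i; rewrite shiftX Zn_n addr0 mul1mx. Qed.

Let Kev i : K *m ev i = qpow i *: ev i.
Proof. by rewrite mulmxA Ke mxZm. Qed.

Let RK : R *m K = q *: (K *m R).
Proof.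
apply: ext => i; rewrite mxZm -!mulmxA Kev mxmZ shift_ev Kev scalerA.
by rewrite -{1}[i](subrK 1) (qpowD (i - 1) 1) qpow1 mulrC.
Qed.

Let GV : dG V = K.
Proof.
apply: ext => i; rewrite Kev /ev Ge_mx (ind_c indV) mulmx1 mulmxA eK mxZm.
by [].
Qed.

Let XV : dX V = sg *: R - sg *: (K *m R).
Proof.
apply: ext => i; rewrite mulmxBl !mxZm -mulmxA shift_ev Kev scalerA.
rewrite -{1}[i](subrK 1) (eX_w _ (ind_x indV) (ind_c indV)) mulmx1.
by rewrite -/(ev _) mul_mx_scalar.
Qed.

Let AV : sumA V = (c0 / sg) *: S - (c0 / sg) *: (K *m S).
Proof.
apply: ext => i; rewrite mulmxBl !mxZm -mulmxA shift_ev Kev scalerA.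
by rewrite (eA_w _ (ind_y indV)) -/(ev _) mul_mx_scalar.
Qed.

Let phi (c : Zn) := \sum_(j : Zn) shift c ^+ j *t de L j.

Let RX_S (i j : Zn) : R ^+ (i + j)%R = R ^+ i *m R ^+ j.
Proof. by rewrite mulmxE; apply: exp_Zn (tn_gt1 T) (shift_n _). Qed.

Let val1 : (1 : Zn) = 1%N :> nat.
Proof. by rewrite -[1]/(1%:R : Zn) val_Zp_nat ?modn_small ?tn_gt1. Qed.

(* Conjugated by Phi, the operators opx and opy of V (x) L depend on L only    *)
(* through opx and opy of L.                                                  *)
Let Phi := phi (-1).

Let phi_inv : Phi *m phi 1 = 1%:M.
Proof.
rewrite mulmx_suml -tensmx11 -(de_sum L : _ = 1%:M) tensmx_sumr.
apply: eq_bigr => i _; rewrite mulmx_sumr (bigD1 i) //= tensmx_mul.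
rewrite big1 ?addr0 => [|j neq_ji]; last first.
  by rewrite tensmx_mul ee eq_sym (negPf neq_ji) tensmx0.
congr (_ *t _); last by rewrite ee eqxx.
apply: ext => j; rewrite -mulmxA !shiftX mul1mx -addrA -mulrnDl subrr.
by rewrite mul0rn addr0.
Qed.

Let Phi_R : Phi *m (R *t 1%:M) = (R *t 1%:M) *m Phi.
Proof.
rewrite mulmx_suml mulmx_sumr; apply: eq_bigr => j _.
by rewrite !tensmx_mul mulmx1 mul1mx -expmxS -expmxSr.
Qed.

Let Phi_S : Phi *m (S *t 1%:M) = (S *t 1%:M) *m Phi.
Proof.
rewrite mulmx_suml mulmx_sumr; apply: eq_bigr => j _.
rewrite !tensmx_mul mulmx1 mul1mx; congr (_ *t _).
by apply/expmx_intertwine; rewrite SR RS.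
Qed.

Let Phi_KL : Phi *m (1%:M *t sumK L) = (1%:M *t sumK L) *m Phi.
Proof.
rewrite mulmx_suml mulmx_sumr; apply: eq_bigr => j _.
by rewrite !tensmx_mul mulmx1 mul1mx eK Ke.
Qed.

Let Phi_K : Phi *m (K *t 1%:M) = (K *t sumK L) *m Phi.
Proof.
rewrite mulmx_suml mulmx_sumr; apply: eq_bigr => j _.
rewrite !tensmx_mul mulmx1 Ke tensmxZr -tensmxZl; congr (_ *t _).
rewrite /qpow; elim: (j : nat) => [|r IH].
  by rewrite !expr0 mul1mx mulmx1 scale1r.
rewrite expmxS -mulmxA IH mxmZ mulmxA RK mxZm scalerA -mulmxA -expmxS.
by rewrite mulrC -exprS.
Qed.

Let Phi_X : Phi *m (R *t dX L) = (1%:M *t dX L) *m Phi.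
Proof.
rewrite mulmx_suml mulmx_sumr [RHS](reindex_inj (addIr 1)).
apply: eq_bigr => j _; rewrite !tensmx_mul mul1mx e_shiftX RX_S.
by rewrite val1 expr1.
Qed.

Let Phi_A : Phi *m (S *t sumA L) = (1%:M *t sumA L) *m Phi.
Proof.
rewrite mulmx_suml mulmx_sumr [LHS](reindex_inj (addIr 1)).
apply: eq_bigr => j _; rewrite !tensmx_mul mul1mx e_shift addrK RX_S.
by rewrite val1 expr1 -mulmxA RS mulmx1.
Qed.

Let tens_split p (A : 'M[k]_(ddim V)) (B : 'M[k]_p) :
  A *t B = (A *t 1%:M) *m (1%:M *t B).
Proof. by rewrite tensmx_mul mulmx1 mul1mx. Qed.

Let Phi_RKL : Phi *m (R *t sumK L) = (R *t sumK L) *m Phi.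
Proof. by rewrite tens_split mulmxA Phi_R -!mulmxA Phi_KL. Qed.

Let Phi_SKL : Phi *m (S *t sumK L) = (S *t sumK L) *m Phi.
Proof. by rewrite tens_split mulmxA Phi_S -!mulmxA Phi_KL. Qed.

Let Phi_KR : Phi *m ((K *m R) *t 1%:M) = ((K *m R) *t sumK L) *m Phi.
Proof.
have -> : (K *m R) *t 1%:M = (K *t 1%:M) *m (R *t (1%:M : 'M_(ddim L))).
  by rewrite tensmx_mul mulmx1.
by rewrite mulmxA Phi_K -mulmxA Phi_R mulmxA tensmx_mul mulmx1.
Qed.

Let Phi_KS : Phi *m ((K *m S) *t 1%:M) = ((K *m S) *t sumK L) *m Phi.
Proof.
have -> : (K *m S) *t 1%:M = (K *t 1%:M) *m (S *t (1%:M : 'M_(ddim L))).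
  by rewrite tensmx_mul mulmx1.
by rewrite mulmxA Phi_K -mulmxA Phi_S mulmxA tensmx_mul mulmx1.
Qed.

Variable xi : k.
Hypothesis xi0 : xi != 0.
Hypothesis neq_xi : xi ^+ n != sg ^+ n.

(** At the pair of L for the parameter sg of V, [FX] and [FY] are the conjugates by [Phi] of x and y
    on V (x) L for the parameter xi. Thus L is filtered at sg, whereas z is taken at xi; at scalar x
    and y, [F] is the operator of [zfree_shift]. *)
Let FX m (x : 'M[k]_m) : 'M[k]_(ddim V * m) :=
  R *t x - (sg * gam) *: ((K *m R) *t 1%:M) + (xi * gam) *: (K *t 1%:M).
Let FY m (y : 'M[k]_m) : 'M[k]_(ddim V * m) :=
  S *t y - (c0 / sg) *: ((K *m S) *t 1%:M) + (c0 / xi) *: (K *t 1%:M).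
Let F m (x y : 'M[k]_m) : 'M[k]_(ddim V * m) :=
  FX x * FY y - c0 *: (1 : 'M[k]_(ddim V * m)).

Let Phi_FX : opx (dtens V L) xi *m Phi = Phi *m FX (opx L sg).
Proof.
rewrite opx_tens /opx GV XV GL /FX mulmxDr mulmxBr.
rewrite tensmxDr !tensmxZr mulmxDr !mxmZ Phi_X Phi_RKL Phi_KR Phi_K.
rewrite !(tensmxDl, tensmxZl, tensmxNl) !(scalerDr, scalerN, mulmxDl, mulNmx, mxZm).
set a := _ *m Phi; set b := _ *m Phi; set c := _ *m Phi; set e := _ *m Phi.
by apply/matrixP => i j; rewrite !mxE; ring.
Qed.

Let Phi_FY : opy (dtens V L) xi *m Phi = Phi *m FY (opy L sg).
Proof.
rewrite opy_tens /opy AV /FY mulmxDr mulmxBr.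
rewrite tensmxDr !tensmxZr mulmxDr !mxmZ Phi_A Phi_SKL Phi_KS Phi_K.
rewrite !(tensmxDl, tensmxZl, tensmxNl) !(scalerDr, scalerN, mulmxDl, mulNmx, mxZm).
set a := _ *m Phi; set b := _ *m Phi; set c := _ *m Phi; set e := _ *m Phi.
by apply/matrixP => i j; rewrite !mxE; ring.
Qed.

Let tameL : tame L.
Proof. by rewrite /tame GL expmxZ gamd Kd scale1r. Qed.

Let tameV : tame V.
Proof. by rewrite /tame GV Kd. Qed.

Lemma zfree_band_tens : zfree d (zop (dtens V L) xi).
Proof.
have Phi_F : zop (dtens V L) xi *m Phi = Phi *m F (opx L sg) (opy L sg).
  rewrite /zop /F -!mulmxE mulmxBl mulmxBr mxZm mxmZ mul1mx mulmx1.
  by rewrite -mulmxA Phi_FY !mulmxA Phi_FX.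
have Fd : F (opx L sg) (opy L sg) ^+ d = 0.
  have inv' := mulmx1C phi_inv.
  rewrite -[LHS]mul1mx -inv' -mulmxA -(expmx_intertwine _ Phi_F).
  by rewrite tame_zop ?mul0mx ?mulmx0 //; apply: tame_tens.
have W : weyl T sg (opx L sg) (opy L sg).
  split; first exact: op_yx.
    by rewrite opx_d tameL.
  by rewrite opy_d.
apply: (zfree_iso phi_inv (mulmx1C phi_inv) (Z := F (opx L sg) (opy L sg))).
  by rewrite -[LHS]mul1mx -(mulmx1C phi_inv) -!mulmxA [Phi *m _]mulmxA -Phi_F
    -!mulmxA phi_inv mulmx1.
apply: (@zfree_flag _ T sg sg0 (fun m => ddim V * m)%N
  (fun a b f => (1%:M : 'M_(ddim V)) *t f) F _ _ _ _ _ _ _ _ W Fd).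
- by move=> a; rewrite tensmx11.
- by move=> *; rewrite tensmx_mul mulmx1.
- by move=> *; rewrite tensmxDr.
- move=> a b f u v u' v' uf vf.
  have X : FX u *m (1%:M *t f) = (1%:M *t f) *m FX u'.
    rewrite /FX !mulmxDl !mulmxDr mulNmx mulmxN !mxZm !mxmZ !tensmx_mul uf.
    by rewrite !mul1mx !mulmx1.
  have Y : FY v *m (1%:M *t f) = (1%:M *t f) *m FY v'.
    rewrite /FY !mulmxDl !mulmxDr mulNmx mulmxN !mxZm !mxmZ !tensmx_mul vf.
    by rewrite !mul1mx !mulmx1.
  rewrite /F -!mulmxE mulmxBl mulmxBr mxZm mxmZ mul1mx mulmx1.
  by rewrite -mulmxA Y !mulmxA X.
- move=> x1 x1d; have x10 : x1 != 0.
    apply: contra_neq sg0 => x10; apply/eqP; move: x1d.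
    rewrite x10 expr0n gtn_eqF ?(ltnW (td_ge2 T)) // => /esym/eqP.
    by rewrite expf_eq0 => /andP[].
  have lM (A B : 'M[k]_(ddim V)) :
      (A *m B) *t 1%:M = (A *t 1%:M) * (B *t (1%:M : 'M[k]_1)).
    by rewrite -mulmxE tensmx_mul mulmx1.
  have lX (A : 'M[k]_(ddim V)) r :
      A ^+ r *t 1%:M = (A *t (1%:M : 'M[k]_1)) ^+ r.
    by rewrite tensX -[1%:M]/1 expr1n.
  rewrite /F /FX /FY -[x1%:M]scalemx1 -[(c0 / x1)%:M]scalemx1 !tensmxZr !lM.
  have dv (x : k) : x != 0 -> x * (c0 / x) = c0 by move=> x_0; rewrite mulrC mulfVK.
  apply: (zfree_shift (n := n) (td_ge2 T) _ prq (c0E T)) => //;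
    rewrite ?dv ?td_unit //.
  + by rewrite -lM SR tensmx11.
  + by rewrite -lM RS tensmx11.
  + by rewrite -lX shift_n tensmx11.
  + by rewrite -lX Kd tensmx11.
  + by rewrite -!lM RK tensmxZl.
Qed.
End BandTensor.

(** * Kernels, cokernels and exactness *)

Section SubQuotient.
Variables (k : closedFieldType) (T : taft_data k).
Local Notation Zn := ('Z_(tn T)).
Local Notation dmod := (dmod T).

Section Transport.
Variables (M : dmod) (r : nat).
Variable rel : 'M[k]_(ddim M) -> 'M[k]_r -> Prop.
Hypothesis rel1 : rel 1 1.
Hypothesis relM : forall A A' B B', rel A A' -> rel B B' -> rel (A * B) (A' * B').
Hypothesis relD : forall A A' B B', rel A A' -> rel B B' -> rel (A + B) (A' + B').
Hypothesis relZ : forall c A A', rel A A' -> rel (c *: A) (c *: A').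
Hypothesis rel_inj : forall A B C, rel A B -> rel A C -> B = C.

Variables (e' a' : Zn -> 'M[k]_r) (G' X' : 'M[k]_r).
Hypothesis rel_e : forall j, rel (de M j) (e' j).
Hypothesis rel_a : forall j, rel (da M j) (a' j).
Hypothesis rel_G : rel (dG M) G'.
Hypothesis rel_X : rel (dX M) X'.

Let rel0 : rel 0 0.
Proof. by have := relZ 0 rel1; rewrite !scale0r. Qed.

Let relX A A' j : rel A A' -> rel (A ^+ j) (A' ^+ j).
Proof.
by move=> rA; elim: j => [|j IH]; rewrite ?expr0 // !exprS; apply: relM.
Qed.

Let relN A A' : rel A A' -> rel (- A) (- A').
Proof. by move=> rA; have := relZ (-1) rA; rewrite !scaleN1r. Qed.

Let eq_rel A B A' B' : A = B -> rel A A' -> rel B B' -> A' = B'.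
Proof. by move=> -> rA rB; apply: rel_inj rA rB. Qed.

Let rel_gamma j p : rel (gamma (da M) j p) (gamma a' j p).
Proof. by elim: p => [|p IH] //=; apply: relM. Qed.

Let tr_orth i j : e' i * e' j = if i == j then e' i else 0.
Proof.
by apply: eq_rel (de_orth M i j) (relM (rel_e i) (rel_e j)) _; case: ifP.
Qed.

Let tr_sum : \sum_i e' i = 1.
Proof.
apply: eq_rel (de_sum M) _ rel1.
by apply: (big_ind2 rel).
Qed.

(** A relation compatible with the algebra operations and functional in its second argument carries
    each defining relation of D from M to k^r. It serves for submodules, as A i = i B, and for
    quotients, as p A = B p. *)
Definition transport_dmod : dmod.
Proof.
refine (@DMod k T r e' a' G' X' tr_orth tr_sum _ _ _ _ _ _ _ _ _).
- by move=> i; apply: eq_rel (da_vert M i) _ _ => //; do !apply: relM.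
- by move=> i; apply: eq_rel (da_nilp M i) _ rel0.
- by apply: eq_rel (dG_order M) _ rel1; apply: relX.
- by apply: eq_rel (dX_nilp M) _ rel0; apply: relX.
- by apply: eq_rel (dGX M) _ _; [apply: relM|apply/relZ/relM].
- by move=> i; apply: eq_rel (dGe M i) _ _; apply: relM.
- by move=> i; apply: eq_rel (daG M i) _ _; [apply: relM|apply/relZ/relM].
- by move=> i; apply: eq_rel (deX M i) _ _; apply: relM.
- move=> i; apply: eq_rel (daX M i) _ _; first exact: relM.
  apply/relZ/relD; last exact/relZ/relM.
  by apply: relD; [apply: relM|apply: relN].
Defined.
End Transport.

Lemma sub_dmod M r (i : 'M[k]_(ddim M, r)) i' : i' *m i = 1%:M ->
  (forall j, i *m (i' *m (de M j *m i)) = de M j *m i) ->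
  i *m (i' *m (sumA M *m i)) = sumA M *m i ->
  i *m (i' *m (dG M *m i)) = dG M *m i ->
  i *m (i' *m (dX M *m i)) = dX M *m i ->
  exists (K : dmod) (f : 'M[k]_(ddim M, ddim K)) f',
    [/\ is_dhom f, f' *m f = 1%:M & f *m f' = i *m i'].
Proof.
move=> i'i ie iA iG iX.
pose rel (A : 'M[k]_(ddim M)) (B : 'M[k]_r) := A *m i = i *m B.
have rel1 : rel 1 1 by rewrite /rel mul1mx mulmx1.
have relM A A' B B' : rel A A' -> rel B B' -> rel (A * B) (A' * B').
  by rewrite /rel => rA rB; rewrite -!mulmxE -mulmxA rB !mulmxA rA.
have relD A A' B B' : rel A A' -> rel B B' -> rel (A + B) (A' + B').
  by rewrite /rel => rA rB; rewrite mulmxDl mulmxDr rA rB.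
have relZ c A A' : rel A A' -> rel (c *: A) (c *: A').
  by rewrite /rel => rA; rewrite mxmZ mxZm rA.
have rel_inj A B C : rel A B -> rel A C -> B = C.
  rewrite /rel => -> /(congr1 (mulmx i')).
  by rewrite !mulmxA i'i !mul1mx.
have re j : rel (de M j) (i' *m (de M j *m i)) by rewrite /rel ie.
have rA : rel (sumA M) (i' *m (sumA M *m i)) by rewrite /rel iA.
have ra j : rel (da M j) (i' *m (sumA M *m i) * (i' *m (de M j *m i))).
  by rewrite da_eq; apply: relM.
have rG : rel (dG M) (i' *m (dG M *m i)) by rewrite /rel iG.
have rX : rel (dX M) (i' *m (dX M *m i)) by rewrite /rel iX.
exists (transport_dmod rel1 relM relD relZ rel_inj re ra rG rX), i, i'.
by split=> //; split=> [j|j||]; apply/esym; [apply: re|apply: ra|apply: rG|apply: rX].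
Qed.

Lemma quot_dmod M r (p : 'M[k]_(r, ddim M)) p' : p *m p' = 1%:M ->
  (forall j, (p *m de M j) *m p' *m p = p *m de M j) ->
  (p *m sumA M) *m p' *m p = p *m sumA M ->
  (p *m dG M) *m p' *m p = p *m dG M ->
  (p *m dX M) *m p' *m p = p *m dX M ->
  exists (Q : dmod) (f : 'M[k]_(ddim Q, ddim M)) f',
    [/\ is_dhom f, f *m f' = 1%:M & f' *m f = p' *m p].
Proof.
move=> pp' pe pA pG pX.
pose rel (A : 'M[k]_(ddim M)) (B : 'M[k]_r) := p *m A = B *m p.
have rel1 : rel 1 1 by rewrite /rel mul1mx mulmx1.
have relM A A' B B' : rel A A' -> rel B B' -> rel (A * B) (A' * B').
  by rewrite /rel => rA rB; rewrite -!mulmxE mulmxA rA -!mulmxA rB.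
have relD A A' B B' : rel A A' -> rel B B' -> rel (A + B) (A' + B').
  by rewrite /rel => rA rB; rewrite mulmxDl mulmxDr rA rB.
have relZ c A A' : rel A A' -> rel (c *: A) (c *: A').
  by rewrite /rel => rA; rewrite mxmZ mxZm rA.
have rel_inj A B C : rel A B -> rel A C -> B = C.
  rewrite /rel => -> /(congr1 (mulmx^~ p')) /=.
  by rewrite -!mulmxA pp' !mulmx1.
have re j : rel (de M j) (p *m de M j *m p') by rewrite /rel pe.
have rA : rel (sumA M) (p *m sumA M *m p') by rewrite /rel pA.
have ra j : rel (da M j) ((p *m sumA M *m p') * (p *m de M j *m p')).
  by rewrite da_eq; apply: relM.
have rG : rel (dG M) (p *m dG M *m p') by rewrite /rel pG.
have rX : rel (dX M) (p *m dX M *m p') by rewrite /rel pX.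
exists (transport_dmod rel1 relM relD relZ rel_inj re ra rG rX), p, p'.
by split=> //; split.
Qed.

Lemma joint_kernel (I : finType) M (N : I -> dmod)
    (g : forall t, 'M[k]_(ddim (N t), ddim M)) :
  (forall t, is_dhom (g t)) ->
  exists (K : dmod) (f : 'M[k]_(ddim M, ddim K)) f',
    [/\ is_dhom f, f' *m f = 1%:M, forall t, g t *m f = 0
      & forall s (u : 'M[k]_(ddim M, s)), (forall t, g t *m u = 0) ->
          f *m (f' *m u) = u].
Proof.
move=> hg; pose U := (\bigcap_t kermx (g t)^T)%MS.
pose i := (row_base U)^T; pose i' := (pinvmx (row_base U))^T.
have i'i : i' *m i = 1%:M.
  by rewrite -trmx_mul mulmxVp ?row_base_free // trmx1.
have memP s (u : 'M[k]_(ddim M, s)) :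
    (forall t, g t *m u = 0) <-> (u^T <= U)%MS.
  split=> [gu|uU t].
    apply/sub_bigcapmxP => t _; apply/sub_kermxP.
    by rewrite -trmx_mul gu trmx0.
  move/sub_bigcapmxP: uU => /(_ t isT) /sub_kermxP.
  by rewrite -trmx_mul => /(congr1 trmx); rewrite trmxK trmx0.
have iK s (u : 'M[k]_(ddim M, s)) : (forall t, g t *m u = 0) ->
    i *m (i' *m u) = u.
  move/memP => uU; apply: trmx_inj; rewrite !trmx_mul !trmxK.
  by rewrite mulmxKpV // eq_row_base.
have gi t : g t *m i = 0.
  by move: t; apply/memP; rewrite trmxK eq_row_base.
have stab (h : 'M[k]_(ddim M)) (h' : forall t, 'M[k]_(ddim (N t))) :
    (forall t, g t *m h = h' t *m g t) -> i *m (i' *m (h *m i)) = h *m i.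
  by move=> gh; apply: iK => t; rewrite mulmxA gh -mulmxA gi mulmx0.
have [||||K [f [f' [hf f'f ff']]]] := sub_dmod i'i.
- by move=> j; apply: stab => t; apply: dhom_e.
- by apply: stab => t; apply: dhom_A.
- by apply: stab => t; apply: dhom_G.
- by apply: stab => t; apply: dhom_X.
have fE : f = i *m i' *m f by rewrite -ff' -mulmxA f'f mulmx1.
exists K, f, f'; split=> // [t|s u gu].
  by rewrite fE !mulmxA gi !mul0mx.
by rewrite mulmxA ff' -mulmxA iK.
Qed.

Lemma dhom_cokernel M N (f : 'M[k]_(ddim N, ddim M)) : is_dhom f ->
  exists (Q : dmod) (p : 'M[k]_(ddim Q, ddim N)) p' f',
    [/\ is_dhom p, p *m p' = 1%:M, p *m f = 0
      & p' *m p = 1%:M - f *m f'].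
Proof.
move=> hf; pose f' := pinvmx f; pose e := 1%:M - f *m f'.
have ff'f : f *m f' *m f = f by rewrite mulmxKpV.
have ef : e *m f = 0 by rewrite mulmxBl mul1mx ff'f subrr.
have ee : e *m e = e by rewrite {2}/e mulmxBr mulmx1 mulmxA ef mul0mx subr0.
have := idem_split ee; have := mulmx_base e.
move: (\rank e) (col_base e) (row_base e) => r p' p p'p pp'.
have pf : p *m f = 0.
  by rewrite -[p]mul1mx -pp' -!mulmxA (mulmxA p') p'p ef mulmx0.
have stab (h : 'M[k]_(ddim N)) h' : h *m f = f *m h' ->
    p *m h *m p' *m p = p *m h.
  move=> hfh; rewrite -mulmxA p'p /e mulmxBr mulmx1 mulmxA -(mulmxA p) hfh.
  by rewrite !mulmxA pf !mul0mx subr0.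
have [||||Q [g [g' [hg gg' g'g]]]] := quot_dmod pp'.
- by move=> j; apply: stab (esym (dhom_e hf j)).
- by apply: stab (esym (dhom_A hf)).
- by apply: stab (esym (dhom_G hf)).
- by apply: stab (esym (dhom_X hf)).
exists Q, g, g', f'; split=> //; last by rewrite g'g.
by rewrite -[g]mul1mx -gg' -!mulmxA (mulmxA g') g'g p'p ef mulmx0.
Qed.
End SubQuotient.

Lemma inj_left_inv (k : fieldType) m p (A : 'M[k]_(m, p)) :
  (forall s (u : 'M[k]_(p, s)), A *m u = 0 -> u = 0) -> exists B, B *m A = 1%:M.
Proof.
move=> injA; have fA : row_free A^T.
  rewrite -kermx_eq0; apply/eqP/trmx_inj; rewrite trmx0; apply: injA.
  by rewrite -{1}[A]trmxK -trmx_mul mulmx_ker trmx0.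
exists (pinvmx A^T)^T; apply: trmx_inj.
by rewrite trmx_mul trmxK mulmxVp // trmx1.
Qed.

(** * Projectivity, freeness and tameness of extensions *)

Section Exact.
Variables (k : closedFieldType) (T : taft_data k).
Local Notation d := (td T).
Local Notation dmod := (dmod T).
Implicit Types M N L P Y : dmod.

Definition dexact M1 M M2 (i : 'M[k]_(ddim M, ddim M1))
    (p : 'M[k]_(ddim M2, ddim M)) : Prop :=
  [/\ is_dhom i, is_dhom p & exists i' p',
    [/\ i' *m i = 1%:M, p *m p' = 1%:M & i *m i' + p' *m p = 1%:M]].

Lemma dhom_tens M M' N N' (f : 'M[k]_(ddim M', ddim M))
    (g : 'M[k]_(ddim N', ddim N)) : is_dhom f -> is_dhom g ->
  is_dhom (M := dtens M N) (N := dtens M' N') (f *t g).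
Proof.
move=> hf hg; apply: dhom_total => [i|||].
- rewrite !dtens_e mulmx_sumr mulmx_suml; apply: eq_bigr => j _.
  by rewrite !tensmx_mul (dhom_e hf) (dhom_e hg).
- rewrite !sumA_tens mulmxDr mulmxDl !tensmx_mul (dhom_A hf) (dhom_A hg).
  by rewrite (dhom_K hg) mulmx1 mul1mx.
- by rewrite !dtens_G !tensmx_mul (dhom_G hf) (dhom_G hg).
- rewrite !dtens_X mulmxDr mulmxDl !tensmx_mul (dhom_X hf) (dhom_X hg).
  by rewrite (dhom_G hg) mulmx1 mul1mx.
Qed.

Lemma dexact_tens M1 M M2 (i : 'M[k]_(ddim M, ddim M1))
    (p : 'M[k]_(ddim M2, ddim M)) N : dexact i p ->
  dexact (M1 := dtens M1 N) (M := dtens M N) (M2 := dtens M2 N)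
    (i *t 1%:M) (p *t 1%:M).
Proof.
move=> [hi hp [i' [p' [i'i pp' ii']]]]; split.
- exact: dhom_tens hi (dhom_id N).
- exact: dhom_tens hp (dhom_id N).
exists (i' *t 1%:M), (p' *t 1%:M).
by rewrite !tensmx_mul -tensmxDl i'i pp' ii' !mulmx1 !tensmx11.
Qed.

Lemma dproj_retract M N (i : 'M[k]_(ddim M, ddim N)) (p : 'M[k]_(ddim N, ddim M)) :
  is_dhom i -> is_dhom p -> p *m i = 1%:M -> dprojective M -> dprojective N.
Proof.
move=> hi hp p_i projM A B g f hg rg hf.
have [h hh gh] := projM A B g (f *m p) hg rg (dhom_mul hp hf).
exists (h *m i); first exact: dhom_mul.
by rewrite mulmxA gh -mulmxA p_i mulmx1.
Qed.

Lemma dproj_ext M1 M M2 (i : 'M[k]_(ddim M, ddim M1))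
    (p : 'M[k]_(ddim M2, ddim M)) : dexact i p ->
  dprojective M1 -> dprojective M2 -> dprojective M.
Proof.
move=> [hi hp [i' [p' [i'i pp' ii']]]] pM1 pM2 A B g f hg rg hf.
have rp : \rank p = ddim M2.
  by apply/eqP; rewrite -/(row_free p); apply/row_freeP; exists p'.
have [s hs ps] := pM2 _ _ p 1%:M hp rp (dhom_id _).
have p_i : p *m i = 0.
  have := congr1 (fun x => p *m x *m i) ii'.
  rewrite mulmxDr mulmxDl mulmx1 -!mulmxA i'i mulmx1.
  by rewrite [p *m (p' *m _)]mulmxA pp' mul1mx -[RHS]add0r => /addIr.
pose r := i' *m (1%:M - s *m p).
have ir : i *m r = 1%:M - s *m p.
  rewrite mulmxA -[i *m i'](addrK (p' *m p)) ii' mulmxBl mul1mx.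
  rewrite -mulmxA mulmxBr mulmx1 [p *m (s *m p)]mulmxA ps mul1mx subrr.
  by rewrite mulmx0 subr0.
have hr : is_dhom r.
  apply: (dhom_inj_l i'i hi); rewrite ir; apply: dhom_add; first exact: dhom_id.
  exact/dhom_opp/dhom_mul.
have [h1 hh1 gh1] := pM1 _ _ g (f *m i) hg rg (dhom_mul hi hf).
have [h2 hh2 gh2] := pM2 _ _ g (f *m s) hg rg (dhom_mul hs hf).
exists (h1 *m r + h2 *m p).
  by apply: dhom_add; [apply: dhom_mul hh1|apply: dhom_mul hh2].
rewrite mulmxDr !mulmxA gh1 gh2 -!mulmxA -mulmxDr ir subrK.
by rewrite mulmx1.
Qed.

Lemma zfree_dext M1 M M2 (i : 'M[k]_(ddim M, ddim M1))
    (p : 'M[k]_(ddim M2, ddim M)) s : dexact i p -> s != 0 -> tame M ->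
  zfree d (zop M1 s) -> zfree d (zop M2 s) -> zfree d (zop M s).
Proof.
move=> [hi hp [i' [p' [i'i pp' ii']]]] s0 tM.
apply: zfree_ext i'i pp' ii' _ _ _; last exact: tame_zop.
  by rewrite dhom_zop.
by rewrite dhom_zop.
Qed.

(** G^d = 1 + v with v^2 = 0, so 1 = G^n = 1 + (n/d) v, and n/d is invertible in k. *)
Lemma tame_ext M1 M M2 (i : 'M[k]_(ddim M, ddim M1))
    (p : 'M[k]_(ddim M2, ddim M)) : dexact i p ->
  tame M1 -> tame M2 -> tame M.
Proof.
move=> [hi hp [i' [p' [i'i pp' ii']]]] tM1 tM2.
have [v vE] : exists v, dG M ^+ d = 1 + v.
  by exists (dG M ^+ d - 1); rewrite addrC subrK.
have vi : v *m i = 0.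
  apply: (addrI i); rewrite addr0 -{1}[i]mul1mx -mulmxDl -vE.
  by rewrite (expmx_intertwine _ (esym (dhom_G hi))) tM1 mulmx1.
have pv : p *m v = 0.
  apply: (addrI p); rewrite addr0 -{1}[p]mulmx1 -mulmxDr -vE.
  by rewrite -(expmx_intertwine _ (esym (dhom_G hp))) tM2 mul1mx.
have vv : v * v = 0.
  rewrite -mulmxE -{2}[v]mul1mx -ii' mulmxDl -!mulmxA pv mulmx0 addr0.
  by rewrite mulmxA vi mul0mx.
have vX r : (1 + v) ^+ r = 1 + r%:R *: v.
  elim: r => [|r IH]; first by rewrite expr0 scale0r addr0.
  rewrite exprS IH mulrDl mul1r mulrDr mulr1 mxZr vv scaler0 addr0 -addrA.
  by rewrite -natr1 scalerDl scale1r.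
have := dG_order M; rewrite -(divnK (td_dvd_n T)) mulnC exprM vE vX.
rewrite /tame vE => /eqP; rewrite -subr_eq0 addrAC subrr add0r scaler_eq0.
case/orP => [/eqP m0|/eqP->]; last by rewrite addr0.
have := tn_inv T; rewrite -(divnK (td_dvd_n T)) natrM m0 mul0r eqxx.
by [].
Qed.

Lemma in_block_sub u i M K (f : 'M[k]_(ddim M, ddim K)) f' :
  is_dhom f -> f' *m f = 1%:M -> in_block u i M -> in_block u i K.
Proof.
move=> hf f'f [c [pc hL cM]]; exists c; split=> //.
have [[nat_c _ _] _ _] := pc.
have := congr1 (mulmx f') (nat_c _ _ _ hf).
by rewrite cM mul1mx mulmxA f'f mul1mx.
Qed.

Lemma in_block_quot u i M Q (p : 'M[k]_(ddim Q, ddim M)) p' :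
  is_dhom p -> p *m p' = 1%:M -> in_block u i M -> in_block u i Q.
Proof.
move=> hp pp' [c [pc hL cM]]; exists c; split=> //.
have [[nat_c _ _] _ _] := pc.
have := congr1 (mulmx^~ p') (nat_c _ _ _ hp).
by rewrite cM mulmx1 pp' -mulmxA pp' mulmx1.
Qed.
End Exact.

(** * Exactness of the equivalence with quiver representations *)

Section Equivalence.
Variables (k : closedFieldType) (T : taft_data k).
Local Notation Zn := ('Z_(tn T)).
Local Notation qmod := (qmod T).
Variables (u i : Zn) (E : block_equiv u i).

Lemma qhom0 (V W : qmod) : is_qhom (0 : 'M[k]_(qdim W, qdim V)).
Proof. by split=> p; rewrite mul0mx mulmx0. Qed.

Lemma qhom_mul (U V W : qmod) (f : 'M[k]_(qdim V, qdim U))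
    (g : 'M[k]_(qdim W, qdim V)) : is_qhom f -> is_qhom g -> is_qhom (g *m f).
Proof.
move=> hf hg; split=> p; rewrite -mulmxA.
- by rewrite (qhom_e hf) !mulmxA (qhom_e hg).
- by rewrite (qhom_b hf) !mulmxA (qhom_b hg).
- by rewrite (qhom_bb hf) !mulmxA (qhom_bb hg).
Qed.

Lemma be0 (V W : qmod) : be_mor E (0 : 'M[k]_(qdim W, qdim V)) = 0.
Proof.
have := be_linear E 1 (qhom0 V W) (qhom0 V W).
by rewrite !scale1r addr0 -[LHS]addr0 => /addrI.
Qed.

Lemma be_eq0 (V W : qmod) (f : 'M[k]_(qdim W, qdim V)) :
  is_qhom f -> be_mor E f = 0 -> f = 0.
Proof.
move=> hf Ef; apply: (be_faithful hf (qhom0 V W) (b := E)).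
by rewrite be0.
Qed.

(* Any homomorphism to or from an object of the block that is killed by the   *)
(* image of an epi or mono f comes from the quiver side, where f cancels.     *)
Lemma be_inj (V W : qmod) (f : 'M[k]_(qdim W, qdim V)) f' :
  is_qhom f -> f' *m f = 1%:M -> exists g, g *m be_mor E f = 1%:M.
Proof.
move=> hf f'f; apply: inj_left_inv => s a Efa.
have [K [ka [ka' [hk k'k fk kK]]]] :=
  joint_kernel (I := unit) (fun _ => be_hom E hf).
have [U [ph [ps [hph hps psph phps]]]] :=
  be_surj E (in_block_sub hk k'k (be_block E V)).
have [g hg Eg] := be_full (b := E) (dhom_mul hps hk).
have g0 : g = 0.
  rewrite -[g]mul1mx -f'f -mulmxA (_ : f *m g = 0) ?mulmx0 //.
  apply: be_eq0; first exact: qhom_mul.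
  by rewrite be_comp // Eg mulmxA (fk tt) mul0mx.
have ka0 : ka = 0.
  by rewrite -[ka]mulmx1 -psph mulmxA -Eg g0 be0 mul0mx.
by rewrite -(kK _ a) // ka0 mul0mx.
Qed.

Lemma be_epi (V W : qmod) (f : 'M[k]_(qdim W, qdim V)) f' :
  is_qhom f -> f *m f' = 1%:M -> exists g, be_mor E f *m g = 1%:M.
Proof.
move=> hf ff'.
have [Q [p [p' [g' [hp pp' pf p'p]]]]] := dhom_cokernel (be_hom E hf).
have [U [ph [ps [hph hps psph phps]]]] :=
  be_surj E (in_block_quot hp pp' (be_block E W)).
have [g hg Eg] := be_full (b := E) (dhom_mul hp hph).
have g0 : g = 0.
  rewrite -[g]mulmx1 -ff' mulmxA (_ : g *m f = 0) ?mul0mx //.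
  apply: be_eq0; first exact: qhom_mul.
  by rewrite be_comp // Eg -mulmxA pf mulmx0.
have p0 : p = 0 by rewrite -[p]mul1mx -psph -mulmxA -Eg g0 be0 mulmx0.
exists g'; apply/eqP; rewrite eq_sym -subr_eq0 -p'p p0 mulmx0.
by [].
Qed.

(** The joint kernel of the images of the [p t] lies in the block, so its inclusion comes from a
    quiver homomorphism g killed by every [p t], and g is the sum of the f_j r_j g. Here r_j g is a
    homomorphism even if r_j is not, because the f_j are jointly injective homomorphisms. Applying
    the functor to the sum gives the claim. *)
Lemma be_exact (I J : finType) (A : pred J) (V : qmod) (W : I -> qmod) (U : J -> qmod)
    (p : forall t, 'M[k]_(qdim (W t), qdim V))
    (f : forall j, 'M[k]_(qdim V, qdim (U j)))
    (r : forall j, 'M[k]_(qdim (U j), qdim V)) :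
  (forall t, is_qhom (p t)) -> (forall j, A j -> is_qhom (f j)) ->
  (forall j, A j -> r j *m f j = 1%:M) ->
  (forall j l, A j -> A l -> j != l -> r j *m f l = 0) ->
  (forall s (a : 'M[k]_(qdim V, s)), (forall t, p t *m a = 0) ->
     a = \sum_(j | A j) f j *m (r j *m a)) ->
  forall s (a : 'M[k]_(ddim (be_obj E V), s)),
    (forall t, be_mor E (p t) *m a = 0) ->
    exists y : forall j, 'M[k]_(ddim (be_obj E (U j)), s),
      a = \sum_(j | A j) be_mor E (f j) *m y j.
Proof.
move=> hp hf rf1 rf0 dec s a pa.
have [K [ka [ka' [hk k'k pk kK]]]] := joint_kernel (fun t => be_hom E (hp t)).
have [X [ph [ps [hph hps psph phps]]]] :=
  be_surj E (in_block_sub hk k'k (be_block E V)).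
have [g hg Eg] := be_full (b := E) (dhom_mul hps hk).
have pg t : p t *m g = 0.
  apply: be_eq0; first exact: qhom_mul.
  by rewrite be_comp // Eg mulmxA pk mul0mx.
have gE := dec _ g pg.
have rh j (hV : 'M[k]_(qdim V)) (hU : forall l, 'M[k]_(qdim (U l))) :
    A j -> (forall l, A l -> f l *m hU l = hV *m f l) ->
    r j *m (hV *m g) = hU j *m (r j *m g).
  move=> Aj fh; rewrite {1}gE mulmx_sumr mulmx_sumr (bigD1 j) //= big1 ?addr0.
    by rewrite !mulmxA -(mulmxA (r j)) -fh // !mulmxA rf1 ?mul1mx.
  move=> l /andP[Al neq]; rewrite !mulmxA -(mulmxA (r j)) -fh // !mulmxA.
  rewrite rf0 1?eq_sym //.
  by rewrite !mul0mx.
have hrg j : A j -> is_qhom (r j *m g).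
  move=> Aj; split=> v; rewrite -mulmxA.
  - rewrite (qhom_e hg) (rh j _ (fun l => qe (U l) v)) // => l Al.
    by rewrite (qhom_e (hf l Al)).
  - rewrite (qhom_b hg) (rh j _ (fun l => qb (U l) v)) // => l Al.
    by rewrite (qhom_b (hf l Al)).
  - rewrite (qhom_bb hg) (rh j _ (fun l => qbb (U l) v)) // => l Al.
    by rewrite (qhom_bb (hf l Al)).
have EgE : be_mor E g = \sum_(j | A j) be_mor E (f j) *m be_mor E (r j *m g).
  have hfr j : A j -> is_qhom (f j *m (r j *m g)).
    by move=> Aj; apply: qhom_mul; [apply: hrg|apply: hf].
  rewrite {1}gE; transitivity (\sum_(j | A j) be_mor E (f j *m (r j *m g))).
    pose ok (x : 'M[k]_(qdim V, qdim X)) y := is_qhom x /\ be_mor E x = y.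
    suff [] : ok (\sum_(j | A j) f j *m (r j *m g))
        (\sum_(j | A j) be_mor E (f j *m (r j *m g))).
      by [].
    apply: (big_ind2 ok) => [|x x' y y' [hx <-] [hy <-]|j Aj].
    - by split; [apply: qhom0|apply: be0].
    - split; last by have := be_linear E 1 hx hy; rewrite !scale1r.
      split=> v; rewrite mulmxDl mulmxDr.
      + by rewrite (qhom_e hx) (qhom_e hy).
      + by rewrite (qhom_b hx) (qhom_b hy).
      + by rewrite (qhom_bb hx) (qhom_bb hy).
    - by split=> //; apply: hfr.
  by apply: eq_bigr => j Aj; rewrite be_comp //; [apply: hrg|apply: hf].
exists (fun j => be_mor E (r j *m g) *m (ph *m (ka' *m a))).
rewrite -{1}(kK _ a pa) -[ka]mulmx1 -psph !mulmxA -Eg EgE.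
by rewrite !mulmx_suml; apply: eq_bigr => j _; rewrite !mulmxA.
Qed.

Lemma be_dexact (V1 V V2 : qmod) (f : 'M[k]_(qdim V, qdim V1))
    (p : 'M[k]_(qdim V2, qdim V)) f' p' : is_qhom f -> is_qhom p ->
  f' *m f = 1%:M -> p *m p' = 1%:M -> f *m f' + p' *m p = 1%:M ->
  dexact (be_mor E f) (be_mor E p).
Proof.
move=> hf hp f'f pp' ff'.
have p_f : p *m f = 0.
  have := congr1 (fun x => p *m x *m f) ff'.
  rewrite mulmxDr mulmxDl mulmx1 -!mulmxA f'f mulmx1.
  by rewrite [p *m (p' *m _)]mulmxA pp' mul1mx -[RHS]add0r => /addIr.
split; try exact: be_hom.
have [g gE] := be_inj hf f'f; have [g' pg'] := be_epi hp pp'.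
(* The left inverse [g] is corrected so as to vanish on the section [g']; the splitting identity
   then amounts to exactness in the middle. *)
exists (g *m (1%:M - g' *m be_mor E p)), g'.
have [||||y yE] := @be_exact unit unit xpredT V (fun _ => V2) (fun _ => V1)
    (fun _ => p) (fun _ => f) (fun _ => f') (fun _ => hp) (fun _ _ => hf) _ _ _
    _ (1%:M - g' *m be_mor E p).
- by [].
- by case; case.
- move=> s a /(_ tt) pa; rewrite (bigD1 tt) //= big1 => [|[]//].
  by rewrite addr0 -{1}[a]mul1mx -ff' mulmxDl -!mulmxA pa mulmx0 addr0.
- by case; rewrite mulmxBr mulmx1 mulmxA pg' mul1mx subrr.
have {}yE : 1%:M - g' *m be_mor E p = be_mor E f *m y tt.
  by rewrite yE (bigD1 tt) //= big1 ?addr0 // => -[].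
split=> //.
  rewrite mulmxBr mulmx1 mulmxBl gE -!mulmxA -be_comp // p_f be0.
  by rewrite !mulmx0 subr0.
rewrite yE [be_mor E f *m (_ *m _)]mulmxA -(mulmxA _ g) (mulmxA g) gE mul1mx.
by rewrite -yE subrK.
Qed.
End Equivalence.

(** * Simple modules and modules of length two *)

Lemma mulmx1C_eq (k : fieldType) m p (A : 'M[k]_(m, p)) (B : 'M[k]_(p, m)) :
  m = p -> B *m A = 1%:M -> A *m B = 1%:M.
Proof. by move=> e; subst p => /mulmx1C. Qed.

Section Ladders.
Variables (k : closedFieldType) (T : taft_data k).
Local Notation n := (tn T).
Local Notation d := (td T).
Local Notation q := (tq T).
Local Notation Zn := ('Z_(tn T)).
Local Notation dmod := (dmod T).

Let q0 : q != 0 := tq_neq0 T.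

Lemma td_le_tn : (d <= n)%N.
Proof. exact: dvdn_leq (ltnW (tn_gt1 T)) (td_dvd_n T). Qed.

Lemma val_Zn r : (r < n)%N -> (r%:R : Zn) = r :> nat.
Proof. by move=> lt_r; rewrite val_Zp_nat ?tn_gt1 // modn_small. Qed.

Lemma natZn_inj r s : (r < n)%N -> (s < n)%N -> (r%:R : Zn) = s%:R -> r = s.
Proof. by move=> lr ls /(congr1 val) /=; rewrite !val_Zn. Qed.

Section Vectors.
Variable M : dmod.
Implicit Type v : 'cV[k]_(ddim M).

Lemma eA_vec v i r : de M i *m v = v ->
  de M (i + r%:R) *m (sumA M ^+ r *m v) = sumA M ^+ r *m v.
Proof.
move=> ev; elim: r => [|r IH]; first by rewrite mulr0n addr0 expr0 mul1mx.
by rewrite expmxS -mulmxA mulmxA e_shift -natr1 addrA addrK -mulmxA IH.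
Qed.

Lemma eX_vec v i r : de M i *m v = v ->
  de M (i - r%:R) *m (dX M ^+ r *m v) = dX M ^+ r *m v.
Proof.
move=> ev; elim: r => [|r IH]; first by rewrite mulr0n subr0 expr0 mul1mx.
rewrite expmxS -mulmxA mulmxA e_shiftX -natr1 opprD addrA subrK -mulmxA IH.
by [].
Qed.

Lemma Kvec v i : de M i *m v = v -> sumK M *m v = qpow i *: v.
Proof. by move=> <-; rewrite mulmxA Ke mxZm. Qed.

(** By X a = q a X + 1 - G K, moving X across a^(r+1) to reach v, where it vanishes, leaves only
    multiples of a^r v. *)
Lemma XA_vec v g i r : dX M *m v = 0 -> de M i *m v = v -> dG M *m v = g *: v ->
  exists b, dX M *m (sumA M ^+ r.+1 *m v) = b *: (sumA M ^+ r *m v).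
Proof.
move=> Xv ev Gv.
have Gr p : dG M *m (sumA M ^+ p *m v) = (q ^+ p * g) *: (sumA M ^+ p *m v).
  elim: p => [|p IH]; first by rewrite expr0 mul1mx mul1r.
  have GA : dG M *m sumA M = q *: (sumA M *m dG M).
    by rewrite !mulmxE dAG scalerA mulfV ?scale1r.
  rewrite {1}expmxS -mulmxA mulmxA GA mxZm -mulmxA IH mxmZ scalerA mulmxA.
  by rewrite -expmxS mulrA -exprS.
have XA : dX M *m sumA M = q *: (sumA M *m dX M) + 1%:M - dG M *m sumK M.
  rewrite !mulmxE dAX scalerA mulfV // scale1r.
  by rewrite addrAC addrK subrK.
have GK p : dG M *m sumK M *m (sumA M ^+ p *m v) =
    (qpow (i + p%:R) * (q ^+ p * g)) *: (sumA M ^+ p *m v).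
  by rewrite -mulmxA (Kvec (eA_vec p ev)) mxmZ Gr scalerA.
elim: r => [|r [b IH]].
  exists (1 - qpow (i + 0%:R) * (q ^+ 0 * g)).
  rewrite expmxS -mulmxA mulmxA XA mulmxBl GK mulmxDl mxZm -mulmxA expr0.
  by rewrite !mul1mx Xv mulmx0 scaler0 add0r scalerBl scale1r.
exists (q * b + 1 - qpow (i + r.+1%:R) * (q ^+ r.+1 * g)).
rewrite expmxS -mulmxA mulmxA XA mulmxBl GK mulmxDl mxZm -mulmxA IH mxmZ.
rewrite mul1mx mulmxA -expmxS scalerBl scalerDl scale1r scalerA.
by [].
Qed.

Lemma AX_vec v g i r : sumA M *m v = 0 -> de M i *m v = v -> dG M *m v = g *: v ->
  exists b, sumA M *m (dX M ^+ r.+1 *m v) = b *: (dX M ^+ r *m v).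
Proof.
move=> Av ev Gv.
have Gr p : dG M *m (dX M ^+ p *m v) = (q^-1 ^+ p * g) *: (dX M ^+ p *m v).
  elim: p => [|p IH]; first by rewrite expr0 mul1mx mul1r.
  have GX : dG M *m dX M = q^-1 *: (dX M *m dG M) by rewrite !mulmxE dGX.
  rewrite {1}expmxS -mulmxA mulmxA GX mxZm -mulmxA IH mxmZ scalerA mulmxA.
  by rewrite -expmxS mulrA -exprS.
have AX : sumA M *m dX M =
    q^-1 *: (dX M *m sumA M - 1%:M + dG M *m sumK M) by rewrite !mulmxE dAX.
have GK p : dG M *m sumK M *m (dX M ^+ p *m v) =
    (qpow (i - p%:R) * (q^-1 ^+ p * g)) *: (dX M ^+ p *m v).
  by rewrite -mulmxA (Kvec (eX_vec p ev)) mxmZ Gr scalerA.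
elim: r => [|r [b IH]].
  exists (q^-1 * (- 1 + qpow (i - 0%:R) * (q^-1 ^+ 0 * g))).
  rewrite expmxS -mulmxA mulmxA AX mxZm mulmxDl GK mulmxBl -mulmxA expr0.
  rewrite !mul1mx Av mulmx0 add0r -[RHS]scalerA; congr (_ *: _).
  by rewrite scalerDl scaleN1r.
exists (q^-1 * (b - 1 + qpow (i - r.+1%:R) * (q^-1 ^+ r.+1 * g))).
rewrite expmxS -mulmxA mulmxA AX mxZm mulmxDl GK mulmxBl -mulmxA IH mxmZ.
rewrite mul1mx mulmxA -expmxS -[RHS]scalerA; congr (_ *: _).
by rewrite !scalerDl scaleN1r.
Qed.

Lemma weights_indep N (v : 'I_N -> 'cV[k]_(ddim M)) (wt : 'I_N -> Zn) :
  injective wt -> (forall r, de M (wt r) *m v r = v r) ->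
  (forall r, v r != 0) ->
  exists B, B *m (\matrix_(i, r) v r i 0) = 1%:M.
Proof.
move=> inj_wt ev v0; apply: inj_left_inv => s a Wa.
have WE (b : 'M_(N, s)) : (\matrix_(i, r) v r i 0) *m b =
    \sum_r v r *m row r b.
  apply/matrixP => i j; rewrite !mxE summxE; apply: eq_bigr => r _.
  by rewrite !mxE big_ord1 !mxE.
apply/row_matrixP => r; rewrite row0.
have := congr1 (mulmx (de M (wt r))) Wa.
rewrite WE mulmx0 mulmx_sumr (bigD1 r) //= big1 ?addr0 => [|l neq].
  rewrite mulmxA ev => /matrixP E; apply/rowP => j; rewrite [RHS]mxE.
  have [i vi] : exists i, v r i 0 != 0.
    apply/existsP; apply: contraR (v0 r); rewrite negb_exists => /forallP v_0.
    by apply/eqP/colP => i; rewrite [RHS]mxE; apply/eqP; move: (v_0 i); rewrite negbK.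
  have := E i j; rewrite !mxE big_ord1 => /eqP.
  by rewrite mulf_eq0 (negPf (vi : v r i ord0 != 0)) mxE => /eqP.
by rewrite -ev -mulmxA eeM (inj_eq inj_wt) eq_sym (negPf neq).
Qed.
End Vectors.

(** The shape of L(u, j): a string of N one-dimensional weight spaces, climbed by a and descended by
    X. *)
Record ladder (L : dmod) (j : Zn) (N : nat) (w : 'cV[k]_(ddim L)) : Prop := Ladder {
  lad_lt : (N < d)%N;
  lad_dim : ddim L = N;
  lad_e : de L j *m w = w;
  lad_neq0 : forall r, (r < N)%N -> sumA L ^+ r *m w != 0;
  lad_span : forall r (m : 'cV[k]_(ddim L)), (r < N)%N ->
    exists c, de L (j + r%:R) *m m = c *: (sumA L ^+ r *m w);
  lad_out : forall i, (forall r, (r < N)%N -> i != j + r%:R) -> de L i = 0;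
  lad_X : forall r, (r.+1 < N)%N ->
    exists2 c, c != 0 & dX L *m (sumA L ^+ r.+1 *m w) = c *: (sumA L ^+ r *m w) }.

(** The a^r w with r < d span a submodule, by [XA_vec], hence all of L. If one with r < N vanished,
    fewer than N would span. The first N have distinct weights because N < d <= n, so they form a
    basis. *)
Lemma simple_ladder u j L : is_L u j L -> exists w : 'cV[k]_(ddim L), ladder j (Ldim u j) w.
Proof.
move=> [[L_gt0 sL] dimL GL [w [w0 Xw ew kerX]]]; exists w.
set N := Ldim u j in dimL *.
have ltNd : (N < d)%N.
  have res0 : (0 < residue T (weight u j))%N.
    rewrite /residue; case: ifP => [_|/negbT]; first exact: ltnW (td_ge2 T).
    by rewrite /dvdn lt0n.
  by rewrite /N /Ldim ltn_subrL res0 (ltnW (td_ge2 T)).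
pose v r := sumA L ^+ r *m w.
have ev r : de L (j + r%:R) *m v r = v r by apply: eA_vec.
have Gv r : dG L *m v r = qpow (u + (j + r%:R)) *: v r.
  by rewrite -{1}ev mulmxA mulmxE GL mxZm ev.
pose W : 'M[k]_(ddim L, d) := \matrix_(i, r) v r i 0.
have WE s (b : 'M_(d, s)) : W *m b = \sum_(r < d) v r *m row r b.
  apply/matrixP => i l; rewrite !mxE summxE; apply: eq_bigr => r _.
  by rewrite !mxE big_ord1 !mxE.
have stabW (A : 'M[k]_(ddim L)) :
    (forall r : 'I_d, exists f : 'cV[k]_d, A *m v r = W *m f) ->
    stablemx <<W^T>>%MS A^T.
  case/fin_all_exists => f Af; rewrite genmxE (eqmxMr _ (genmxE _)).
  apply/submxP; exists (\matrix_(r, i) f r i 0).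
  apply: trmx_inj; rewrite !trmx_mul !trmxK; apply/matrixP => i r.
  have := congr1 (fun x : 'cV_(ddim L) => x i 0) (Af r).
  rewrite !mxE => E; transitivity (\sum_l A i l * v r l 0).
    by apply: eq_bigr => l _; rewrite !mxE.
  by rewrite E; apply: eq_bigr => l _; rewrite !mxE.
have Wd (r : 'I_d) c : c *: v r = W *m (c *: delta_mx r 0).
  rewrite mxmZ; congr (_ *: _); apply/colP => i; rewrite [RHS]mxE (bigD1 r) //=.
  rewrite big1 ?addr0 => [|l neq]; rewrite !mxE; first by rewrite !eqxx mulr1.
  by rewrite (negPf neq) mulr0.
have vd : v d = 0 by rewrite /v dA_nilp mul0mx.
have Wv c r : (r < d)%N -> exists f : 'cV[k]_d, c *: v r = W *m f.
  by move=> lt_r; exists (c *: delta_mx (Ordinal lt_r) 0); rewrite -Wd.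
have stA : stablemx <<W^T>>%MS (sumA L)^T.
  apply: stabW => r; have [lt_r|le_d] := ltnP r.+1 d.
    have [f fE] := Wv 1 _ lt_r; exists f.
    by rewrite -fE scale1r /v expmxS mulmxA.
  have ed : r.+1 = d by apply/eqP; rewrite eqn_leq le_d ltn_ord.
  exists 0; rewrite mulmx0 -[RHS]vd -[in RHS]ed /v.
  by rewrite expmxS mulmxA.
have ste i : stablemx <<W^T>>%MS (de L i)^T.
  apply: stabW => r.
  have [f fE] := Wv (i == j + r%:R)%:R _ (ltn_ord r); exists f; rewrite -fE.
  rewrite -{1}ev eeM; case: eqP => [->|_]; first by rewrite ev scale1r.
  by rewrite scale0r.
have stU : dstable <<W^T>>%MS.
  split=> // [i||].
  - rewrite da_eq -mulmxE trmx_mul mulmxA.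
    exact: submx_trans (submxMr _ (ste i)) stA.
  - apply: stabW => r; rewrite Gv.
    by have [f fE] := Wv (qpow (u + (j + r%:R))) _ (ltn_ord r); exists f.
  apply: stabW => -[[|r] /= lt_r].
    by exists 0; rewrite mulmx0 /v expr0 mul1mx.
  have := Gv 0%N; rewrite /v expr0 mul1mx => Gw.
  have [b ->] := XA_vec r Xw ew Gw.
  by have [f fE] := Wv b _ (ltnW lt_r); exists f.
have rW : \rank W = N.
  rewrite -dimL -mxrank_tr; case: (sL _ stU) => [U0|/eqP]; last first.
    by rewrite genmxE.
  case/negP: w0; have := WE 1%N (delta_mx (Ordinal (ltnW (td_ge2 T))) 0).
  have -> : W = 0.
    apply: trmx_inj; rewrite trmx0; apply/eqP; rewrite -submx0.
    by rewrite -genmxE U0.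
  rewrite mul0mx => /esym; have := Wd (Ordinal (ltnW (td_ge2 T))) 1.
  by rewrite WE !scale1r => <-; rewrite /v expr0 mul1mx => ->.
have vN0 r : (r < N)%N -> v r != 0.
  move=> lt_r; apply: contraTneq (leqnn N) => v_r0; rewrite -ltnNge -{1}rW.
  pose W1 : 'M[k]_(ddim L, r) := \matrix_(i, l) v l i 0.
  pose P1 : 'M[k]_(r, d) := \matrix_(l, l') (l == l' :> nat)%:R.
  have v_ge s : (r <= s)%N -> v s = 0.
    by move=> le_rs; rewrite /v -(subnK le_rs) exprD -mulmxE -mulmxA -/(v r)
      v_r0 mulmx0.
  apply: leq_ltn_trans lt_r.
  suff -> : W = W1 *m P1 by apply: mulmx_max_rank.
  have W1E i l : W1 i l = v l i 0 by rewrite [LHS]mxE.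
  have P1E l l' : P1 l l' = (l == l' :> nat)%:R by rewrite mxE.
  apply/matrixP => i l; rewrite [LHS]mxE [RHS]mxE.
  have [lt_l|le_l] := ltnP l r.
    rewrite (bigD1 (Ordinal lt_l)) //= W1E P1E eqxx mulr1 big1 ?addr0 // => l' neq.
    rewrite P1E [_ == _](_ : _ = false) ?mulr0 //; apply: contraNF neq => /eqP e.
    by apply/eqP/val_inj.
  rewrite v_ge // mxE big1 // => l' _; rewrite P1E ltn_eqF ?mulr0 //.
  exact: leq_trans (ltn_ord l') le_l.
have ltNn : (N < n)%N := leq_trans ltNd td_le_tn.
pose wt (r : 'I_N) : Zn := j + r%:R.
have inj_wt : injective wt.
  move=> r s /addrI/natZn_inj E; apply/val_inj/E.
    exact: ltn_trans (ltn_ord r) ltNn.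
  exact: ltn_trans (ltn_ord s) ltNn.
pose V : 'M[k]_(ddim L, N) := \matrix_(i, r) v r i 0.
have [B BV] := weights_indep (v := fun r : 'I_N => v r) inj_wt
  (fun r => ev r) (fun r => vN0 r (ltn_ord r)).
have VB : V *m B = 1%:M := mulmx1C_eq dimL BV.
have dec (m : 'cV[k]_(ddim L)) : m = \sum_r (B *m m) r 0 *: v r.
  rewrite -{1}[m]mul1mx -VB -mulmxA; apply/colP => i; rewrite !mxE summxE.
  by apply: eq_bigr => r _; rewrite !mxE mulrC.
split=> // [r m lt_r|i out|r lt_r].
- exists ((B *m m) (Ordinal lt_r) 0); rewrite {1}(dec m) mulmx_sumr.
  rewrite (bigD1 (Ordinal lt_r)) //= mxmZ ev big1 ?addr0 // => l neq.
  rewrite mxmZ -ev eeM ifN ?scaler0 //; apply: contra neq => /eqP E.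
  by apply/eqP/inj_wt.
- apply/row_matrixP => i1; rewrite row0; apply/rowP => i2; rewrite [RHS]mxE.
  have E : de L i *m (delta_mx i2 0 : 'cV[k]_(ddim L)) = 0.
    rewrite (dec (delta_mx i2 0 : 'cV[k]_(ddim L))) mulmx_sumr big1 // => l _.
    by rewrite mxmZ -ev eeM ifN ?scaler0 // out.
  by have := congr1 (fun x : 'cV_(ddim L) => x i1 0) E; rewrite -colE !mxE.
(* If X killed a^(r+1) w, this vector would lie on the line spanned by w, which has another
   weight. *)
- have := Gv 0%N; rewrite /v expr0 mul1mx => Gw.
  have [b bE] := XA_vec r Xw ew Gw; exists b => //.
  apply: contraNneq (vN0 _ lt_r) => b0; rewrite b0 scale0r in bE.
  have [c cE] := kerX _ bE; rewrite -/(v r.+1) in cE *.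
  have := ev r.+1; rewrite cE mxmZ -{1}ew eeM ifN ?scaler0 => [<- //|].
  rewrite -[X in _ != X]addr0 (inj_eq (addrI j)).
  apply/eqP => /(@natZn_inj r.+1 0%N (ltn_trans lt_r ltNn)).
  by move/(_ (ltn_trans (ltn0Sn _) (ltn_trans lt_r ltNn))).
Qed.
End Ladders.

Lemma mx_inverse_dim (k : fieldType) m p (A : 'M[k]_(m, p)) (B : 'M[k]_(p, m)) :
  A *m B = 1%:M -> B *m A = 1%:M -> m = p.
Proof.
move=> AB BA; apply/eqP; rewrite eqn_leq.
have := mulmx_max_rank A B; rewrite AB mxrank1 => ->.
by have := mulmx_max_rank B A; rewrite BA mxrank1 => ->.
Qed.

(** Z is tridiagonal in the basis m with nonzero coefficients towards the next vector. So m_0 is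
    cyclic, and the coordinate of the last basis vector vanishes on Z^j m_0 for j < N - 1, as
    [zfree_cyclic] requires. For r = 0 the term in [m r.-1] is one more multiple of m_0. *)
Lemma zfree_hessenberg (k : fieldType) N p (Z : 'M[k]_p) (m : nat -> 'cV[k]_p) B c :
  p = N -> (0 < N)%N -> Z ^+ N = 0 -> B *m (\matrix_(i < p, r < N) m r i 0) = 1%:M ->
  (forall r, (r.+1 < N)%N -> c r != 0 /\ exists a b,
    Z *m m r = c r *: m r.+1 + b *: m r + a *: m r.-1) ->
  zfree N Z.
Proof.
move=> eN; subst p; case: N Z m B => // N Z m B _ ZN BV Zm.
pose g := row ord_max B.
have gm (r : 'I_N.+1) : g *m m r = (r == N :> nat)%:R%:M.
  have -> : g *m m r = ((B *m \matrix_(i < N.+1, r < N.+1) m r i 0) ord_max r)%:M.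
    apply/matrixP => i j; rewrite !ord1 !mxE; apply: eq_bigr => l _.
    by rewrite !mxE.
  by rewrite BV mxE -val_eqE /= eq_sym.
pose C r t := \prod_(r <= i < r + t) c i.
have gZ t r : (r + t <= N)%N ->
    g *m (Z ^+ t *m m r) = (if (r + t == N)%N then C r t else 0)%:M.
  elim: t r => [|t IH] r le_N.
    rewrite addn0 in le_N *; rewrite expr0 mul1mx (gm (Ordinal (le_N : r < N.+1)%N)).
    by rewrite /C addn0 big_geq //=; case: eqP.
  have lt_r : (r.+1 < N.+1)%N by lia.
  have [_ [a [b E]]] := Zm r lt_r.
  rewrite expmxSr -mulmxA E !mulmxDr !mxmZ !IH; try lia.
  rewrite (_ : (r + t == N)%N = false); last by lia.
  rewrite (_ : (r.-1 + t == N)%N = false); last by lia.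
  rewrite addSnnS raddf0 !scaler0 !addr0; case: eqP => _; last first.
    by rewrite raddf0 scaler0.
  rewrite scale_scalar_mx; congr _%:M.
  by rewrite /C addSnnS [RHS]big_ltn //; lia.
apply: (zfree_cyclic (f := m 0%N) (g := g) (c := C 0%N N) ZN) => [|j lt_j].
  rewrite prodf_seq_neq0; apply/allP => i; rewrite mem_index_iota /= => lt_i.
  by have [] := Zm i; rewrite ?ltnS //; lia.
by rewrite -mulmxA gZ // add0n /=; case: eqP => // ->.
Qed.

(** * Freeness over k[z]/z^d of chains of d weight vectors *)

Section LengthTwo.
Variables (k : closedFieldType) (T : taft_data k).
Local Notation d := (td T).
Local Notation q := (tq T).
Local Notation c0 := (c0 T).
Local Notation Zn := ('Z_(tn T)).
Local Notation dmod := (dmod T).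
Implicit Types M L P Y : dmod.

Let q0 : q != 0 := tq_neq0 T.
Let d_gt0 : (0 < d)%N := ltnW (td_ge2 T).

Lemma GA_vec M (v : 'cV[k]_(ddim M)) g r : dG M *m v = g *: v ->
  dG M *m (sumA M ^+ r *m v) = (q ^+ r * g) *: (sumA M ^+ r *m v).
Proof.
move=> Gv; elim: r => [|p IH]; first by rewrite expr0 mul1mx mul1r.
have GA : dG M *m sumA M = q *: (sumA M *m dG M).
  by rewrite !mulmxE dAG scalerA mulfV ?scale1r.
rewrite {1}expmxS -mulmxA mulmxA GA mxZm -mulmxA IH mxmZ scalerA mulmxA.
by rewrite -expmxS mulrA -exprS.
Qed.

Lemma GX_vec M (v : 'cV[k]_(ddim M)) g r : dG M *m v = g *: v ->
  dG M *m (dX M ^+ r *m v) = (q^-1 ^+ r * g) *: (dX M ^+ r *m v).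
Proof.
move=> Gv; elim: r => [|p IH]; first by rewrite expr0 mul1mx mul1r.
have GX : dG M *m dX M = q^-1 *: (dX M *m dG M) by rewrite !mulmxE dGX.
rewrite {1}expmxS -mulmxA mulmxA GX mxZm -mulmxA IH mxmZ scalerA mulmxA.
by rewrite -expmxS mulrA -exprS.
Qed.

Lemma zop_vec M s (v : 'cV[k]_(ddim M)) i : de M i *m v = v ->
  zop M s *m v = dX M *m (sumA M *m v) + s *: (dG M *m (sumA M *m v)) +
    (c0 / s * qpow i) *: (dX M *m v + s *: (dG M *m v)) - c0 *: v.
Proof.
move=> ev; rewrite /zop mulmxBl mxZm mul1mx -mulmxE -mulmxA.
rewrite /opy (mulmxDl (sumA M)) mxZm (Kvec ev) scalerA mulmxDr mxmZ.
by rewrite /opx !(mulmxDl (dX M)) !mxZm.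
Qed.

(** In the basis a^r v the only part of z that raises r is s G a. *)
Lemma zfree_chain_up M (v : 'cV[k]_(ddim M)) g i s : ddim M = d -> tame M ->
  s != 0 -> g != 0 -> de M i *m v = v -> dX M *m v = 0 -> dG M *m v = g *: v ->
  sumA M ^+ d.-1 *m v != 0 -> zfree d (zop M s).
Proof.
move=> dimM tM s0 g0 ev Xv Gv top; pose m r := sumA M ^+ r *m v.
have m0 r : (r < d)%N -> m r != 0.
  move=> lt_r; apply: contraNneq top => mr0.
  rewrite -[d.-1](subnK (_ : r <= d.-1)%N); last by lia.
  by rewrite exprD -mulmxE -mulmxA -/(m r) mr0 mulmx0.
pose wt (r : 'I_d) : Zn := i + r%:R.
have inj_wt : injective wt.
  move=> a b /addrI/natZn_inj E; have le_n := td_le_tn T.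
  apply/val_inj/E; exact: leq_trans (ltn_ord _) le_n.
have [B BV] := weights_indep (v := fun r : 'I_d => m r) inj_wt
  (fun r => eA_vec r ev) (fun r => m0 r (ltn_ord r)).
apply: (zfree_hessenberg (c := fun r => s * (q ^+ r.+1 * g)) dimM d_gt0 _ BV).
  exact: tame_zop.
move=> r lt_r; split; first by rewrite !mulf_neq0 ?expf_neq0.
have [b1 X1] := XA_vec r Xv ev Gv.
have [b2 X2] : exists b2, dX M *m m r = b2 *: m r.-1.
  case: (r) => [|r1]; first by exists 0; rewrite /m expr0 mul1mx Xv scale0r.
  exact: XA_vec Xv ev Gv.
have Ar : sumA M *m m r = m r.+1 by rewrite /m expmxS mulmxA.
pose e := c0 / s * qpow (i + r%:R).
exists (e * b2), (b1 + e * s * (q ^+ r * g) - c0).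
rewrite (zop_vec s (eA_vec r ev)) -/(m r) Ar X2 -/(m r.+1) X1 -/(m r).
rewrite (GA_vec r.+1 Gv) (GA_vec r Gv) -/(m r) -/(m r.+1) -/e.
by apply/colP => l; rewrite !mxE; ring.
Qed.

(** In the basis X^r v the only part of z that raises r is (c0 / s) X K. *)
Lemma zfree_chain_dn M (v : 'cV[k]_(ddim M)) g i s : ddim M = d -> tame M ->
  s != 0 -> de M i *m v = v -> sumA M *m v = 0 -> dG M *m v = g *: v ->
  dX M ^+ d.-1 *m v != 0 -> zfree d (zop M s).
Proof.
move=> dimM tM s0 ev Av Gv top; pose m r := dX M ^+ r *m v.
have m0 r : (r < d)%N -> m r != 0.
  move=> lt_r; apply: contraNneq top => mr0.
  rewrite -[d.-1](subnK (_ : r <= d.-1)%N); last by lia.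
  by rewrite exprD -mulmxE -mulmxA -/(m r) mr0 mulmx0.
pose wt (r : 'I_d) : Zn := i - r%:R.
have inj_wt : injective wt.
  move=> a b /addrI/oppr_inj/natZn_inj E; have le_n := td_le_tn T.
  apply/val_inj/E; exact: leq_trans (ltn_ord _) le_n.
have [B BV] := weights_indep (v := fun r : 'I_d => m r) inj_wt
  (fun r => eX_vec r ev) (fun r => m0 r (ltn_ord r)).
apply: (zfree_hessenberg (c := fun r => c0 / s * qpow (i - r%:R)) dimM d_gt0 _ BV).
  exact: tame_zop.
move=> r lt_r; split.
  by rewrite !mulf_neq0 ?qpow_neq0 ?(c0_neq0 T) // invr_neq0.
have [b AE] : exists b, forall r', r = r'.+1 -> sumA M *m m r = b *: m r'.
  case: (r) => [|r1]; first by exists 0.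
  by have [b E] := AX_vec r1 Av ev Gv; exists b => r' [<-].
have Xr p : dX M *m m p = m p.+1 by rewrite /m expmxS mulmxA.
pose e := c0 / s * qpow (i - r%:R).
case: r lt_r AE @e => [|r] lt_r AE e.
  exists 0, (e * s * g - c0).
  rewrite (zop_vec s (eX_vec 0 ev)) -/(m 0%N) Xr -/e.
  have -> : sumA M *m m 0%N = 0 by rewrite /m expr0 mul1mx Av.
  rewrite (GX_vec 0 Gv) -/(m 0%N) !mulmx0 expr0 mul1r.
  by move: (m 0%N) (m 1%N) => m_0 m_1; apply/colP => l; rewrite !mxE; ring.
exists (s * b * (q^-1 ^+ r * g)), (b + e * s * (q^-1 ^+ r.+1 * g) - c0).
rewrite (zop_vec s (eX_vec r.+1 ev)) -/(m r.+1) (AE r) // mxmZ Xr -/e mxmZ Xr.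
rewrite (GX_vec r.+1 Gv) (GX_vec r Gv) -/(m r) -/(m r.+1) /=.
by move: (m r) (m r.+1) (m r.+2) => u1 u2 u3; apply/colP => l; rewrite !mxE; ring.
Qed.
End LengthTwo.

Section LengthTwoModules.
Variables (k : closedFieldType) (T : taft_data k).
Local Notation n := (tn T).
Local Notation d := (td T).
Local Notation Zn := ('Z_(tn T)).
Local Notation dmod := (dmod T).
Implicit Types M L P Y : dmod.


Lemma gammaE M j N : (0 < N)%N ->
  gamma (da M) j N * de M j = sumA M ^+ N *m de M j.
Proof.
case: N => // N _.
rewrite (eq_gamma (@da_eq _ _ M)) (tot_gamma (@de_orth _ _ M) (@deA _ _ M)).
by rewrite -mulrA de_orth eqxx.
Qed.

Lemma Zn_neq (j : Zn) r s : (r < n)%N -> (s < n)%N -> r != s ->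
  j + r%:R != j + s%:R.
Proof.
move=> lr ls; apply: contra_neq => /addrI; exact: natZn_inj.
Qed.

Section Ladder.
Variables (L : dmod) (j : Zn) (N : nat) (w : 'cV[k]_(ddim L)).
Hypothesis lad : ladder j N w.

Lemma ladder_XA r : (r < N)%N ->
  exists2 c, c != 0 & dX L ^+ r *m (sumA L ^+ r *m w) = c *: w.
Proof.
elim: r => [|r IH] lt_r.
  by exists 1; rewrite ?oner_eq0 // !expr0 !mul1mx scale1r.
have [c c_0 cE] := lad_X lad lt_r; have [b b0 bE] := IH (ltnW lt_r).
exists (c * b); first exact: mulf_neq0.
by rewrite expmxSr -mulmxA cE mxmZ bE scalerA.
Qed.
End Ladder.

Section Extension.
Variables (L2 M L1 : dmod) (i : 'M[k]_(ddim M, ddim L2)).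
Variables (p : 'M[k]_(ddim L1, ddim M)) (w1 : 'cV[k]_(ddim L1)).
Variables (w2 : 'cV[k]_(ddim L2)) (j j2 : Zn) (N N2 : nat) (g : k).
Hypothesis ex : dexact i p.
Hypothesis lad1 : ladder j N w1.
Hypothesis lad2 : ladder j2 N2 w2.
Hypothesis NN2 : (N + N2)%N = d.
Hypotheses (N_gt0 : (0 < N)%N) (N2_gt0 : (0 < N2)%N).

Let le_dn := td_le_tn T.

Lemma ext_dim : ddim M = d.
Proof.
have [hi hp [i' [p' [i'i pp' ii']]]] := ex.
have p_i : p *m i = 0.
  have := congr1 (fun x => p *m x *m i) ii'.
  rewrite mulmxDr mulmxDl mulmx1 -!mulmxA i'i mulmx1.
  by rewrite [p *m (p' *m _)]mulmxA pp' mul1mx -[RHS]add0r => /addIr.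
have ip' : i' *m p' = 0.
  have := congr1 (fun x => i' *m x *m p') ii'.
  rewrite mulmxDr mulmxDl mulmx1 -!mulmxA pp' mulmx1.
  by rewrite [i' *m (i *m _)]mulmxA i'i mul1mx -[RHS]addr0 => /addrI.
have := mx_inverse_dim (A := row_mx i p') (B := col_mx i' p).
rewrite mul_row_col ii' mul_col_row i'i pp' p_i ip' -scalar_mx_block.
by move=> -> //; rewrite (lad_dim lad1) (lad_dim lad2) addnC.
Qed.

Lemma ext_lift (v : 'cV[k]_(ddim L1)) t : de L1 t *m v = v ->
  exists2 m, de M t *m m = m & p *m m = v.
Proof.
move=> tv; have [hi hp [i' [p' [i'i pp' ii']]]] := ex.
exists (de M t *m (p' *m v)); first by rewrite eeM eqxx.
by rewrite mulmxA (dhom_e hp) -mulmxA (mulmxA p) pp' mul1mx.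
Qed.

Lemma ext_sub (a : 'cV[k]_(ddim M)) t : p *m a = 0 -> de M t *m a = a ->
  exists b, a = i *m (de L2 t *m b).
Proof.
move=> pa ta; have [hi hp [i' [p' [i'i pp' ii']]]] := ex.
exists (i' *m a); rewrite mulmxA (dhom_e hi) -mulmxA -{1}ta; congr (_ *m _).
by rewrite -{1}[a]mul1mx -ii' mulmxDl -(mulmxA p') pa mulmx0 addr0 mulmxA.
Qed.

Lemma ext_i0 (a : 'cV[k]_(ddim L2)) : i *m a = 0 -> a = 0.
Proof.
have [hi hp [i' [p' [i'i pp' ii']]]] := ex.
by move=> /(congr1 (mulmx i')); rewrite mulmxA i'i mul1mx mulmx0.
Qed.

Lemma ext_kill t (a : 'cV[k]_(ddim M)) :
  (forall r, (r < N2)%N -> t != j2 + r%:R) ->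
  p *m a = 0 -> de M t *m a = a -> a = 0.
Proof.
move=> out pa ta; have [b ->] := ext_sub pa ta.
by rewrite (lad_out lad2) // mul0mx mulmx0.
Qed.

(** As j + r is not a weight of L2, the weight space of M is the line through m0, which thus detects
    whether B vanishes there. *)
Lemma ext_line r m0 (B : 'M[k]_(ddim M)) : (r < N)%N ->
  (forall r', (r' < N2)%N -> j + r%:R != j2 + r'%:R) ->
  de M (j + r%:R) *m m0 = m0 -> p *m m0 = sumA L1 ^+ r *m w1 ->
  B *m de M (j + r%:R) != 0 -> B *m m0 != 0.
Proof.
move=> lt_r out em pm; have [hi hp _] := ex.
apply: contraNneq => B0; apply/eqP/trmx_inj.
apply/row_matrixP => l; rewrite -tr_col colE -mulmxA.
set a := delta_mx l 0.
have [b bE] := lad_span lad1 (p *m (de M (j + r%:R) *m a)) lt_r.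
rewrite (mulmxA (de L1 _)) -(dhom_e hp) -mulmxA eeM eqxx in bE.
suff -> : de M (j + r%:R) *m a = b *: m0.
  by rewrite mxmZ B0 scaler0; apply/rowP => l'; rewrite !mxE.
apply/eqP; rewrite -subr_eq0; apply/eqP/(ext_kill out).
  by rewrite mulmxBr bE mxmZ pm subrr.
by rewrite mulmxBr mxmZ em eeM eqxx.
Qed.

Hypothesis Gw1 : forall t, dG L1 *m de L1 t = (g * qpow t) *: de L1 t.
Hypothesis g0 : g != 0.

(** Let m0 lift w1. It is proportional to X^(N-1) a^(N-1) m0, and X^N kills the weight j + N - 1, so
    X m0 = 0. The nonzero vector a^N m0 is a multiple of the image of w2, from which a climbs N2 - 1
    further steps: [zfree_chain_up] applies. *)
Lemma zfree_len2_up s : j2 = j + N%:R -> tame M -> s != 0 ->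
  gamma (da M) j N * de M j != 0 -> dX M ^+ N * de M (j + N%:R - 1) = 0 ->
  zfree d (zop M s).
Proof.
move=> j2E tM s0 AN XN; have [hi hp _] := ex.
have out r : (r < N2)%N -> j != j2 + r%:R.
  move=> lt_r; rewrite j2E -addrA -natrD -[X in X != _]addr0.
  by apply: (@Zn_neq j 0 (N + r)); lia.
have kill (a : 'cV[k]_(ddim M)) : p *m a = 0 -> de M j *m a = a -> a = 0.
  exact: ext_kill out.
have [m0 em pm] := ext_lift (lad_e lad1).
have Gm : dG M *m m0 = (g * qpow j) *: m0.
  apply/eqP; rewrite -subr_eq0; apply/eqP/kill.
    rewrite mulmxBr mulmxA (dhom_G hp) -mulmxA pm mxmZ pm -{1}(lad_e lad1).
    by rewrite mulmxA Gw1 mxZm (lad_e lad1) subrr.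
  by rewrite mulmxBr mxmZ em -Ge_mx em.
have [c cn0 cE] := ladder_XA lad1 (r := N.-1) ltac:(lia).
have eAm r := eA_vec r em.
have XAm : dX M ^+ N.-1 *m (sumA M ^+ N.-1 *m m0) = c *: m0.
  apply/eqP; rewrite -subr_eq0; apply/eqP/kill.
    rewrite mulmxBr (mulmxA p) -(expmx_intertwine _ (esym (dhom_X hp))) -mulmxA.
    rewrite (mulmxA p) -(expmx_intertwine _ (esym (dhom_A hp))) -mulmxA.
    by rewrite mxmZ pm cE subrr.
  rewrite mulmxBr mxmZ em; congr (_ - _).
  by rewrite -{1}[j](addrK N.-1%:R) eX_vec.
have Xm : dX M *m m0 = 0.
  apply: (scalerI cn0); rewrite scaler0 -mxmZ -XAm (mulmxA (dX M)) -expmxS prednK //.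
  rewrite -eAm (mulmxA (dX M ^+ N)).
  have -> : j + N.-1%:R = j + N%:R - 1.
    by rewrite -{2}(prednK N_gt0) -natr1 addrA addrK.
  by rewrite mulmxE XN mul0mx.
have ANm : sumA M ^+ N *m m0 != 0.
  apply: (@ext_line 0); rewrite ?mulr0n ?addr0 ?expr0 ?mul1mx -?gammaE //.
have pA : p *m (sumA M ^+ N *m m0) = 0.
  rewrite mulmxA -(expmx_intertwine _ (esym (dhom_A hp))) -mulmxA pm.
  rewrite -(eA_vec N (lad_e lad1)) (lad_out lad1) ?mul0mx // => r lt_r.
  by apply: Zn_neq; lia.
have [b AE] := ext_sub pA (eAm N).
have [c2 cE2] := lad_span lad2 b N2_gt0.
rewrite mulr0n addr0 expr0 mul1mx j2E in cE2; rewrite cE2 mxmZ in AE.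
have c20 : c2 != 0.
  by apply: contraNneq ANm => c20; rewrite AE c20 scale0r.
apply: (zfree_chain_up ext_dim tM s0 _ em Xm Gm).
  by rewrite mulf_neq0 ?qpow_neq0.
have -> : d.-1 = (N2.-1 + N)%N by lia.
rewrite exprD -mulmxE -mulmxA AE mxmZ scaler_eq0 negb_or c20 mulmxA.
rewrite (expmx_intertwine _ (esym (dhom_A hi))) -mulmxA.
have nz := lad_neq0 lad2 (r := N2.-1) ltac:(lia).
by apply: contraNneq nz => /ext_i0 ->.
Qed.

(** The mirror image: the chain starts at the highest weight j + N - 1 of L1 and descends by X,
    first through L1 and then through L2. *)
Lemma zfree_len2_dn s : j = j2 + N2%:R -> tame M -> s != 0 ->
  gamma (da M) j N * de M j = 0 -> dX M ^+ N * de M (j + N%:R - 1) != 0 ->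
  zfree d (zop M s).
Proof.
move=> jE tM s0 AN XN; have [hi hp _] := ex; pose t := j + N.-1%:R.
have tE : j + N%:R - 1 = t.
  by rewrite /t -{1}(prednK N_gt0) -natr1 addrA addrK.
have out r : (r < N2)%N -> t != j2 + r%:R.
  by move=> lt_r; rewrite /t jE -addrA -natrD; apply: Zn_neq; lia.
have kill (a : 'cV[k]_(ddim M)) : p *m a = 0 -> de M t *m a = a -> a = 0.
  exact: ext_kill out.
pose w := sumA L1 ^+ N.-1 *m w1.
have ew : de L1 t *m w = w := eA_vec N.-1 (lad_e lad1).
have [m0 em pm] := ext_lift ew.
have Gm : dG M *m m0 = (g * qpow t) *: m0.
  apply/eqP; rewrite -subr_eq0; apply/eqP/kill.
    rewrite mulmxBr mulmxA (dhom_G hp) -mulmxA pm mxmZ pm -{1}ew.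
    by rewrite mulmxA Gw1 mxZm ew subrr.
  by rewrite mulmxBr mxmZ em -Ge_mx em.
have [c cn0 cE] := ladder_XA lad1 (r := N.-1) ltac:(lia).
have eXm r := eX_vec r em.
have tj : t - N.-1%:R = j by rewrite addrK.
have AXm : sumA M ^+ N.-1 *m (dX M ^+ N.-1 *m m0) = c *: m0.
  apply/eqP; rewrite -subr_eq0; apply/eqP/kill.
    rewrite mulmxBr (mulmxA p) -(expmx_intertwine _ (esym (dhom_A hp))) -mulmxA.
    rewrite (mulmxA p) -(expmx_intertwine _ (esym (dhom_X hp))) -mulmxA.
    by rewrite mxmZ pm cE mxmZ subrr.
  rewrite mulmxBr mxmZ em; congr (_ - _).
  by rewrite /t; apply: eA_vec; rewrite -{1}tj eXm.
have Am : sumA M *m m0 = 0.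
  apply: (scalerI cn0); rewrite scaler0 -mxmZ -AXm (mulmxA (sumA M)) -expmxS prednK //.
  by rewrite -eXm tj (mulmxA (sumA M ^+ N)) -gammaE // AN mul0mx.
have XNm : dX M ^+ N *m m0 != 0.
  apply: (@ext_line N.-1) => //; first by lia.
  by rewrite mulmxE -/t -tE.
have tN : t - N%:R = j2 + N2.-1%:R.
  rewrite /t -{2}(prednK N_gt0) -natr1 opprD addrA addrK jE -(prednK N2_gt0).
  by rewrite -natr1 addrA addrK.
have pX : p *m (dX M ^+ N *m m0) = 0.
  rewrite mulmxA -(expmx_intertwine _ (esym (dhom_X hp))) -mulmxA pm.
  rewrite -(eX_vec N ew) (lad_out lad1) ?mul0mx // => r lt_r.
  rewrite tN jE -addrA -natrD; apply: Zn_neq; lia.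
have [b XE] := ext_sub pX (eXm N).
have lt_N2 : (N2.-1 < N2)%N by lia.
have [c2 cE2] := lad_span lad2 b lt_N2.
rewrite tN cE2 mxmZ in XE.
have c20 : c2 != 0.
  by apply: contraNneq XNm => c20; rewrite XE c20 scale0r.
apply: (zfree_chain_dn ext_dim tM s0 em Am Gm).
have -> : d.-1 = (N2.-1 + N)%N by lia.
rewrite exprD -mulmxE -mulmxA XE mxmZ scaler_eq0 negb_or c20 mulmxA.
rewrite (expmx_intertwine _ (esym (dhom_X hi))) -mulmxA.
have [c3 c30 ->] := ladder_XA lad2 lt_N2.
rewrite mxmZ scaler_eq0 negb_or c30.
have nz := lad_neq0 lad2 N2_gt0; rewrite expr0 mul1mx in nz.
by apply: contraNneq nz => /ext_i0 ->.
Qed.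
End Extension.
End LengthTwoModules.

(** * Band modules of the principal block *)

Section ExplicitBand.
Variables (k : closedFieldType) (T : taft_data k).
Local Notation n := (tn T).
Local Notation d := (td T).
Local Notation q := (tq T).
Local Notation c0 := (c0 T).
Local Notation Zn := ('Z_(tn T)).
Local Notation dmod := (dmod T).

Let q0 : q != 0 := tq_neq0 T.
Let prq : d.-primitive_root q := tq_prim T.
Let q1 : 1 - q != 0 := prim_1B (td_ge2 T) prq.
Let n_gt0 : (0 < n)%N := ltnW (tn_gt1 T).

Lemma Zn_nat (P : Zn -> Prop) : (forall r, (r < n)%N -> P r%:R) -> forall i, P i.
Proof.
move=> Pr i; rewrite -[i]natr_Zp; apply: Pr.
by have := ltn_ord i; rewrite [X in (_ < X)%N](Zp_cast (tn_gt1 T)).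
Qed.

Lemma qpow_eq1 (i : Zn) : (qpow i == 1) = (d %| i)%N.
Proof. by rewrite /qpow -(prim_order_dvd prq). Qed.

Lemma opp1_nat : (- 1 : Zn) = n.-1%:R.
Proof.
apply: (addIr 1); rewrite addNr natr1 prednK //.
by apply: val_inj; rewrite /= val_Zp_nat ?tn_gt1 // modnn.
Qed.

Variables (M : dmod) (v : Zn -> 'cV[k]_(ddim M)).
Hypothesis v0 : forall i, v i != 0.
Hypothesis ev : forall i, de M i *m v i = v i.
Hypothesis v_span : forall i (a : 'cV[k]_(ddim M)), exists c, de M i *m a = c *: v i.
Hypothesis Gv : forall i, dG M *m v i = qpow i *: v i.
Hypothesis top_A : forall i : Zn, (d %| i)%N -> sumA M *m v i != 0.
Hypothesis top_X : forall i : Zn, (d %| i)%N -> dX M *m v i != 0.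
Hypothesis soc_X : forall i : Zn, (d %| i)%N -> dX M *m v (i + 1) = 0.

(** Let al_i and be_i be the coefficients of a from v_i to v_(i+1) and of X back. A generator \sum_i
    ka_i v_i on which x = s and y = c0 / s must satisfy be_i ka_(i+1) = s (1 - q^i) ka_i and al_i
    ka_i = (c0 / s) (1 - q^(i+1)) ka_(i+1). The two are compatible by the value of al_i be_i found
    in [gamE]. *)
Lemma explicit_band : exists2 s, s != 0 &
  exists (w : 'cV[k]_(ddim M)) (rho : Zn -> 'rV[k]_(ddim M)),
    induced s w rho s%:M (c0 / s)%:M 1%:M.
Proof.
have /fin_all_exists[al alE] i : exists c, sumA M *m v i = c *: v (i + 1).
  have [c cE] := v_span (i + 1) (sumA M *m v i).
  by exists c; rewrite -cE mulmxA e_shift addrK -mulmxA ev.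
have /fin_all_exists[be beE] i : exists c, dX M *m v (i + 1) = c *: v i.
  have [c cE] := v_span i (dX M *m v (i + 1)).
  by exists c; rewrite -cE mulmxA e_shiftX -mulmxA ev.
have scale_inj i a b : a *: v i = b *: v i -> a = b.
  move=> /eqP; rewrite -subr_eq0 -scalerBl scaler_eq0 (negPf (v0 i)) orbF.
  by rewrite subr_eq0 => /eqP.
have Kv i : sumK M *m v i = qpow i *: v i by rewrite (Kvec (ev i)).
have rec i : al (i + 1) * be (i + 1) =
    q * (al i * be i) + 1 - qpow (i + 1) * qpow (i + 1).
  apply: (@scale_inj (i + 1)).
  have XA : dX M *m sumA M = q *: (sumA M *m dX M) + 1%:M - dG M *m sumK M.
    rewrite !mulmxE dAX scalerA mulfV // scale1r.
    by rewrite addrAC addrK subrK.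
  have := congr1 (mulmx^~ (v (i + 1))) XA; rewrite /= mulmxBl mulmxDl mxZm.
  rewrite -!mulmxA mul1mx alE mxmZ beE scalerA => ->.
  rewrite beE mxmZ alE Kv mxmZ Gv !scalerA scalerBl scalerDl scale1r.
  by rewrite [al i * _]mulrC mulrA.
have gamE i : al i * be i = c0 * (1 - qpow i) * (1 - qpow (i + 1)).
  elim/Zn_nat: i => r _; elim: r => [|r IH].
    rewrite mulr0n qpow0 subrr mulr0 mul0r.
    have := beE 0; rewrite soc_X ?dvdn0 // => /esym/eqP.
    by rewrite scaler_eq0 (negPf (v0 0)) orbF => /eqP->; rewrite mulr0.
  rewrite -natr1 rec IH !qpowD qpow1 /c0; field.
  by [].
have be_dvd (i : Zn) : (d %| i)%N -> be i = 0.
  move=> di; have := beE i; rewrite soc_X // => /esym/eqP.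
  by rewrite scaler_eq0 (negPf (v0 i)) orbF => /eqP.
have al_dvd (i : Zn) : (d %| i)%N -> al i != 0.
  move=> di; have := top_A di; rewrite alE; apply: contraNneq => ->.
  by rewrite scale0r.
have be_ndvd (i : Zn) : ~~ (d %| i)%N -> be i != 0.
  move=> ndi; have [di1|ndi1] := boolP (d %| nat_of_ord (i + 1)%R)%N.
    have := top_X di1; rewrite beE; apply: contraNneq => ->.
    by rewrite scale0r.
  have : al i * be i != 0.
    rewrite gamE !mulf_neq0 ?c0_neq0 //.
      by rewrite subr_eq0 eq_sym qpow_eq1.
    by rewrite subr_eq0 eq_sym qpow_eq1.
  by apply: contraNneq => ->; rewrite mulr0.
(* [s * tau i] is the ratio of ka_(i+1) to ka_i. If d divides i, then be_i = 0 and the equation for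
   x is void; the one for y gives al_i, as c0 (1 - q) = 1. *)
pose tau (i : Zn) := if (d %| i)%N then al i else (1 - qpow i) / be i.
have tau0 (i : Zn) : tau i != 0.
  rewrite /tau; case: ifPn => [/al_dvd//|ndi].
  by rewrite mulf_neq0 ?invr_neq0 ?be_ndvd // subr_eq0 eq_sym qpow_eq1.
have tau_be (i : Zn) : tau i * be i = 1 - qpow i.
  rewrite /tau; case: ifPn => [di|ndi]; last by rewrite mulfVK // be_ndvd.
  by rewrite be_dvd // mulr0; move: di; rewrite -qpow_eq1 => /eqP->; rewrite subrr.
have tau_al (i : Zn) : al i = c0 * (1 - qpow (i + 1)) * tau i.
  rewrite /tau; case: ifPn => [di|ndi].
    rewrite qpowD qpow1; move: di; rewrite -qpow_eq1 => /eqP->.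
    by rewrite mul1r c0E mul1r.
  apply: (mulIf (be_ndvd _ ndi)); rewrite gamE mulrA mulfVK ?be_ndvd //.
  by rewrite mulrAC.
pose Pi r := \prod_(l < r) tau (l%:R).
have Pi0 r : Pi r != 0 by rewrite /Pi prodf_seq_neq0; apply/allP => l _; exact: tau0.
(* The coefficients ka_i must close up after going around Z_n, which fixes s^n. *)
have [s sE] : exists s, s ^+ n = (Pi n)^-1.
  have /closed_rootP[s] : size ('X^n - ((Pi n)^-1)%:P : {poly k}) != 1%N.
    by rewrite size_XnsubC // eqSS -lt0n.
  by rewrite /root !hornerE subr_eq0 => /eqP sE; exists s.
have s0 : s != 0.
  apply: contra_eq_neq sE => ->; rewrite expr0n gtn_eqF // eq_sym.
  by rewrite invr_neq0.
pose ka (i : Zn) := s ^+ i * Pi i.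
have ka0 i : ka i != 0 by rewrite mulf_neq0 ?expf_neq0.
have kaS i : ka (i + 1) = s * tau i * ka i.
  elim/Zn_nat: i => r lt_r.
  have E : s ^+ r.+1 * Pi r.+1 = s * tau r%:R * (s ^+ r * Pi r).
    by rewrite /Pi big_ord_recr exprS /=; ring.
  rewrite natr1 /ka (val_Zn lt_r) -E.
  have [lt_r1|] := ltnP r.+1 n; first by rewrite val_Zn.
  move=> le_n; have en : r.+1 = n by apply/eqP; rewrite eqn_leq lt_r.
  rewrite en sE mulVf // val_Zp_nat ?tn_gt1 // modnn expr0 /Pi big_ord0.
  by rewrite mulr1.
pose w := \sum_i ka i *: v i.
have ew i : de M i *m w = ka i *: v i.
  rewrite mulmx_sumr (bigD1 i) //= mxmZ ev big1 ?addr0 // => l neq.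
  by rewrite mxmZ -ev eeM eq_sym (negPf neq) scaler0.
have /fin_all_exists[f fE] i : exists g : 'rV[k]_(ddim M), g *m v i = 1%:M.
  have [l vl] : exists l, v i l 0 != 0.
    apply/existsP; apply: contraR (v0 i); rewrite negb_exists => /forallP v_0.
    apply/eqP/colP => l; rewrite [RHS]mxE; apply/eqP.
    by move: (v_0 l); rewrite negbK.
  exists ((v i l 0)^-1 *: delta_mx 0 l); rewrite mxZm -rowE.
  by apply/matrixP => a b; rewrite !ord1 !mxE mulVf.
exists s => //; exists w, (fun i => (ka i)^-1 *: (f i *m de M i)).
split; last 2 first.
- move=> i j; rewrite !mxZm -!mulmxA ew; case: (eqVneq i j) => [<-|neq].
    by rewrite mxmZ ev mxmZ fE scalerA mulVf // scale1r.
  by rewrite mxmZ -(ev j) eeM (negPf neq) scaler0 mulmx0 scaler0.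
- rewrite -[RHS](de_sum M); apply: eq_bigr => i _.
  rewrite ew mxmZ mxZm scalerA mulVf // scale1r mulmxA.
  apply/matrixP => a b; have [c cE] := v_span i (delta_mx b 0).
  have E : v i *m f i *m de M i *m (delta_mx b 0 : 'cV_(ddim M)) =
      de M i *m delta_mx b 0.
    by rewrite -!mulmxA cE !mxmZ fE mulmx1.
  by have := congr1 (fun x : 'cV_(ddim M) => x a 0) E; rewrite -!colE !mxE.
- apply: e_dec => i; rewrite mul_mx_scalar mxmZ ew mulmxDl mxZm mulmxDr mxmZ.
  rewrite mulmxA e_shiftX -mulmxA ew -Ge_mx ew !mxmZ beE Gv !scalerA -scalerDl.
  by congr (_ *: _); rewrite kaS -[s * tau i * _ * _]mulrA [ka i * _]mulrC
    mulrA -[s * tau i * _]mulrA tau_be; ring.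
- apply: e_dec => i; rewrite mul_mx_scalar mxmZ ew mulmxDl mxZm mulmxDr mxmZ.
  rewrite mulmxA e_shift -mulmxA ew mulmxA eK mxZm ew mxmZ alE subrK !scalerA.
  rewrite -scalerDl; congr (_ *: _); rewrite tau_al.
  have := kaS (i - 1); rewrite subrK => ->.
  by move: (c0) => e; field; rewrite s0.
- apply: e_dec => i; rewrite mulmx1 -Ge_mx ew mxmZ Gv mulmxA eK mxZm ew.
  by rewrite !scalerA mulrC.
Qed.
End ExplicitBand.

(** * Orbits of simple modules and quiver homomorphisms *)

Section Orbits.
Variables (k : closedFieldType) (T : taft_data k).
Local Notation n := (tn T).
Local Notation d := (td T).
Local Notation Zn := ('Z_(tn T)).
Local Notation nv := ((2 * tn T) %/ td T)%N.
Local Notation Zv := ('Z_((2 * tn T) %/ td T)).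
Variable u : Zn.

Let d_gt0 : (0 < d)%N := ltnW (td_ge2 T).

Lemma weightD j r : weight u (j + r%:R) = (weight u j + 2 * r)%N %[mod d].
Proof.
have E : (j + r%:R) *+ 2 + u - 1 = (j *+ 2 + u - 1) + (2 * r)%:R.
  by rewrite natrM; ring.
rewrite /weight E; move: (_ - _) => a.
by rewrite -{1}[a]natr_Zp -natrD val_Zp_nat ?tn_gt1 // modn_dvdm ?td_dvd_n.
Qed.

Lemma residue_nonproj j : nonproj u j -> residue T (weight u j) = (weight u j %% d)%N.
Proof. by rewrite /nonproj /residue => /negPf->. Qed.

Lemma Ldim_nonproj j : nonproj u j -> (0 < Ldim u j < d)%N.
Proof.
move=> np; have := np; rewrite /nonproj /dvdn /Ldim residue_nonproj // -lt0n => w0.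
by have := ltn_pmod (weight u j) d_gt0; move: w0; lia.
Qed.

Lemma sigmaE j : nonproj u j -> sigma u j = j + (Ldim u j)%:R.
Proof.
move=> np; have := Ldim_nonproj np; rewrite /sigma /Ldim => lt_d.
by rewrite natrB; [rewrite addrA [j + _]addrC|lia].
Qed.

Lemma weight_sigma j : nonproj u j ->
  (weight u (sigma u j) %% d = d - weight u j %% d)%N.
Proof.
move=> np; rewrite sigmaE // weightD /Ldim residue_nonproj //.
have w0 : (0 < weight u j %% d)%N by move: np; rewrite /nonproj /dvdn -lt0n.
have lt_d := ltn_pmod (weight u j) d_gt0.
rewrite -modnDml (_ : (_ + _ = d + (d - weight u j %% d))%N); last by lia.
by rewrite modnDl modn_small //; lia.
Qed.

Lemma nonproj_sigma j : nonproj u j -> nonproj u (sigma u j).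
Proof.
move=> np; have w0 : (0 < weight u j %% d)%N.
  by move: np; rewrite /nonproj /dvdn -lt0n.
by rewrite /nonproj /dvdn weight_sigma // -lt0n; have := ltn_pmod (weight u j) d_gt0; lia.
Qed.

Lemma Ldim_sigma j : nonproj u j -> (Ldim u j + Ldim u (sigma u j) = d)%N.
Proof.
move=> np; have nps := nonproj_sigma np.
rewrite /Ldim !residue_nonproj // weight_sigma //.
by have := ltn_pmod (weight u j) d_gt0; lia.
Qed.

Lemma sigma2 j : nonproj u j -> sigma u (sigma u j) = j + d%:R.
Proof.
move=> np; rewrite sigmaE ?nonproj_sigma // {1}sigmaE // -addrA -natrD.
by rewrite Ldim_sigma.
Qed.

Section Iterates.
Variable i : Zn.
Hypothesis np : nonproj u i.
Local Notation orb p := (iter p (sigma u) i).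

Lemma orb_nonproj p : nonproj u (orb p).
Proof. by elim: p => //= p; apply: nonproj_sigma. Qed.

Lemma orb_even r : orb (2 * r) = i + (d * r)%:R.
Proof.
elim: r => [|r IH]; first by rewrite !muln0 addr0.
rewrite (_ : 2 * r.+1 = (2 * r).+2)%N /=; last by lia.
by rewrite sigma2 ?orb_nonproj // IH -addrA -natrD mulnSr.
Qed.

Lemma orb_nv : orb nv = i.
Proof.
rewrite nv_eq orb_even mulnC divnK ?td_dvd_n //.
have -> : n%:R = 0 :> Zn by apply: val_inj; rewrite /= val_Zp_nat ?tn_gt1 // modnn.
by rewrite addr0.
Qed.

Lemma orb_mod p : orb (p %% nv) = orb p.
Proof.
rewrite [in RHS](divn_eq p nv) addnC iterD; congr iter.
elim: (p %/ nv)%N => [|r IH]; first by rewrite mul0n.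
by rewrite mulSn iterD -IH orb_nv.
Qed.

Lemma orbS (p : Zv) : orb (p + 1)%R = sigma u (orb p).
Proof.
have -> : (p + 1)%R = (p.+1 %% nv)%N :> nat.
  by rewrite -[in LHS](natr_Zp p) natr1 val_Zp_nat ?nv_gt1.
exact: orb_mod p.+1.
Qed.
End Iterates.
End Orbits.

(** * Homomorphisms of quiver representations *)

Section QuiverHoms.
Variables (k : closedFieldType) (T : taft_data k).
Local Notation Zv := ('Z_((2 * tn T) %/ td T)).
Local Notation qmod := (qmod T).

Let ord10 (i : 'I_(1 + 0)) : i = lshift 0 ord0.
Proof. by apply: val_inj; case: i => -[]. Qed.

Lemma qsimple_e (r p : Zv) :
  qe (qsimple r) p = if p == r then 1%:M else 0.
Proof.
apply/matrixP => i j; rewrite /= /bip_e (ord10 i) (ord10 j).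
rewrite block_mxEul !mxE eq_sym; case: eqP => _; rewrite ?mxE ?eqxx //.
Qed.

Lemma qsimple_b (r p : Zv) : qb (qsimple r) p = 0.
Proof.
apply/matrixP => i j; rewrite /= /bip_b (ord10 i) (ord10 j).
by rewrite block_mxEul !mxE.
Qed.

Lemma qsimple_bb (r p : Zv) : qbb (qsimple r) p = 0.
Proof.
apply/matrixP => i j; rewrite /= /bip_bb (ord10 i) (ord10 j).
by rewrite block_mxEul !mxE.
Qed.

Lemma simple_in (V : qmod) r (f : 'M[k]_(qdim V, qdim (qsimple r))) :
  (forall p, qe V p *m f = if p == r then f else 0) ->
  (forall p, qb V p *m f = 0) -> (forall p, qbb V p *m f = 0) -> is_qhom f.
Proof.
move=> ef bf bbf; split=> p.
- by rewrite qsimple_e ef; case: eqP => _; rewrite ?mulmx1 ?mulmx0.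
- by rewrite qsimple_b bf mulmx0.
- by rewrite qsimple_bb bbf mulmx0.
Qed.

Lemma simple_out (V : qmod) r (f : 'M[k]_(qdim (qsimple r), qdim V)) :
  (forall p, f *m qe V p = if p == r then f else 0) ->
  (forall p, f *m qb V p = 0) -> (forall p, f *m qbb V p = 0) -> is_qhom f.
Proof.
move=> ef bf bbf; split=> p.
- by rewrite qsimple_e ef; case: eqP => _; rewrite ?mul1mx ?mul0mx.
- by rewrite qsimple_b bf mul0mx.
- by rewrite qsimple_bb bbf mul0mx.
Qed.

Section Bip.
Variables (nx ny : nat) (posx : 'I_nx -> Zv) (posy : 'I_ny -> Zv).
Variables (b bb : 'I_ny -> 'I_nx -> bool).
Local Notation V := (bipartite posx posy b bb).

Lemma bip_y_in s : is_qhom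
  (V := qsimple (posy s)) (W := V) (col_mx 0 (delta_mx s 0) : 'M[k]_(nx + ny, 1 + 0)).
Proof.
apply: simple_in => p; rewrite /= mul_block_col ?mulmx0 ?mul0mx ?addr0 ?add0r.
- have -> : diag_mx (\row_s0 (posy s0 == p)%:R) *m (delta_mx s 0 : 'M[k]_(ny, 1 + 0)) =
      if p == posy s then delta_mx s 0 else 0.
    have [->|neq_p] := eqVneq p (posy s); apply/matrixP => i j;
      rewrite mul_diag_mx !mxE; have [->|neq] := eqVneq i s;
      rewrite ?eqxx ?mul1r ?mulr0 //.
    by rewrite eq_sym (negPf neq_p) mul0r.
  by case: ifP => _ //; rewrite col_mx0.
- by rewrite col_mx0.
- by rewrite col_mx0.
Qed.

Lemma bip_x_out r : is_qhom
  (V := V) (W := qsimple (posx r)) (row_mx (delta_mx 0 r) 0 : 'M[k]_(1 + 0, nx + ny)).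
Proof.
apply: simple_out => p; rewrite /= mul_row_block ?mulmx0 ?mul0mx ?addr0 ?add0r.
- have -> : (delta_mx 0 r : 'M[k]_(1 + 0, nx)) *m diag_mx (\row_s0 (posx s0 == p)%:R) =
      if p == posx r then delta_mx 0 r else 0.
    have [->|neq_p] := eqVneq p (posx r); apply/matrixP => i j;
      rewrite mul_mx_diag !mxE; have [->|neq] := eqVneq j r;
      rewrite ?eqxx ?mulr1 ?andbF ?mul0r //.
    by rewrite [posx r == p]eq_sym (negPf neq_p) mulr0.
  by case: ifP => _ //; rewrite row_mx0.
- by rewrite row_mx0.
- by rewrite row_mx0.
Qed.
End Bip.

Section BipHom.
Variables (nx ny : nat) (posx : 'I_nx -> Zv) (posy : 'I_ny -> Zv).
Variables (b bb : 'I_ny -> 'I_nx -> bool).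
Variables (nx' ny' : nat) (posx' : 'I_nx' -> Zv) (posy' : 'I_ny' -> Zv).
Variables (b' bb' : 'I_ny' -> 'I_nx' -> bool).
Variables (fx : 'M[k]_(nx', nx)) (fy : 'M[k]_(ny', ny)).
Hypothesis hx : forall i j, fx i j != 0 -> posx' i = posx j.
Hypothesis hy : forall i j, fy i j != 0 -> posy' i = posy j.
Hypothesis cb : forall s r, b s r -> posy s = posx r + 1.
Hypothesis cbb : forall s r, bb s r -> posx r = posy s + 1.
Hypothesis cb' : forall s r, b' s r -> posy' s = posx' r + 1.
Hypothesis cbb' : forall s r, bb' s r -> posx' r = posy' s + 1.
Hypothesis hb : fy *m (\matrix_(s, r) (b s r)%:R) = (\matrix_(s, r) (b' s r)%:R) *m fx.
Hypothesis hbb :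
  fy *m (\matrix_(s, r) (bb s r)%:R) = (\matrix_(s, r) (bb' s r)%:R) *m fx.

Let diag_comm N N' (pos : 'I_N -> Zv) (pos' : 'I_N' -> Zv) (f : 'M[k]_(N', N)) p :
  (forall i j, f i j != 0 -> pos' i = pos j) ->
  f *m diag_mx (\row_s (pos s == p)%:R) = diag_mx (\row_s (pos' s == p)%:R) *m f.
Proof.
move=> hf; apply/matrixP => i j; rewrite mul_mx_diag mul_diag_mx !mxE.
have [->|/hf->] := eqVneq (f i j) 0; first by rewrite mul0r mulr0.
by rewrite mulrC.
Qed.

Lemma bip_hom : is_qhom (V := bipartite posx posy b bb)
  (W := bipartite posx' posy' b' bb')
  (block_mx fx 0 0 fy : 'M[k]_(nx' + ny', nx + ny)).
Proof.
split=> p; rewrite /= !mulmx_block !(mul0mx, mulmx0, addr0, add0r).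
- by rewrite !(diag_comm p hx, diag_comm p hy).
- congr block_mx.
  have E m1 m2 (c : 'I_m2 -> 'I_m1 -> bool) (px : 'I_m1 -> Zv) (py : 'I_m2 -> Zv) :
      (forall s r, c s r -> py s = px r + 1) ->
      \matrix_(s, r) [&& c s r, px r == p & py s == p + 1]%:R =
      (\matrix_(s, r) (c s r)%:R) *m diag_mx (\row_s (px s == p)%:R) :> 'M[k]_(m2, m1).
    move=> cc; apply/matrixP => s r; rewrite mul_mx_diag !mxE.
    case: (boolP (c s r)) => [/cc->|_]; last by rewrite mul0r.
    by rewrite (inj_eq (addIr 1)) andbb mul1r.
  by rewrite !E // mulmxA hb -!mulmxA (diag_comm p hx).
- congr block_mx.
  have E m1 m2 (c : 'I_m2 -> 'I_m1 -> bool) (px : 'I_m1 -> Zv) (py : 'I_m2 -> Zv) :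
      (forall s r, c s r -> px r = py s + 1) ->
      \matrix_(s, r) [&& c s r, px r == p + 1 & py s == p]%:R =
      (\matrix_(s, r) (c s r)%:R) *m diag_mx (\row_s (px s == p + 1)%:R)
      :> 'M[k]_(m2, m1).
    move=> cc; apply/matrixP => s r; rewrite mul_mx_diag !mxE.
    case: (boolP (c s r)) => [/cc->|_]; last by rewrite mul0r.
    by rewrite (inj_eq (addIr 1)) andbb mul1r.
  by rewrite !E // mulmxA hbb -!mulmxA (diag_comm (p + 1) hx).
Qed.
End BipHom.
End QuiverHoms.

(** * String modules *)

Section Strings.
Variables (k : closedFieldType) (T : taft_data k).
Local Notation d := (td T).
Local Notation Zn := ('Z_(tn T)).
Local Notation Zv := ('Z_((2 * tn T) %/ td T)).

Lemma isL_G u i (L : dmod T) : is_L u i L -> dG L = qpow u *: sumK L.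
Proof.
move=> [_ _ GL _]; apply: (totP (@de_sum _ _ L)) => j.
by rewrite GL mxZl -mulmxE Ke scalerA qpowD.
Qed.

Lemma isL_tame u i (L : dmod T) : is_L u i L -> tame L.
Proof. by move/isL_G; rewrite /tame => ->; rewrite expmxZ Kd qpow_exp_d scale1r. Qed.

Variables (u i : Zn) (np : nonproj u i) (E : block_equiv u i).
Local Notation orb p := (iter p (sigma u) i).
Local Notation good M := (tame M /\ forall s, s != 0 -> zfree d (zop M s)).

Lemma delta11 : delta_mx 0 0 = 1%:M :> 'M[k]_1.
Proof. by apply/matrixP => a b; rewrite !ord1 !mxE. Qed.

Lemma len2_dexact (px py : Zv) b bb :
  let V := bipartite (fun _ : 'I_1 => px) (fun _ : 'I_1 => py)
    (fun _ _ => b) (fun _ _ => bb) in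
  dexact (M1 := be_obj E (qsimple py)) (M := be_obj E V)
    (M2 := be_obj E (qsimple px))
    (be_mor E (V := qsimple py) (W := V)
      (col_mx 0 (delta_mx ord0 0) : 'M[k]_(1 + 1, 1 + 0)))
    (be_mor E (V := V) (W := qsimple px)
      (row_mx (delta_mx 0 ord0) 0 : 'M[k]_(1 + 0, 1 + 1))).
Proof.
move=> V; apply: (be_dexact E (V1 := qsimple py) (V := V) (V2 := qsimple px)
  (f' := row_mx 0 (delta_mx 0 ord0) : 'M[k]_(1 + 0, 1 + 1))
  (p' := col_mx (delta_mx ord0 0) 0 : 'M[k]_(1 + 1, 1 + 0))).
- exact: (@bip_y_in k T 1 1 (fun=> px) (fun=> py) (fun _ _ => b) (fun _ _ => bb) ord0).
- exact: (@bip_x_out k T 1 1 (fun=> px) (fun=> py) (fun _ _ => b) (fun _ _ => bb) ord0).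
- by rewrite mul_row_col mul0mx add0r mul_delta_mx; apply: delta11.
- by rewrite mul_row_col mul0mx addr0 mul_delta_mx; apply: delta11.
- rewrite !mul_col_row !mul0mx !mulmx0 !mul_delta_mx add_block_mx.
  by rewrite !addr0 !add0r !delta11 -scalar_mx_block.
Qed.

Lemma simple_data (p : Zv) : exists w : 'cV[k]_(ddim (be_obj E (qsimple p))),
  ladder (orb p) (Ldim u (orb p)) w.
Proof. exact: simple_ladder (be_simple E p). Qed.

Lemma simple_G (p : Zv) t : dG (be_obj E (qsimple p)) *m
    de (be_obj E (qsimple p)) t = (qpow u * qpow t) *: de (be_obj E (qsimple p)) t.
Proof.
have [_ _ GL _] := be_simple E p.
by rewrite mulmxE GL qpowD.
Qed.

Lemma good_len2_b p : good (be_obj E (qlen2_b p)).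
Proof.
have ex := len2_dexact p (p + 1) true false.
have tM : tame (be_obj E (qlen2_b p)).
  by apply: (tame_ext ex); apply: isL_tame (be_simple E _).
split=> // s s0.
have [w1 lad1] := simple_data p; have [w2 lad2] := simple_data (p + 1).
have npp := orb_nonproj np p; have /andP[N_gt0 _] := Ldim_nonproj npp.
rewrite orbS // in lad2; have nps := nonproj_sigma npp.
have /andP[N2_gt0 _] := Ldim_nonproj nps.
have [AN XN] := be_len2_b E p.
apply: (zfree_len2_up ex lad1 lad2 (Ldim_sigma npp) N_gt0 N2_gt0
  (simple_G p) (qpow_neq0 u) _ tM s0 AN XN).
by rewrite sigmaE.
Qed.

Lemma good_len2_bb p : good (be_obj E (qlen2_bb p)).
Proof.
have ex := len2_dexact p (p - 1) false true.
have tM : tame (be_obj E (qlen2_bb p)).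
  by apply: (tame_ext ex); apply: isL_tame (be_simple E _).
split=> // s s0.
have [w1 lad1] := simple_data p; have [w2 lad2] := simple_data (p - 1).
have npp := orb_nonproj np (p - 1)%R; have /andP[N2_gt0 _] := Ldim_nonproj npp.
have jE := orbS np (p - 1); rewrite subrK in jE.
have nps := nonproj_sigma npp; rewrite -jE in nps.
have /andP[N_gt0 _] := Ldim_nonproj nps.
have [AN XN] := be_len2_bb E p.
apply: (zfree_len2_dn ex lad1 lad2 _ N_gt0 N2_gt0
  (simple_G p) (qpow_neq0 u) _ tM s0 AN XN).
  by rewrite addnC jE Ldim_sigma.
by rewrite jE sigmaE.
Qed.

Lemma good_ext M1 M M2 (f : 'M[k]_(ddim M, ddim M1)) (p : 'M[k]_(ddim M2, ddim M)) :
  @dexact k T M1 M M2 f p -> good M1 -> good M2 -> good M.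
Proof.
move=> ex [t1 f1] [t2 f2]; have tM := tame_ext ex t1 t2; split=> // s s0.
by apply: (zfree_dext ex); [| |apply: f1|apply: f2].
Qed.

Lemma good0 (V : qmod T) : qdim V = 0%N -> good (be_obj E V).
Proof.
move=> V0; have E0 : 1%:M = 0 :> 'M[k]_(ddim (be_obj E V)).
  rewrite -(be_id E V) -(be0 E V V); congr be_mor.
  by apply/matrixP => -[a]; rewrite V0.
have all0 (A B : 'M[k]_(ddim (be_obj E V))) : A = B.
  by rewrite -[A]mul1mx -[B]mul1mx E0 !mul0mx.
by split=> [|s _]; [apply: all0|exists 0; apply: all0].
Qed.

(** [P] includes the first t basis vectors and [Q] is the coordinate of the last one. *)
Let P t : 'M[k]_(t.+1, t) := \matrix_(a, b) (a == b :> nat)%:R.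
Let Q t : 'M[k]_(1, t.+1) := \matrix_(a, b) (b == t :> nat)%:R.

Let PP t : (P t)^T *m P t = 1%:M.
Proof.
apply/matrixP => a b; rewrite !mxE (bigD1 (widen_ord (leqnSn t) a)) //= !mxE eqxx.
rewrite mul1r big1 ?addr0 // => c neq; rewrite !mxE.
case: (eqVneq (c : nat) a) => [ca|_]; last by rewrite mul0r.
by case/eqP: neq; apply: val_inj.
Qed.

Let QQ t : Q t *m (Q t)^T = 1%:M.
Proof.
apply/matrixP => a b; rewrite !ord1 !mxE (bigD1 ord_max) //= !mxE eqxx.
rewrite mul1r big1 ?addr0 // => c neq; rewrite !mxE.
case: (eqVneq (c : nat) t) => [ca|_]; last by rewrite mul0r.
by case/eqP: neq; apply: val_inj.
Qed.

Let PQ t : P t *m (P t)^T + (Q t)^T *m Q t = 1%:M.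
Proof.
apply/matrixP => a b; rewrite !mxE big_ord1 !mxE -val_eqE /=.
have [lt_a|le_a] := ltnP a t.
  rewrite (ltn_eqF lt_a) mul0r addr0 (bigD1 (Ordinal lt_a)) //= !mxE eqxx mul1r.
  rewrite eq_sym big1 ?addr0 // => c neq; rewrite !mxE.
  case: (eqVneq (a : nat) c) => [ac|_]; last by rewrite mul0r.
  by case/eqP: neq; apply: val_inj.
have at_ : a = t :> nat by apply/eqP; rewrite eqn_leq le_a -ltnS ltn_ord.
rewrite at_ eqxx mul1r eq_sym big1 ?add0r // => c _.
by rewrite !mxE at_ gtn_eqF ?mul0r.
Qed.

Let bool_mx (m p : nat) (c : 'I_m -> 'I_p -> bool) : 'M[k]_(m, p) :=
  \matrix_(s, r) (c s r)%:R.

Let P_eq t : P t *m bool_mx (fun s r : 'I_t => s == r) =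
  bool_mx (fun s r : 'I_t.+1 => s == r) *m P t.
Proof.
have id1 p : bool_mx (fun s r : 'I_p => s == r) = 1%:M.
  by apply/matrixP => a b; rewrite !mxE.
by rewrite !id1 mulmx1 mul1mx.
Qed.

Let P_S t : P t *m bool_mx (fun s r : 'I_t => s.+1 == r :> nat) =
  bool_mx (fun s r : 'I_t.+1 => s.+1 == r :> nat) *m P t.
Proof.
apply/matrixP => a b; rewrite !mxE.
rewrite [RHS](bigD1 (widen_ord (leqnSn t) b)) //= !mxE eqxx mulr1.
rewrite [X in _ = _ + X]big1 ?addr0 => [|c neq]; last first.
  rewrite !mxE; case: (eqVneq (c : nat) b) => [cb|_]; last by rewrite mulr0.
  by case/eqP: neq; apply: val_inj.
have [lt_a|le_a] := ltnP a t.
  rewrite (bigD1 (Ordinal lt_a)) //= !mxE eqxx mul1r.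
  rewrite big1 ?addr0 // => c neq; rewrite !mxE.
  case: (eqVneq (a : nat) c) => [ac|_]; last by rewrite mul0r.
  by case/eqP: neq; apply: val_inj.
rewrite gtn_eqF; last by rewrite ltnS; apply: leq_trans (ltnW (ltn_ord b)) le_a.
rewrite big1 // => c _; rewrite !mxE gtn_eqF ?mul0r //.
exact: leq_trans (ltn_ord c) le_a.
Qed.

Let Q_eq t : Q t *m bool_mx (fun s r : 'I_t.+1 => s == r) =
  bool_mx (fun s r : 'I_1 => true) *m Q t.
Proof.
have -> : bool_mx (fun s r : 'I_t.+1 => s == r) = 1%:M.
  by apply/matrixP => a b; rewrite !mxE.
have -> : bool_mx (fun s r : 'I_1 => true) = 1%:M.
  by apply/matrixP => a b; rewrite !ord1 !mxE.
by rewrite mulmx1 mul1mx.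
Qed.

Let Q_S t : Q t *m bool_mx (fun s r : 'I_t.+1 => s.+1 == r :> nat) =
  bool_mx (fun s r : 'I_1 => false) *m Q t.
Proof.
apply/matrixP => a b; rewrite !mxE !big1 // => c _; rewrite !mxE ?mul0r //.
case: (eqVneq (c : nat) t) => [->|_]; last by rewrite mul0r.
by rewrite gtn_eqF ?mulr0 // ltn_ord.
Qed.

Let block_id t :
  [/\ block_mx (P t)^T 0 0 (P t)^T *m block_mx (P t) 0 0 (P t) = 1%:M,
      block_mx (Q t) 0 0 (Q t) *m block_mx (Q t)^T 0 0 (Q t)^T = 1%:M
    & block_mx (P t) 0 0 (P t) *m block_mx (P t)^T 0 0 (P t)^T +
      block_mx (Q t)^T 0 0 (Q t)^T *m block_mx (Q t) 0 0 (Q t) = 1%:M].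
Proof.
rewrite !mulmx_block !(mul0mx, mulmx0, addr0, add0r) PP QQ add_block_mx PQ.
by rewrite !addr0 -!scalar_mx_block.
Qed.

Let P_neq0 t a b : P t a b != 0 -> a = b :> nat.
Proof. by rewrite mxE; case: (eqVneq (a : nat) b) => //; rewrite eqxx. Qed.

Let Q_neq0 t a b : Q t a b != 0 -> b = t :> nat.
Proof. by rewrite mxE; case: (eqVneq (b : nat) t) => //; rewrite eqxx. Qed.

Let cstr_b (t : nat) (s r : 'I_t) : s == r ->
  ((2 * s + 1)%:R : Zv) = (2 * r)%:R + 1.
Proof. by move/eqP->; rewrite natrD. Qed.

Let cstr_bb (t : nat) (s r : 'I_t) : s.+1 == r :> nat ->
  ((2 * r)%:R : Zv) = (2 * s + 1)%:R + 1.
Proof. by move/eqP<-; rewrite natr1; congr _%:R; lia. Qed.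

(** The first t pairs x_r, y_r span a subrepresentation, into which the arrow \bar b from x_t leads;
    the quotient, with basis x_t, y_t, is the length-two representation [qlen2_b]. *)
Lemma good_string_plus t : good (be_obj E (qstring_plus T t)).
Proof.
elim: t => [|t IH]; first exact: good0.
have [PPb QQb PQb] := block_id t.
have ex := be_dexact E (V1 := qstring_plus T t) (V := qstring_plus T t.+1)
  (V2 := qlen2_b (2 * t)%:R) (f := block_mx (P t) 0 0 (P t))
  (p := block_mx (Q t) 0 0 (Q t)) _ _ PPb QQb PQb.
apply: (good_ext (ex _ _) IH (good_len2_b _)).
- apply: bip_hom; [by move=> a b /P_neq0->|by move=> a b /P_neq0->
    |exact: cstr_b|exact: cstr_bb|exact: cstr_b|exact: cstr_bb
    |exact: P_eq|exact: P_S].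
- apply: bip_hom; [by move=> a b /Q_neq0->|by move=> a b /Q_neq0->; rewrite natrD
    |exact: cstr_b|exact: cstr_bb|by []|by []|exact: Q_eq|exact: Q_S].
Qed.

Let cstr_b' (t : nat) (s r : 'I_t) : s.+1 == r :> nat ->
  (- (2 * s + 1)%:R : Zv) = - (2 * r)%:R + 1.
Proof.
move/eqP<-; rewrite (_ : 2 * s.+1 = (2 * s + 1).+1)%N; last by lia.
by rewrite -[in RHS]natr1 opprD subrK.
Qed.

Let cstr_bb' (t : nat) (s r : 'I_t) : s == r ->
  (- (2 * r)%:R : Zv) = - (2 * s + 1)%:R + 1.
Proof. by move/eqP->; rewrite natrD opprD subrK. Qed.

Lemma good_string_minus t : good (be_obj E (qstring_minus T t)).
Proof.
elim: t => [|t IH]; first exact: good0.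
have [PPb QQb PQb] := block_id t.
have ex := be_dexact E (V1 := qstring_minus T t) (V := qstring_minus T t.+1)
  (V2 := qlen2_bb (- (2 * t)%:R)) (f := block_mx (P t) 0 0 (P t))
  (p := block_mx (Q t) 0 0 (Q t)) _ _ PPb QQb PQb.
apply: (good_ext (ex _ _) IH (good_len2_bb _)).
- apply: bip_hom; [by move=> a b /P_neq0->|by move=> a b /P_neq0->
    |exact: cstr_b'|exact: cstr_bb'|exact: cstr_b'|exact: cstr_bb'
    |exact: P_S|exact: P_eq].
- apply: bip_hom; [by move=> a b /Q_neq0->
    |by move=> a b /Q_neq0->; rewrite natrD opprD
    |exact: cstr_b'|exact: cstr_bb'|by []
    |by move=> s r _; rewrite subrK|exact: Q_S|exact: Q_eq].
Qed.
End Strings.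

(** * Identification of the bands in the principal block *)

Section BandQuiver.
Variables (k : closedFieldType) (T : taft_data k).
Local Notation nv := ((2 * tn T) %/ td T)%N.
Local Notation Zv := ('Z_((2 * tn T) %/ td T)).
Variable lam : k.
Local Notation B := (qband T lam 1).

Let N := (Zp_trunc nv).+2.
Let psi m n (A : 'M[k]_(m, n)) : 'M[k]_(m * 1, n * 1) := A *t (1%:M : 'M[k]_1).

Let psiM m n p (A : 'M[k]_(m, n)) (C : 'M[k]_(n, p)) : psi A *m psi C = psi (A *m C).
Proof. by rewrite /psi tensmx_mul mulmx1. Qed.

Let psi0 m n : psi (0 : 'M[k]_(m, n)) = 0.
Proof. exact: tens0mx. Qed.

(** Basis vector of the band at the vertex r, and [brow] its coordinate; [psi] accounts for the
    tensor factor k^l with l = 1. *)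
Definition bcol (r : Zv) : 'M[k]_(qdim B, 1) := psi (delta_mx r 0 : 'M[k]_(N, 1)).
Definition brow (r : Zv) : 'M[k]_(1, qdim B) := psi (delta_mx 0 r : 'M[k]_(1, N)).
Definition bscal (p : Zv) : k := if p == 0 then lam else 1.

Let bE p : qe B p = psi (delta_mx p p : 'M[k]_N). Proof. by []. Qed.

Let bB p : qb B p = if odd p then 0 else bscal p *: psi (delta_mx (p + 1) p : 'M[k]_N).
Proof.
rewrite /= /band_b; case: ifP => // _; rewrite /psi -tensmxZr; congr (_ *t _).
rewrite /bscal; case: ifP => _; last by rewrite scale1r.
by apply/matrixP => i j; rewrite !ord1 !mxE eqxx mulr1.
Qed.

Let bBB p : qbb B p = if odd p then psi (delta_mx p (p + 1) : 'M[k]_N) else 0.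
Proof. by []. Qed.

Let dmul m n p (i : 'I_m) (j j' : 'I_n) (l : 'I_p) :
  delta_mx i j *m delta_mx j' l = if j == j' then delta_mx i l else 0 :> 'M[k]_(m, p).
Proof. by rewrite mul_delta_mx_cond; case: eqP. Qed.

Let psi_if m n b (A : 'M[k]_(m, n)) : psi (if b then A else 0) = if b then psi A else 0.
Proof. by case: b => //; apply: psi0. Qed.

Let psiD m n p (i : 'I_m) (j j' : 'I_n) (l : 'I_p) :
  psi (delta_mx i j) *m psi (delta_mx j' l) = if j == j' then psi (delta_mx i l) else 0.
Proof. by rewrite psiM dmul psi_if. Qed.

Lemma bcol_e p r : qe B p *m bcol r = if p == r then bcol r else 0.
Proof. by apply: etrans (@psiD N N 1 p p r 0) _; case: eqP => // ->. Qed.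

Lemma bcol_b p r : qb B p *m bcol r =
  if odd p then 0 else if p == r then bscal p *: bcol (p + 1) else 0.
Proof.
rewrite bB; case: ifP => _; first exact: mul0mx.
rewrite -scalemxAl; apply: etrans (congr1 _ (@psiD N N 1 (p + 1) p r 0)) _.
by case: eqP => // _; apply: scaler0.
Qed.

Lemma bcol_bb p r : qbb B p *m bcol r =
  if odd p then if p + 1 == r then bcol p else 0 else 0.
Proof.
rewrite bBB; case: ifP => _; last exact: mul0mx.
exact: (@psiD N N 1 p (p + 1) r 0).
Qed.

Lemma brow_e p r : brow r *m qe B p = if p == r then brow r else 0.
Proof. by apply: etrans (@psiD 1 N N 0 r p p) _; rewrite eq_sym; case: eqP => // ->. Qed.

Lemma brow_b p r : brow r *m qb B p =
  if odd p then 0 else if r == p + 1 then bscal p *: brow p else 0.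
Proof.
rewrite bB; case: ifP => _; first exact: mulmx0.
rewrite -scalemxAr; apply: etrans (congr1 _ (@psiD 1 N N 0 r (p + 1) p)) _.
by case: eqP => // _; apply: scaler0.
Qed.

Lemma brow_bb p r : brow r *m qbb B p =
  if odd p then if r == p then brow (p + 1) else 0 else 0.
Proof.
rewrite bBB; case: ifP => _; last exact: mulmx0.
exact: (@psiD 1 N N 0 r p (p + 1)).
Qed.

Lemma brow_col r s : brow r *m bcol s = if r == s then 1%:M else 0.
Proof.
apply: etrans (@psiD 1 N 1 0 r s 0) _; case: eqP => // _.
by rewrite delta11; apply: tensmx11.
Qed.

Let psi_sum : psi (1%:M : 'M[k]_N) = \sum_r psi (delta_mx r r).
Proof. by rewrite /psi mx1_sum_delta tensmx_suml. Qed.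

Lemma bcol_row : \sum_r bcol r *m brow r = 1%:M.
Proof.
transitivity (psi (1%:M : 'M[k]_N)); last exact: tensmx11.
rewrite psi_sum; by apply: eq_bigr => r _; apply: etrans (@psiD N 1 N r 0 0 r) _.
Qed.

(** Every arrow acting on the band leads from an even vertex to an odd one: odd vertices give the
    socle, even ones the top. *)
Lemma band_soc (r : Zv) : odd r -> is_qhom (V := qsimple r) (W := B) (bcol r).
Proof.
move=> or; apply: simple_in => p; first exact: bcol_e.
  by rewrite bcol_b; case: ifP => // op; case: eqP => // pr; rewrite pr or in op.
rewrite bcol_bb; case: ifP => // op; case: eqP => // pr.
by rewrite -pr odd_Zv1 op in or.
Qed.

Lemma band_top (r : Zv) : ~~ odd r -> is_qhom (V := B) (W := qsimple r) (brow r).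
Proof.
move=> er; apply: simple_out => p; first exact: brow_e.
  rewrite brow_b; case: ifP => // op; case: eqP => // pr.
  by rewrite pr odd_Zv1 op in er.
by rewrite brow_bb; case: ifP => // op; case: eqP => // pr; rewrite pr op in er.
Qed.

(* Pullback of qlen2_b p and qlen2_bb p over their common top. *)
Definition wpos (p : Zv) (s : 'I_2) : Zv := if s == 0 then p + 1 else p - 1.
Definition wmod (p : Zv) : qmod T :=
  bipartite (fun _ : 'I_1 => p) (wpos p) (fun s _ => s == 0) (fun s _ => s != 0).

Let row_sel (s : 'I_2) (c : 'I_2 -> 'I_1 -> bool) : (forall r, c r 0 = (r == s)) ->
  (delta_mx 0 s : 'M[k]_(1, 2)) *m (\matrix_(a, r) (c a r)%:R) = 1%:M :> 'M[k]_1.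
Proof.
move=> cE; apply/matrixP => i j; rewrite !ord1 -rowE !mxE cE eqxx.
by [].
Qed.

Let row_sel0 (s : 'I_2) (c : 'I_2 -> 'I_1 -> bool) : (forall r, c r 0 = (r != s)) ->
  (delta_mx 0 s : 'M[k]_(1, 2)) *m (\matrix_(a, r) (c a r)%:R) = 0 :> 'M[k]_1.
Proof.
move=> cE; apply/matrixP => i j; rewrite !ord1 -rowE !mxE cE eqxx.
by [].
Qed.

Let one_mx (c : bool) : \matrix_(a < 1, r < 1) c%:R = (c%:R)%:M :> 'M[k]_1.
Proof. by apply/matrixP => i j; rewrite !ord1 !mxE eqxx. Qed.

Let ord2 (s : 'I_2) : (s != 0) = (s == 1).
Proof. by case: s => -[|[|s]]. Qed.

Lemma wmod_b p : is_qhom (V := wmod p) (W := qlen2_b p)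
  (block_mx 1%:M 0 0 (delta_mx 0 0) : 'M[k]_(1 + 1, 1 + 2)).
Proof.
apply: bip_hom => //.
- move=> i j; rewrite !ord1 mxE /wpos; case: (j == 0) => //.
  by rewrite andbF eqxx.
- by move=> s r /eqP->.
- by move=> s r; rewrite /wpos => /negPf->; rewrite subrK.
- by rewrite (@row_sel 0 (fun s _ => s == 0)) // one_mx mulmx1.
- by rewrite (@row_sel0 0 (fun s _ => s != 0)) // one_mx mul_scalar_mx scale0r.
Qed.

Lemma wmod_bb p : is_qhom (V := wmod p) (W := qlen2_bb p)
  (block_mx 1%:M 0 0 (delta_mx 0 1) : 'M[k]_(1 + 1, 1 + 2)).
Proof.
apply: bip_hom => //.
- move=> i j; rewrite !ord1 mxE /wpos; case: (eqVneq j 0) => // ->.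
  by rewrite andbF eqxx.
- by move=> s r /eqP->.
- by move=> s r; rewrite /wpos => /negPf->; rewrite subrK.
- by move=> s r _; rewrite subrK.
- rewrite (@row_sel0 1 (fun s _ => s == 0)) ?one_mx ?mul_scalar_mx ?scale0r //.
  by move=> r; rewrite -[r == 0]negbK ord2.
- rewrite (@row_sel 1 (fun s _ => s != 0)) ?one_mx ?mulmx1 //.
Qed.

(** For even p, this maps onto the subrepresentation generated at the vertex p. It is not injective
    when there are only two vertices, since then p + 1 = p - 1. *)
Definition wband (p : Zv) : 'M[k]_(qdim B, 1 + 2) :=
  row_mx (bcol p)
    (bscal p *: (bcol (p + 1) *m delta_mx 0 0) + bcol (p - 1) *m delta_mx 0 1).

Lemma wband_hom (p : Zv) : ~~ odd p -> is_qhom (V := wmod p) (W := B) (wband p).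
Proof.
move=> ep; have ep1 : odd (p + 1)%R by rewrite odd_Zv1.
have ep2 : odd (p - 1)%R by move: ep; rewrite -{1}[p](subrK 1) odd_Zv1 negbK.
have dm (s : 'I_2) r : (delta_mx 0 s : 'M[k]_(1, 2)) *m
    diag_mx (\row_s0 (wpos p s0 == r)%:R) = if r == wpos p s then delta_mx 0 s else 0.
  have [->|neq_p] := eqVneq r (wpos p s); apply/matrixP => i j;
    rewrite mul_mx_diag !mxE; have [->|neq] := eqVneq j s;
    rewrite ?eqxx ?mulr1 ?andbF ?mul0r //.
  by rewrite [wpos p s == r]eq_sym (negPf neq_p) mulr0.
split=> r; rewrite mul_mx_row mul_row_block ?mulmx0 ?mul0mx ?addr0 ?add0r.
- congr row_mx.
    have -> : diag_mx (\row_(s < 1) (p == r)%:R) = (p == r)%:R%:M :> 'M[k]_1.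
      by apply/matrixP => i j; rewrite !ord1 !mxE eqxx.
    by rewrite bcol_e mul_mx_scalar eq_sym; case: eqP; rewrite ?scale1r ?scale0r.
  rewrite mulmxDl mulmxDr mxZm mxmZ -!mulmxA !dm !mulmxA !bcol_e /wpos /=.
  by congr (_ *: _ + _); case: eqP; rewrite ?mulmx0 ?mul0mx.
- congr row_mx; last first.
    rewrite mulmxDr mxmZ !mulmxA !bcol_b.
    case: ifP => or; first by rewrite !mul0mx scaler0 addr0.
    have nr (x : Zv) : odd x -> (r == x) = false.
      by move=> ox; apply: contraFF or => /eqP->.
    by rewrite !nr // !mul0mx scaler0 addr0.
  have -> : \matrix_(s < 2, r0 < 1) [&& s == 0, p == r & wpos p s == r + 1]%:R =
      if p == r then delta_mx 0 0 else 0 :> 'M[k]_(2, 1).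
    have [->|neq] := eqVneq p r; apply/matrixP => s x; rewrite !mxE; last first.
      by rewrite andbF.
    by rewrite !ord1 eqxx andbT /wpos; case: (s == 0) => //=; rewrite eqxx.
  rewrite bcol_b eq_sym; case: eqP => [->|_]; last by rewrite mulmx0; case: ifP.
  rewrite (negPf ep) mulmxDl mxZm -!mulmxA !dmul /= mulmx0 addr0.
  by rewrite delta11 mulmx1.
- congr row_mx; last first.
    rewrite mulmxDr mxmZ !mulmxA !bcol_bb.
    case: ifP => or; last by rewrite !mul0mx scaler0 addr0.
    have nr (x : Zv) : odd x -> (r + 1 == x) = false.
      by move=> ox; apply: contraTF or => /eqP e; rewrite -odd_Zv1 e.
    by rewrite !nr // !mul0mx scaler0 addr0.
  have -> : \matrix_(s < 2, r0 < 1) [&& s != 0, p == r + 1 & wpos p s == r]%:R =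
      if p == r + 1 then delta_mx 1 0 else 0 :> 'M[k]_(2, 1).
    have [->|neq] := eqVneq p (r + 1); apply/matrixP => s x; rewrite !mxE; last first.
      by rewrite andbF.
    rewrite !ord1 eqxx andbT /wpos addrK.
    by case: s => -[|[|s]] //= lt_s; rewrite eqxx.
  rewrite bcol_bb eq_sym; case: eqP => [pr|_]; last by rewrite mulmx0; case: ifP.
  have -> : odd r by move: ep; rewrite -pr odd_Zv1 negbK.
  rewrite mulmxDl mxZm -!mulmxA !dmul /= mulmx0 scaler0 add0r.
  by rewrite delta11 mulmx1 -pr addrK.
Qed.

Lemma wband_top p : brow p *m wband p = row_mx (delta_mx 0 0) 0 :> 'M[k]_(1, 1 + 2).
Proof.
rewrite mul_mx_row brow_col eqxx delta11; congr row_mx.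
have n1 : (1 : Zv) != 0 by [].
rewrite mulmxDr mxmZ !mulmxA !brow_col -[X in X == _ + _]addr0 (inj_eq (addrI p)).
rewrite eq_sym (negPf n1) mul0mx scaler0 add0r.
rewrite -[X in X == _]addr0 (inj_eq (addrI p)) eq_sym oppr_eq0 (negPf n1).
by rewrite mul0mx.
Qed.
End BandQuiver.

(** * Weights of the simple modules of the principal block *)

Section PrincipalOrbit.
Variables (k : closedFieldType) (T : taft_data k).
Local Notation n := (tn T).
Local Notation d := (td T).
Local Notation Zn := ('Z_(tn T)).
Local Notation Zv := ('Z_((2 * tn T) %/ td T)).
Local Notation orb r := (iter r (sigma (0%R : Zn)) (0%R : Zn)).

Let d_gt1 : (1 < d)%N := td_ge2 T.

Lemma Ldim0 r : Ldim (0%R : Zn) ((d * r)%:R : Zn) = 1%N.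
Proof.
have w0 : weight (0%R : Zn) ((d * r)%:R) = d.-1 %[mod d].
  rewrite -[_%:R]add0r weightD /weight mul0rn add0r add0r opp1_nat.
  rewrite val_Zp_nat ?tn_gt1 // (modn_small (m := n.-1)); last first.
    by have := tn_gt1 T; lia.
  rewrite addnC [(d * r)%N]mulnC mulnA modnMDl.
  have := divnK (td_dvd_n T); have := tn_gt1 T; case: (n %/ d)%N => [|s]; first lia.
  move=> _ <-; rewrite (_ : (s.+1 * d).-1 = s * d + d.-1)%N ?modnMDl //.
  by move: d_gt1; rewrite mulSn; lia.
have np : nonproj (0 : Zn) ((d * r)%:R).
  rewrite /nonproj /dvdn w0 modn_small; by move: d_gt1; lia.
rewrite /Ldim residue_nonproj // w0 modn_small; by move: d_gt1; lia.
Qed.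

Lemma orb0_even r : orb (2 * r) = (d * r)%:R.
Proof. by rewrite (orb_even (nonproj00 T)) add0r. Qed.

Lemma orb0_odd r : orb (2 * r).+1 = (d * r).+1%:R.
Proof.
have np := orb_nonproj (nonproj00 T) (2 * r).
by rewrite iterS sigmaE // orb0_even Ldim0 natr1.
Qed.

(** With dimensions alternating between 1 and d - 1, the weights of these simple modules tile Z_n.
    Hence each weight space of a band with l = 1 is a line. *)
Lemma Ldim_orb r : Ldim (0%R : Zn) (orb r) = if odd r then d.-1 else 1%N.
Proof.
rewrite -[r]odd_double_half -mul2n oddD oddM /= addbF oddb.
case: (odd r) => /=; last by rewrite add0n orb0_even Ldim0.
have np := orb_nonproj (nonproj00 T) (2 * r./2).
have := Ldim_sigma np; rewrite {1}orb0_even Ldim0.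
by rewrite add1n -[sigma _ _]/(orb (2 * r./2).+1) => <-.
Qed.

(* The vertex p for which e_i does not kill L(0, sigma_0^p(0)). *)
Definition vtx (i : Zn) : Zv :=
  if (d %| i)%N then (2 * (i %/ d))%:R else (2 * (i %/ d)).+1%:R.

Let vtx_val (i : Zn) :
  vtx i = (if (d %| i)%N then 2 * (i %/ d) else (2 * (i %/ d)).+1)%N :> nat.
Proof.
have lt_i : (i < n)%N by have := ltn_ord i; rewrite {2}Zp_cast ?tn_gt1.
have lt_q : (i %/ d < n %/ d)%N.
  by rewrite ltn_divRL ?td_dvd_n //; apply: leq_ltn_trans (leq_divM _ _) _.
rewrite /vtx; case: ifP => _; rewrite val_Zp_nat ?nv_gt1 ?modn_small //;
  rewrite nv_eq; lia.
Qed.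

Lemma odd_vtx i : odd (vtx i) = ~~ (d %| i)%N.
Proof. by rewrite vtx_val; case: ifP => _ /=; rewrite oddM. Qed.

Lemma vtx_orb i : exists2 r, (r < Ldim (0%R : Zn) (orb (vtx i)))%N & i = orb (vtx i) + r%:R.
Proof.
exists (if (d %| i) then 0 else (i %% d).-1)%N.
  rewrite Ldim_orb odd_vtx; case: ifP => //= /negbT; rewrite /dvdn -lt0n.
  by have := ltn_pmod i (ltnW d_gt1); lia.
rewrite vtx_val; case: ifP => [dvd_i|/negbT].
  by rewrite orb0_even addr0 mulnC divnK // natr_Zp.
rewrite /dvdn -lt0n orb0_odd -natrD => mod_i.
rewrite -[LHS]natr_Zp {1}(divn_eq i d); congr _%:R; move: mod_i; lia.
Qed.

Let block_lt h r : (h < n %/ d)%N -> (r < d)%N -> (d * h + r < n)%N.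
Proof.
move=> lt_h lt_r; rewrite -[X in (_ < X)%N](divnK (td_dvd_n T)).
have : (h.+1 * d <= n %/ d * d)%N by rewrite leq_mul2r lt_h orbT.
by rewrite mulSn [(h * d)%N]mulnC; lia.
Qed.

Lemma orb_vtx (p : Zv) r : (r < Ldim (0%R : Zn) (orb p))%N -> vtx (orb p + r%:R) = p.
Proof.
have lt_p : (p < 2 * (n %/ d))%N.
  by apply: leq_trans (ltn_ord p) _; rewrite Zp_cast ?nv_gt1 // nv_eq.
rewrite Ldim_orb => lt_r; apply: val_inj; rewrite /= vtx_val.
have pE := odd_double_half p; rewrite -mul2n in pE.
have [op|ep] := boolP (odd p); rewrite ?op ?(negPf ep) in lt_r pE.
  rewrite add1n in pE; rewrite -pE orb0_odd -natrD.
  have lt_n : (d * p./2 + r.+1 < n)%N by apply: block_lt; lia.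
  rewrite addSnnS val_Zp_nat ?tn_gt1 // modn_small //.
  rewrite dvdn_addr ?dvdn_mulr // gtnNdvd //; last by lia.
  rewrite [(d * _)%N]mulnC divnMDl ?(divn_small (m := r.+1)) ?addn0; lia.
rewrite add0n in pE; case: r lt_r => // _.
rewrite -pE orb0_even addr0 val_Zp_nat ?tn_gt1 // modn_small.
  by rewrite dvdn_mulr // mulKn //; lia.
by rewrite -[X in (X < _)%N]addn0 block_lt //; lia.
Qed.
End PrincipalOrbit.

(** * The action of D on a band of the principal block *)

Section PrincipalBand.
Variables (k : closedFieldType) (T : taft_data k).
Local Notation d := (td T).
Local Notation Zn := ('Z_(tn T)).
Local Notation Zv := ('Z_((2 * tn T) %/ td T)).
Variables (E : block_equiv (0%R : Zn) 0%R) (lam : k).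
Hypothesis lam0 : lam != 0.
Local Notation orb r := (iter r (sigma (0%R : Zn)) (0%R : Zn)).
Local Notation B := (qband T lam 1).
Local Notation M := (be_obj E B).
Local Notation S r := (be_obj E (qsimple r)).
Local Notation Ecol r := (be_mor E (V := qsimple r) (W := B) (bcol lam r)).
Local Notation Erow r := (be_mor E (V := B) (W := qsimple r) (brow lam r)).

Lemma simple_vec i : exists w : 'cV[k]_(ddim (S (vtx i))),
  [/\ w != 0, de (S (vtx i)) i *m w = w
    & forall a, exists c, de (S (vtx i)) i *m a = c *: w].
Proof.
have [r lt_r iE] := vtx_orb i; have [w lad] := simple_data E (vtx i).
exists (sumA (S (vtx i)) ^+ r *m w); split; first exact: lad_neq0 lad _ lt_r.
  rewrite [X in de _ X]iE mulmxA mulmxE (tot_eX (@deA _ _ _)) -mulmxE -mulmxA.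
  by rewrite (lad_e lad).
by move=> a; rewrite [X in de _ X]iE; apply: lad_span lad _ _ lt_r.
Qed.

Lemma simple_e0 (p : Zv) i : p != vtx i -> de (S p) i = 0.
Proof.
move=> neq; have [w lad] := simple_data E p.
apply: (lad_out lad) => r lt_r; apply: contraNneq neq => ->.
by rewrite orb_vtx.
Qed.

Let Ecol_hom r : odd (r : Zv) -> is_dhom (Ecol r).
Proof. by move=> or; apply: be_hom (band_soc lam or). Qed.

Let Erow_hom r : ~~ odd (r : Zv) -> is_dhom (Erow r).
Proof. by move=> er; apply: be_hom (band_top lam er). Qed.

(** A vector killed by all maps to the top lies in the socle, by [be_exact], and only the simple
    module at [vtx i] has the weight i. *)
Lemma band_dec i (a : 'cV[k]_(ddim M)) : de M i *m a = a ->
  (forall t : Zv, ~~ odd t -> Erow t *m a = 0) ->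
  exists y, a = if odd (vtx i) then Ecol (vtx i) *m (de (S (vtx i)) i *m y) else 0.
Proof.
move=> ea row0.
pose pt (t : Zv) : 'M[k]_(qdim (qsimple t), qdim B) :=
  if odd t then 0 else brow lam t.
have hpt t : is_qhom (V := B) (W := qsimple t) (pt t).
  rewrite /pt; case: ifPn => [_|]; first exact: qhom0.
  exact: band_top.
have [|||||y aE] := @be_exact _ _ _ _ E Zv Zv (fun t => odd (t : Zv)) B
    (fun t => qsimple t) (fun t => qsimple t) pt (fun t => bcol lam t)
    (fun t => brow lam t) hpt _ _ _ _ _ a.
- by move=> j; apply: band_soc.
- by move=> j _; rewrite brow_col eqxx.
- by move=> j l _ _ /negPf neq; rewrite brow_col neq.
- move=> s b pb; rewrite -[LHS]mul1mx -(bcol_row T lam) mulmx_suml.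
  rewrite (bigID (fun j : Zv => odd j)) /= [X in _ + X]big1 ?addr0.
    by apply: eq_bigr => j _; rewrite mulmxA.
  move=> j /negPf ej; have := pb j; rewrite /pt ej => b0.
  by rewrite -mulmxA b0 mulmx0.
- move=> t; rewrite /pt; case: ifPn => [_|et]; last exact: row0.
  by rewrite be0 mul0mx.
exists (y (vtx i)); rewrite -ea {1}aE mulmx_sumr.
have term (j : Zv) : odd j -> de M i *m (Ecol j *m y j) = Ecol j *m (de (S j) i *m y j).
  by move=> oj; rewrite !mulmxA (dhom_e (Ecol_hom oj)).
rewrite (eq_bigr _ term) {term}; case: ifPn => ov.
  rewrite (bigD1 (vtx i)) //= big1 ?addr0 // => j /andP[_ neq].
  by rewrite (simple_e0 neq) mul0mx mulmx0.
rewrite big1 // => j oj; rewrite simple_e0 ?mul0mx ?mulmx0 //.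
by apply: contraNneq ov => <-.
Qed.

Let ioa (p : Zv) (s : 'I_2) : 'M[k]_(1 + 2, 1 + 0) := col_mx 0 (delta_mx s 0).
Let pia (s : 'I_2) : 'M[k]_(1 + 1, 1 + 2) := block_mx 1%:M 0 0 (delta_mx 0 s).
Let top2 : 'M[k]_(1 + 0, 1 + 2) := row_mx (delta_mx 0 0) 0.
Let top1 : 'M[k]_(1 + 0, 1 + 1) := row_mx (delta_mx 0 0) 0.

Let top_pia s : top1 *m pia s = top2.
Proof.
by rewrite /top1 /pia mul_row_block !(mulmx1, mul0mx, mulmx0, addr0).
Qed.

Let wband_io (p : Zv) (s : 'I_2) : exists2 c, c != 0 &
  wband lam p *m ioa p s = c *: bcol lam (wpos p s).
Proof.
have dm (t : 'I_2) : (delta_mx 0 t : 'M[k]_(1, 2)) *m (delta_mx s 0 : 'M[k]_(2, 1)) =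
    if t == s then 1%:M else 0.
  rewrite mul_delta_mx_cond; case: (t == s) => //=.
  by rewrite -delta11.
exists (if s == 0 then bscal lam p else 1).
  by rewrite /bscal; case: ifP => _; [case: ifP => _ //|]; apply: oner_neq0.
rewrite /ioa mul_row_col mulmx0 add0r mulmxDl mxZm -!mulmxA !dm /wpos.
have [->|] := eqVneq s 0; first by rewrite /= mulmx1 mulmx0 addr0.
case: s {dm} => -[|[|s]] // lt_s _ /=; rewrite mulmx0 scaler0 add0r scale1r.
by rewrite mulmx1.
Qed.

Section Top.
Variable p : Zv.
Hypothesis even_p : ~~ odd p.
Local Notation W := (wmod p : qmod T).
Local Notation Eio s := (be_mor E (V := qsimple (wpos p s)) (W := W) (ioa p s)).
Local Notation Ew := (be_mor E (V := W) (W := B) (wband lam p)).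
Local Notation Etop := (be_mor E (V := W) (W := qsimple p) top2).

Let io_hom s : is_qhom (V := qsimple (wpos p s)) (W := W) (ioa p s).
Proof.
exact: (@bip_y_in k T 1 2 (fun=> p) (wpos p) (fun s _ => s == 0) (fun s _ => s != 0)).
Qed.

Let top_hom : is_qhom (V := W) (W := qsimple p) top2.
Proof.
exact: (@bip_x_out k T 1 2 (fun=> p) (wpos p) (fun s _ => s == 0) (fun s _ => s != 0)).
Qed.

(** Although W may not embed in the band, each simple summand of its socle does, and the kernel of g
    is the summand at [wpos p s]. *)
Lemma wband_inj_on (V2 : qmod T) (g : 'M[k]_(qdim V2, 1 + 2)) g' s :
  is_qhom (V := W) (W := V2) g -> g *m g' = 1%:M ->
  ioa p s *m (row_mx 0 (delta_mx 0 s) : 'M[k]_(1 + 0, 1 + 2)) + g' *m g = 1%:M ->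
  forall x : 'cV[k]_(ddim (be_obj E W)),
    be_mor E (V := W) (W := V2) g *m x = 0 -> x != 0 -> Ew *m x != 0.
Proof.
move=> hg gg' eq1 x gx; apply: contraNneq => wx.
have io1 : (row_mx 0 (delta_mx 0 s) : 'M[k]_(1 + 0, 1 + 2)) *m ioa p s = 1%:M.
  by rewrite mul_row_col mul0mx add0r mul_delta_mx; apply: delta11.
have [_ _ [i' [p' [_ _ ii']]]] :=
  be_dexact E (V1 := qsimple (wpos p s)) (V := W) (io_hom s) hg io1 gg' eq1.
have xE : x = Eio s *m (i' *m x).
  by rewrite -{1}[x]mul1mx -ii' mulmxDl -!mulmxA gx mulmx0 addr0.
have [c c0 cE] := wband_io p s.
have hcol : is_qhom (V := qsimple (wpos p s)) (W := B) (wband lam p *m ioa p s).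
  by apply: (qhom_mul (V := W)); [apply: io_hom|apply: wband_hom].
have colV : (c^-1 *: brow lam (wpos p s)) *m (wband lam p *m ioa p s) = 1%:M.
  by rewrite cE mxmZ mxZm brow_col eqxx !scalerA mulfV ?scale1r.
have [h hE] := be_inj E (V := qsimple (wpos p s)) (W := B) hcol colV.
have i0 : i' *m x = 0.
  rewrite -[LHS]mul1mx -hE (be_comp E (V := W)) //; last exact: wband_hom.
  by rewrite -!mulmxA -xE wx mulmx0.
by rewrite xE i0 mulmx0.
Qed.

Let pia_id s s' : s' != s ->
  ioa p s *m (row_mx 0 (delta_mx 0 s) : 'M[k]_(1 + 0, 1 + 2)) +
  (block_mx 1%:M 0 0 (delta_mx s' 0) : 'M[k]_(1 + 2, 1 + 1)) *m pia s' = 1%:M.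
Proof.
move=> neq; rewrite mul_col_row mulmx_block !(mul0mx, mulmx0, addr0, add0r).
rewrite mulmx1 !mul_delta_mx add_block_mx !(addr0, add0r).
suff -> : delta_mx s s + delta_mx s' s' = 1%:M :> 'M[k]_2.
  by rewrite -scalar_mx_block.
rewrite mx1_sum_delta (bigD1 s) //= (bigD1 s') //= big1 ?addr0 // => r.
case: s s' r neq => -[|[|s]] // ? [] [|[|s']] // ? [] [|[|r]] // ?;
  by rewrite -?val_eqE.
Qed.

Let pia_pia s : pia s *m (block_mx 1%:M 0 0 (delta_mx s 0) : 'M[k]_(1 + 2, 1 + 1)) = 1%:M.
Proof.
rewrite mulmx_block !(mul0mx, mulmx0, addr0, add0r) mulmx1 mul_delta_mx delta11.
by rewrite -scalar_mx_block.
Qed.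

(* v lifts the generator of L(0, j) to the pullback W; it is moved by A in    *)
(* the quotient qlen2_b and by X in the quotient qlen2_bb.                    *)
Lemma wmod_vec : let j := orb p in
  exists2 w : 'cV[k]_(ddim (S p)), ladder j 1 w &
  exists v : 'cV[k]_(ddim (be_obj E W)),
    [/\ de (be_obj E W) j *m v = v, Etop *m v = w,
        sumA M *m (Ew *m v) != 0 & dX M *m (Ew *m v) != 0].
Proof.
move=> j; have [w lad] := simple_data E p.
have L1 : Ldim (0%R : Zn) j = 1%N by rewrite Ldim_orb (negPf even_p).
rewrite L1 in lad; exists w => //.
have [g gE] : exists g, Etop *m g = 1%:M.
  apply: (be_epi E (V := W) (W := qsimple p) (f' := col_mx (delta_mx 0 0) 0) top_hom).
  by rewrite mul_row_col mulmx0 addr0 mul_delta_mx; apply: delta11.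
have htop := be_hom E top_hom.
exists (de (be_obj E W) j *m (g *m w)).
set v := de _ j *m (g *m w); have ev : de (be_obj E W) j *m v = v.
  by rewrite /v mulmxA mulmxE de_orth eqxx.
have tv : Etop *m v = w.
  have tw : Etop *m (g *m w) = w by rewrite mulmxA gE mul1mx.
  by rewrite /v mulmxA (dhom_e htop) -mulmxA tw (lad_e lad).
have out (px : Zv) : px != p -> forall r, (r < Ldim (0%R : Zn) (orb px))%N ->
    j + 0%:R != orb px + r%:R.
  move=> neq r lt_r; apply: contraNneq neq => e.
  by rewrite -(orb_vtx lt_r) -e orb_vtx // L1.
have one0 : (1 : Zv) != 0 by [].
have np1 : p + 1 != p by rewrite -subr_eq0 addrAC subrr add0r.
have np2 : p - 1 != p by rewrite -subr_eq0 addrAC subrr add0r oppr_eq0.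
have [Ab Xb] := be_len2_b E p; have [Abb Xbb] := be_len2_bb E p.
rewrite -/j L1 in Ab Xb Abb Xbb; rewrite !gammaE // expr1 addrK in Ab Xb Abb Xbb.
have hw := be_hom E (wband_hom lam even_p).
have hb := be_hom E (wmod_b p); have hbb := be_hom E (wmod_bb p).
have line (px : Zv) b bb (ne : px != p) (s : 'I_2) (V := bipartite (fun _ : 'I_1 => p)
    (fun _ : 'I_1 => px) (fun _ _ => b) (fun _ _ => bb) : qmod T)
    (C : 'M[k]_(ddim (be_obj E V))) :
    is_qhom (V := W) (W := V) (pia s) -> C *m de (be_obj E V) j != 0 ->
    C *m (be_mor E (V := W) (W := V) (pia s) *m v) != 0.
  move=> hV C0; have [w2 lad2] := simple_data E px.
  apply: (ext_line (len2_dexact E p px b bb) lad lad2 (r := 0)) => //.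
  - exact: out.
  - by rewrite addr0 mulmxA -(dhom_e (be_hom E hV)) -mulmxA ev.
  - rewrite expr0 mul1mx mulmxA -be_comp //; last first.
      exact: (@bip_x_out k T 1 1 (fun=> p) (fun=> px) (fun _ _ => b) (fun _ _ => bb)).
    by rewrite -tv; congr (be_mor _ _ *m _); apply: top_pia.
  - by rewrite addr0.
have dead (V : qmod T) (g0 : 'M[k]_(qdim V, 1 + 2)) (C : 'M[k]_(ddim (be_obj E V))) :
    is_qhom (V := W) (W := V) g0 -> C *m de (be_obj E V) j = 0 ->
    C *m (be_mor E (V := W) (W := V) g0 *m v) = 0.
  move=> hV C0; rewrite -ev [_ *m (de _ _ *m v)]mulmxA (dhom_e (be_hom E hV)).
  by rewrite -mulmxA mulmxA C0 mul0mx.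
split=> //.
- rewrite mulmxA -(dhom_A hw) -mulmxA.
  (* As N = 1 here, a v vanishes in [qlen2_bb p] by [be_len2_bb] but not in [qlen2_b p] by
     [be_len2_b]; so it is a nonzero vector of the summand at p + 1. For X the roles are
     exchanged. *)
  apply: (wband_inj_on (s := 0) (wmod_bb p) (pia_pia 1)); first exact: pia_id.
    by rewrite mulmxA (dhom_A hbb) -mulmxA; apply: dead => //; apply: wmod_bb.
  have := line (p + 1) true false np1 0 (sumA _) (wmod_b p) Ab.
  rewrite mulmxA -(dhom_A hb) -mulmxA; apply: contraNneq => ->.
  by rewrite mulmx0.
- rewrite mulmxA -(dhom_X hw) -mulmxA.
  apply: (wband_inj_on (s := 1) (wmod_b p) (pia_pia 0)); first exact: pia_id.
    by rewrite mulmxA (dhom_X hb) -mulmxA; apply: dead => //; apply: wmod_b.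
  have := line (p - 1) false true np2 1 (dX _) (wmod_bb p) Xbb.
  rewrite mulmxA -(dhom_X hbb) -mulmxA; apply: contraNneq => ->.
  by rewrite mulmx0.
Qed.
End Top.

Let simple_Gw p i (w : 'cV[k]_(ddim (S p))) : de (S p) i *m w = w ->
  dG (S p) *m w = qpow i *: w.
Proof.
move=> ew; rewrite -{1}ew mulmxA simple_G qpow0 mul1r mxZm ew.
by [].
Qed.

Lemma band_vec i : exists v : 'cV[k]_(ddim M),
  [/\ v != 0 /\ de M i *m v = v,
      forall a, exists c, de M i *m a = c *: v,
      dG M *m v = qpow i *: v,
      (d %| i)%N -> sumA M *m v != 0 /\ dX M *m v != 0
    & ~~ (d %| i)%N -> exists2 y, de (S (vtx i)) i *m y = y & v = Ecol (vtx i) *m y].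
Proof.
have row0 (x : 'cV[k]_(ddim M)) : de M i *m x = x -> forall t : Zv, ~~ odd t ->
    t != vtx i -> Erow t *m x = 0.
  move=> ex t et neq; rewrite -ex mulmxA (dhom_e (Erow_hom et)).
  by rewrite simple_e0 // !mul0mx.
have ede (x : 'cV[k]_(ddim M)) : de M i *m (de M i *m x) = de M i *m x.
  by rewrite mulmxA mulmxE de_orth eqxx.
have [dvd_i|ndvd_i] := boolP (d %| i)%N; last first.
  have ov : odd (vtx i) by rewrite odd_vtx.
  have [w [w0 ew span]] := simple_vec i; have hc := Ecol_hom ov.
  have colV : brow lam (vtx i) *m bcol lam (vtx i) = 1%:M by rewrite brow_col eqxx.
  have [h hE] := be_inj E (band_soc lam ov) colV.
  exists (Ecol (vtx i) *m w); split=> //; last by exists w.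
  - split; last by rewrite mulmxA -(dhom_e hc) -mulmxA ew.
    by apply: contraNneq w0 => e; rewrite -[w]mul1mx -hE -mulmxA e mulmx0.
  - move=> a; have [|y aE] := band_dec (ede a).
      by move=> t et; apply: row0 => //; apply: contraNneq et => ->.
    have [c cE] := span y; exists c.
    by rewrite aE ov cE mxmZ.
  - by rewrite mulmxA -(dhom_G hc) -mulmxA (simple_Gw ew) mxmZ.
have ev : ~~ odd (vtx i) by rewrite odd_vtx dvd_i.
have [w lad [x [ex tx Ax Xx]]] := wmod_vec ev.
have jE : orb (vtx i) = i.
  have [r lt_r iE] := vtx_orb i; rewrite [RHS]iE.
  by move: lt_r; rewrite Ldim_orb (negPf ev); case: r {iE} => //; rewrite addr0.
rewrite jE in lad ex; have hw := be_hom E (wband_hom lam ev).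
have kill (a : 'cV[k]_(ddim M)) : de M i *m a = a -> Erow (vtx i) *m a = 0 -> a = 0.
  move=> ea ra; have [|y ->] := band_dec ea; last by rewrite (negPf ev).
  move=> t et; have [->|neq] := eqVneq t (vtx i); [exact: ra|exact: row0].
set v := be_mor E _ *m x in Ax Xx.
have evv : de M i *m v = v by rewrite /v mulmxA -(dhom_e hw) -mulmxA ex.
have rv : Erow (vtx i) *m v = w.
  rewrite /v mulmxA -be_comp; [|exact: wband_hom|exact: band_top].
  by rewrite wband_top.
have w0 : w != 0.
  by have := lad_neq0 lad (r := 0) isT; rewrite expr0 mul1mx.
have ew := lad_e lad; have hr := Erow_hom ev.
exists v; split=> //.
- by split=> //; apply: contraNneq w0 => v0; rewrite -rv v0 mulmx0.
- move=> a; have [c cE] := lad_span lad (r := 0) (Erow (vtx i) *m a) isT.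
  rewrite addr0 expr0 mul1mx in cE; exists c.
  apply/eqP; rewrite -subr_eq0; apply/eqP/kill.
    by rewrite mulmxBr ede mxmZ evv.
  by rewrite mulmxBr mxmZ rv mulmxA (dhom_e hr) -mulmxA cE subrr.
- apply/eqP; rewrite -subr_eq0; apply/eqP/kill.
    by rewrite mulmxBr mxmZ evv -Ge_mx evv.
  by rewrite mulmxBr mxmZ rv mulmxA (dhom_G hr) -mulmxA rv (simple_Gw ew) subrr.
Qed.

Lemma band_induced : exists2 s, s != 0 &
  exists (w : 'cV[k]_(ddim M)) rho, induced s w rho s%:M (c0 T / s)%:M 1%:M.
Proof.
have /fin_all_exists[v vP] i := band_vec i.
have vtx1 (i : Zn) : (d %| i)%N -> ~~ (d %| (i + 1)%R)%N.
  rewrite -!qpow_eq1 qpowD => /eqP->; rewrite mul1r qpow1.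
  by rewrite -[tq T]expr1 -(prim_order_dvd (tq_prim T)) dvdn1 gtn_eqF ?td_ge2.
apply: (@explicit_band k T M v) => i.
- by case: (vP i) => -[].
- by case: (vP i) => -[].
- by case: (vP i).
- by case: (vP i).
- by move=> di; case: (vP i) => _ _ _ /(_ di)[].
- by move=> di; case: (vP i) => _ _ _ /(_ di)[].
- move=> di; have nd := vtx1 i di.
  case: (vP (i + 1)) => _ _ _ _ /(_ nd)[y ey ->].
  have ov : odd (vtx (i + 1)) by rewrite odd_vtx.
  rewrite mulmxA -(dhom_X (Ecol_hom ov)) -mulmxA -ey [dX _ *m _]mulmxA.
  rewrite mulmxE -deX simple_e0.
    by rewrite mul0r mul0mx mulmx0.
  by apply: contraTneq ov => ->; rewrite odd_vtx di.
Qed.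
End PrincipalBand.

(** * Dependence on the eigenvalue *)

Section Twist.
Variables (k : closedFieldType) (T : taft_data k) (P : dmod T) (z : k).
Local Notation n := (tn T).
Local Notation Zn := ('Z_(tn T)).
Hypothesis zn : z ^+ n = 1.

(** Conjugation by this operator multiplies X by z and a by z^-1 and fixes G and K, so it turns a
    generator of parameter t into one of parameter z t. *)
Definition twist := \sum_(i : Zn) z ^+ i *: de P i.

Lemma twist_e i : twist *m de P i = z ^+ i *: de P i.
Proof.
rewrite /twist mulmx_suml (bigD1 i) //= mxZm mulmxE de_orth eqxx big1 ?addr0 // => j neq.
by rewrite mxZl de_orth (negPf neq) scaler0.
Qed.

Lemma e_twist i : de P i *m twist = z ^+ i *: de P i.
Proof.
rewrite /twist mulmx_sumr (bigD1 i) //= mxmZ mulmxE de_orth eqxx big1 ?addr0 // => j neq.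
by rewrite mxZr de_orth eq_sym (negPf neq) scaler0.
Qed.

Lemma twist_succ (i : Zn) : z ^+ (i + 1)%R = z * z ^+ i.
Proof.
rewrite -exprS -[in LHS](natr_Zp i) natr1 val_Zp_nat ?tn_gt1 //.
by rewrite expr_mod.
Qed.

Lemma twist_G : dG P *m twist = twist *m dG P.
Proof.
apply: (totP (@de_sum _ _ P)) => i; rewrite -!mulmxE -!mulmxA twist_e mxmZ.
by rewrite mulmxE dGe -mulmxE mulmxA twist_e mxZm.
Qed.

Lemma twist_K : sumK P *m twist = twist *m sumK P.
Proof.
apply: (totP (@de_sum _ _ P)) => i.
by rewrite -!mulmxE -!mulmxA twist_e mxmZ Ke mxmZ twist_e !scalerA mulrC.
Qed.

Lemma twist_X : dX P *m twist = z *: (twist *m dX P).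
Proof.
apply: (totP (@de_sum _ _ P)) => i; rewrite -[i](subrK 1); move: (i - 1) => j.
rewrite -!mulmxE mxZm -!mulmxA twist_e mxmZ mulmxE -deX -mulmxE [twist *m _]mulmxA.
by rewrite twist_e mxZm scalerA -twist_succ.
Qed.

Lemma twist_A : z *: (sumA P *m twist) = twist *m sumA P.
Proof.
apply: (totP (@de_sum _ _ P)) => i.
rewrite -!mulmxE mxZm -!mulmxA twist_e mxmZ mulmxE -deA -mulmxE [twist *m _]mulmxA.
by rewrite twist_e mxZm scalerA -twist_succ.
Qed.
End Twist.

(** * Bands with different eigenvalues *)

Section Distinct.
Variables (k : closedFieldType) (T : taft_data k).
Local Notation n := (tn T).
Local Notation nv := ((2 * tn T) %/ td T)%N.
Local Notation Zv := ('Z_((2 * tn T) %/ td T)).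

(* On an induced module the parameter s only matters up to n-th roots of 1.   *)
Lemma induced_hom (P Q : dmod T) (w : 'cV[k]_(ddim P)) rho (w' : 'cV[k]_(ddim Q)) rho' s t :
  s != 0 -> t != 0 -> s ^+ n = t ^+ n ->
  induced s w rho s%:M (c0 T / s)%:M 1%:M ->
  induced t w' rho' t%:M (c0 T / t)%:M 1%:M ->
  exists2 f : 'M[k]_(ddim Q, ddim P), is_dhom f & f != 0.
Proof.
move=> s0 t0 st indP indQ.
have [z [zn szt z0]] : exists z, [/\ z ^+ n = 1, s = z * t & z != 0].
  exists (s / t); split; last by rewrite mulf_neq0 ?invr_eq0.
    by rewrite exprMn exprVn st mulfV ?expf_neq0.
  by rewrite divfK.
pose phi := twist Q z *m w'.
have Xw : dX Q *m w' + t *: (dG Q *m w') = t *: w'.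
  by have := ind_x indQ; rewrite mulmxDl mxZm mul_mx_scalar.
have Aw : sumA Q *m w' + (c0 T / t) *: (sumK Q *m w') = (c0 T / t) *: w'.
  by have := ind_y indQ; rewrite mulmxDl mxZm mul_mx_scalar.
have Gw : dG Q *m w' = sumK Q *m w' by have := ind_c indQ; rewrite mulmx1.
have phi_x : opx Q s *m phi = phi *m s%:M.
  rewrite /opx mulmxDl mxZm !mulmxA twist_X // twist_G // mxZm -!mulmxA.
  rewrite {1}szt -scalerA -scalerDr -mxmZ -mulmxDr Xw mul_mx_scalar !mxmZ.
  by rewrite scalerA -szt.
have phi_y : opy Q s *m phi = phi *m (c0 T / s)%:M.
  apply: (scalerI z0); rewrite /opy mulmxDl mxZm !mulmxA scalerDr -(mxZm z) twist_A //.
  have zs : z * (c0 T / s) = c0 T / t by rewrite szt; field; rewrite ?z0 ?t0.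
  rewrite twist_K // scalerA zs -!mulmxA -mxmZ -mulmxDr Aw mul_mx_scalar.
  by rewrite !mxmZ scalerA zs.
have phi_c : dG Q *m phi = sumK Q *m phi *m 1%:M.
  by rewrite mulmx1 !mulmxA twist_G // twist_K // -!mulmxA Gw.
exists (extend rho phi); first exact (extend_dhom indP phi_x phi_y phi_c).
apply/eqP => F0; have phi0 : phi = 0 by rewrite -(extend_w indP phi) F0 mul0mx.
have := ind_rho indQ 0 0; rewrite eqxx -mulmxA => e.
have ew : de Q 0 *m w' = 0.
  by rewrite -[LHS]scale1r -[1](expr0 z) -mxZm -(e_twist Q z 0) -mulmxA -/phi phi0 mulmx0.
move: e; rewrite ew mulmx0 => /matrixP/(_ 0 0)/eqP.
by rewrite !mxE eq_sym oner_eq0.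
Qed.

(** A homomorphism is a scalar at each vertex. Every acting arrow except b_0 forces equal scalars at
    its ends, so going around the cycle they all agree, and b_0 then multiplies the common value by
    mu on one side and lam on the other. *)
Lemma band_qhom lam mu (f : 'M[k]_(qdim (qband T mu 1), qdim (qband T lam 1))) :
  is_qhom f -> lam != mu -> f = 0.
Proof.
move=> hf neq; pose F p r := brow mu p *m f *m bcol lam r.
have F_off p r : p != r -> F p r = 0.
  move=> /negPf pr; have := congr1 (fun A => brow mu p *m A *m bcol lam r) (qhom_e hf p).
  rewrite -!mulmxA bcol_e pr !mulmx0 !mulmxA brow_e eqxx.
  by [].
have Fb p : ~~ odd (p : Zv) -> bscal mu p *: F p p = bscal lam p *: F (p + 1) (p + 1).
  move=> /negPf ep.
  have := congr1 (fun A => brow mu (p + 1) *m A *m bcol lam p) (qhom_b hf p).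
  rewrite -!mulmxA bcol_b ep eqxx !mxmZ !mulmxA brow_b ep eqxx !mxZm.
  by [].
have Fbb p : odd (p : Zv) -> F (p + 1) (p + 1) = F p p.
  move=> op.
  have := congr1 (fun A => brow mu p *m A *m bcol lam (p + 1)) (qhom_bb hf p).
  rewrite -!mulmxA bcol_bb op eqxx !mulmxA brow_bb op eqxx.
  by [].
have FS p : p != 0 -> F (p + 1) (p + 1) = F p p.
  move=> p0; have [/Fbb //|/Fb] := boolP (odd (p : Zv)).
  by rewrite /bscal (negPf p0) !scale1r.
have Fr r : (0 < r <= nv)%N -> F r%:R r%:R = F 1 1.
  elim: r => // r IH; have [->|r_gt0] := posnP r; first by [].
  move=> /= lt_r; rewrite -natr1 FS ?IH ?r_gt0 1?ltnW //.
  by rewrite -val_eqE /= val_Zp_nat ?nv_gt1 // modn_small // -lt0n.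
have F0 : F 0 0 = F 1 1.
  have := Fr nv; rewrite leqnn (ltnW (nv_gt1 T)) => /(_ isT) <-.
  have -> // : nv%:R = 0 :> Zv.
  by apply: val_inj; rewrite /= val_Zp_nat ?nv_gt1 // modnn.
have F1 : F 1 1 = 0.
  have := Fb 0 isT; rewrite add0r /bscal eqxx F0 => /eqP.
  rewrite -subr_eq0 -scalerBl scaler_eq0 subr_eq0 eq_sym (negPf neq) /=.
  by move/eqP.
have Fd p : F p p = 0.
  have [->|p0] := eqVneq p 0; first by rewrite F0.
  rewrite -[p]natr_Zp Fr //.
  rewrite lt0n; apply/andP; split; first by apply: contraNneq p0 => e; apply/eqP/val_inj.
  by apply: ltnW; rewrite -[X in (_ < X)%N](Zp_cast (nv_gt1 T)).
have -> : f = (\sum_p bcol mu p *m brow mu p) *m f *m (\sum_r bcol lam r *m brow lam r).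
  by rewrite !bcol_row mul1mx mulmx1.
rewrite !mulmx_suml big1 // => p _; rewrite mulmx_sumr big1 // => r _.
have -> : bcol mu p *m brow mu p *m f *m (bcol lam r *m brow lam r) =
    bcol mu p *m F p r *m brow lam r by rewrite /F !mulmxA.
have [<-|pr] := eqVneq p r; first by rewrite Fd mulmx0 mul0mx.
by rewrite F_off // mulmx0 mul0mx.
Qed.
End Distinct.

(** * Projectivity of the tensor products *)

Section BandFiltration.
Variables (k : closedFieldType) (T : taft_data k).
Local Notation nv := ((2 * tn T) %/ td T)%N.
Local Notation N := (Zp_trunc nv).+2.
Variable lam : k.

Lemma band_hom l l' (g : 'M[k]_(l', l)) :
  g *m jordan l lam = jordan l' lam *m g ->
  is_qhom (V := qband T lam l) (W := qband T lam l') ((1%:M : 'M[k]_N) *t g).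
Proof.
move=> gJ; split=> p; rewrite /= /band_e /band_b /band_bb.
- by rewrite !tensmx_mul !mulmx1 !mul1mx.
- case: ifP => _; first by rewrite mulmx0 mul0mx.
  rewrite !tensmx_mul mulmx1 !mul1mx; congr (_ *t _).
  by case: ifP => _; rewrite ?gJ // mulmx1 mul1mx.
- case: ifP => _; last by rewrite mulmx0 mul0mx.
  by rewrite !tensmx_mul !mulmx1 !mul1mx.
Qed.

Lemma jordan_block l : jordan (1 + l) lam =
  block_mx (jordan 1 lam) (\row_j (j == 0 :> nat)%:R) 0 (jordan l lam).
Proof.
apply/matrixP => i j; rewrite -[i]splitK -[j]splitK.
case: (split i) => a; case: (split j) => b;
  rewrite ?(block_mxEul, block_mxEur, block_mxEdl, block_mxEdr) !mxE -!val_eqE /=.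
- by rewrite !ord1.
- by rewrite !ord1 /= add1n eqSS eq_sym.
- by rewrite !ord1.
- by rewrite !add1n !eqSS.
Qed.
End BandFiltration.

Section Assembly.
Variables (k : closedFieldType) (T : taft_data k).
Local Notation n := (tn T).
Local Notation d := (td T).
Local Notation Zn := ('Z_(tn T)).
Local Notation nv := ((2 * tn T) %/ td T)%N.
Local Notation N := (Zp_trunc nv).+2.
Local Notation dmod := (dmod T).
Variable E : block_equiv (0%R : Zn) 0%R.
Local Notation Eband lam l := (be_obj E (qband T lam l)).

Lemma band_dexact lam l : exists f p,
  @dexact k T (Eband lam 1) (Eband lam l.+1) (Eband lam l) f p.
Proof.
pose f : 'M[k]_(1 + l, 1) := col_mx 1%:M 0; pose f' : 'M[k]_(1, 1 + l) := row_mx 1%:M 0.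
pose p : 'M[k]_(l, 1 + l) := row_mx 0 1%:M; pose p' : 'M[k]_(1 + l, l) := col_mx 0 1%:M.
have fJ : f *m jordan 1 lam = jordan (1 + l) lam *m f.
  rewrite jordan_block mul_block_col mul_col_mx.
  by rewrite !(mulmx1, mul1mx, mulmx0, mul0mx, addr0).
have pJ : p *m jordan (1 + l) lam = jordan l lam *m p.
  rewrite jordan_block mul_row_block mul_mx_row.
  by rewrite !(mulmx1, mul1mx, mulmx0, mul0mx, addr0, add0r).
have f'f : f' *m f = 1%:M by rewrite mul_row_col mulmx1 mulmx0 addr0.
have pp' : p *m p' = 1%:M by rewrite mul_row_col mulmx1 mulmx0 add0r.
have ff' : f *m f' + p' *m p = 1%:M.
  rewrite !mul_col_row add_block_mx !(mulmx1, mulmx0, mul0mx, addr0, add0r).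
  by rewrite -scalar_mx_block.
exists (be_mor E (V := qband T lam 1) (W := qband T lam l.+1) ((1%:M : 'M[k]_N) *t f)).
exists (be_mor E (V := qband T lam l.+1) (W := qband T lam l) ((1%:M : 'M[k]_N) *t p)).
apply: (be_dexact E (V1 := qband T lam 1) (V := qband T lam l.+1) (V2 := qband T lam l)
  (f' := (1%:M : 'M[k]_N) *t f') (p' := (1%:M : 'M[k]_N) *t p')).
- exact: (@band_hom k T lam 1 (1 + l) f fJ).
- exact: (@band_hom k T lam (1 + l) l p pJ).
- by rewrite tensmx_mul mulmx1 [X in _ *t X]f'f; apply: tensmx11.
- by rewrite tensmx_mul mulmx1 [X in _ *t X]pp'; apply: tensmx11.
- rewrite !tensmx_mul -tensmxDr [X in _ *t X]ff' mulmx1.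
  exact: tensmx11.
Qed.

Definition retract (C M : dmod) : Prop :=
  exists (i : 'M[k]_(ddim M, ddim C)) (p : 'M[k]_(ddim C, ddim M)),
    [/\ is_dhom i, is_dhom p & p *m i = 1%:M].

Lemma retract_trans A B C : retract A B -> retract B C -> retract A C.
Proof.
move=> [i [p [hi hp pi]]] [j [r [hj hr rj]]]; exists (j *m i), (p *m r).
by split; [apply: dhom_mul|apply: dhom_mul|rewrite mulmxA -(mulmxA p) rj mulmx1].
Qed.

Lemma retract_iso A B : diso A B -> retract A B /\ retract B A.
Proof. by move=> [f [g [hf hg gf fg]]]; split; [exists f, g|exists g, f]. Qed.

Lemma retract_tens A A' B B' : retract A A' -> retract B B' ->
  retract (dtens A B) (dtens A' B').
Proof.
move=> [i [p [hi hp pi]]] [j [r [hj hr rj]]]; exists (i *t j), (p *t r).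
by split; [apply: dhom_tens|apply: dhom_tens|rewrite tensmx_mul pi rj tensmx11].
Qed.

Lemma retract_refl A : retract A A.
Proof. by exists 1%:M, 1%:M; split; rewrite ?mulmx1 //; apply: dhom_id. Qed.

Lemma retract_bigsum r (F : 'I_r -> dmod) (P : pred 'I_r) :
  retract (\big[@dsum k T/dzero T]_(s < r | P s) F s)
    (\big[@dsum k T/dzero T]_(s < r) F s).
Proof.
elim: (index_enum _) => [|s e IH]; first by rewrite !big_nil; apply: retract_refl.
rewrite !big_cons; move: (\big[_/_]_(j <- e | P j) F j) (\big[_/_]_(j <- e) F j) IH.
move=> A B [i [p [hi hp pi]]]; case: ifP => _.
  exists (block_mx 1%:M 0 0 i), (block_mx 1%:M 0 0 p); split.
  - split=> *; rewrite /= !mulmx_block !(mulmx1, mul1mx, mulmx0, mul0mx, addr0, add0r);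
    by rewrite ?(dhom_e hi, dhom_a hi, dhom_G hi, dhom_X hi).
  - split=> *; rewrite /= !mulmx_block !(mulmx1, mul1mx, mulmx0, mul0mx, addr0, add0r);
    by rewrite ?(dhom_e hp, dhom_a hp, dhom_G hp, dhom_X hp).
  - rewrite mulmx_block !(mulmx1, mul1mx, mulmx0, mul0mx, addr0, add0r) pi.
    by rewrite -scalar_mx_block.
exists (col_mx 0 i), (row_mx 0 p); split.
- split=> *; rewrite /= mul_block_col mul_col_mx !(mulmx0, mul0mx, addr0, add0r);
  by rewrite ?(dhom_e hi, dhom_a hi, dhom_G hi, dhom_X hi).
- split=> *; rewrite /= mul_row_block mul_mx_row !(mulmx0, mul0mx, addr0, add0r);
  by rewrite ?(dhom_e hp, dhom_a hp, dhom_G hp, dhom_X hp).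
- by rewrite mul_row_col mul0mx add0r.
Qed.

Lemma core_retract M C : is_core M C -> retract C M.
Proof.
move=> [r [F [P [_ isoM _ isoC]]]].
apply: retract_trans (retract_iso isoC).1 _.
exact: retract_trans (retract_bigsum F P) (retract_iso isoM).2.
Qed.

Lemma retract_proj A B : retract A B -> dprojective B -> dprojective A.
Proof. by move=> [i [p [hi hp pi]]]; apply: dproj_retract hi hp pi. Qed.

Lemma tame_induced s (P : dmod) (w : 'cV[k]_(ddim P)) rho x y :
  induced s w rho x y 1%:M -> tame P.
Proof.
move=> indP; have GP : dG P = sumK P.
  apply: (ind_ext indP) => i.
  by rewrite -!mulmxA Ge_mx (ind_c indP) mulmx1 !mulmxA eK Ke.
by rewrite /tame GP Kd.
Qed.

Lemma band_tens_proj lam s w rho (L X : dmod) l : s != 0 ->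
  @induced k T s (Eband lam 1) 1 w rho s%:M (c0 T / s)%:M 1%:M ->
  tame L -> tame X -> (forall xi, xi ^+ d = s ^+ d -> zfree d (zop X xi)) ->
  dprojective (dtens (dtens (Eband lam l.+1) L) X).
Proof.
move=> s0 indP tL tX free.
have base := proj_tens s0 (tame_induced indP) tL tX indP free.
elim: l => [|l IH]; first exact: base.
have [f [p ex]] := band_dexact lam l.+1.
exact: dproj_ext (dexact_tens X (dexact_tens L ex)) base IH.
Qed.

Lemma band_tens_zfree mu s w rho (v : Zn) (L : dmod) xi l : s != 0 ->
  @induced k T s (Eband mu 1) 1 w rho s%:M (c0 T / s)%:M 1%:M ->
  dG L = qpow v *: sumK L -> xi != 0 -> xi ^+ n != s ^+ n ->
  tame (dtens (Eband mu l.+1) L) /\ zfree d (zop (dtens (Eband mu l.+1) L) xi).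
Proof.
move=> s0 indP GL xi0 neq.
have tL : tame L by rewrite /tame GL expmxZ Kd qpow_exp_d scale1r.
have base : tame (dtens (Eband mu 1) L) /\ zfree d (zop (dtens (Eband mu 1) L) xi).
  split; first exact: tame_tens (tame_induced indP) tL.
  exact (zfree_band_tens s0 indP (qpow_exp_d v) GL xi0 neq).
elim: l => [|l [tl fl]]; first exact: base.
have [f [p ex]] := band_dexact mu l.+1; have exL := dexact_tens L ex.
have tl1 := tame_ext exL base.1 tl; split=> //.
exact: zfree_dext exL xi0 tl1 base.2 fl.
Qed.
End Assembly.

Theorem proposition4p6 (k : closedFieldType) (T : taft_data k)
    (E : forall u i : 'Z_(tn T), nonproj u i -> block_equiv u i)
    (u i v j : 'Z_(tn T)) (hui : nonproj u i) (hvj : nonproj v j)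
    (l t : nat) (l_gt0 : (0 < l)%N) (t_gt0 : (0 < t)%N) :
  (forall lam mu : k, lam != 0 -> mu != 0 -> lam != mu ->
     forall C C' : dmod T,
       is_band E lam l u i C -> is_band E mu t v j C' ->
       dprojective (dtens C C')) /\
  (forall lam : k, lam != 0 ->
     forall C : dmod T, is_band E lam l u i C ->
       dprojective (dtens C (string_plus E t hvj)) /\
       dprojective (dtens C (string_minus E t hvj))).
Proof.
case: l l_gt0 => // l _; case: t t_gt0 => // t _.
set E0 := E _ _ (nonproj00 T).
have neq0 (s xi : k) : s != 0 -> xi ^+ td T = s ^+ td T -> xi != 0.
  move=> s0 e; have := expf_neq0 (td T) s0; rewrite -e; apply: contraNneq => ->.
  by rewrite expr0n gtn_eqF // ltnW // td_ge2.
split=> [lam mu lam0 mu0 neq C C' [L isL coreC] [L' isL' coreC']|].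
  have [s s0 [w [rho indP]]] := band_induced E0 lam0.
  have [s' s'0 [w' [rho' indP']]] := band_induced E0 mu0.
  (* Equal n-th powers would give a nonzero homomorphism between the two induced modules, which
     fullness turns into one between the bands of lam and mu. *)
  have neq_s : s ^+ tn T != s' ^+ tn T.
    apply/eqP => e; have [f hf f0] := induced_hom s0 s'0 e indP indP'.
    have [g hg gE] := be_full (b := E0) hf.
    by move: f0; rewrite -gE (band_qhom hg neq) be0 eqxx.
  apply: retract_proj (retract_tens (core_retract coreC) (core_retract coreC')) _.
  have free xi : xi ^+ td T = s ^+ td T ->
      tame (dtens (be_obj E0 (qband T mu t.+1)) L') /\
      zfree (td T) (zop (dtens (be_obj E0 (qband T mu t.+1)) L') xi).
    move=> e; apply: (band_tens_zfree t s'0 indP' (isL_G isL') (neq0 _ _ s0 e)).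
    (* As d divides n, xi^d = s^d gives xi^n = s^n, which differs from s'^n. *)
    rewrite -(divnK (td_dvd_n T)) mulnC !exprM e -!exprM mulnC.
    by rewrite divnK ?td_dvd_n.
  apply: (band_tens_proj s0 indP (isL_tame isL) (free s erefl).1).
  by move=> xi /free[].
move=> lam lam0 C [L isL coreC].
have [s s0 [w [rho indP]]] := band_induced E0 lam0.
have proj X : tame X /\ (forall xi, xi != 0 -> zfree (td T) (zop X xi)) ->
    dprojective (dtens C X).
  move=> [tX free].
  apply: retract_proj (retract_tens (core_retract coreC) (retract_refl X)) _.
  apply: (band_tens_proj s0 indP (isL_tame isL) tX) => xi e.
  exact: free (neq0 _ _ s0 e).
split; apply: proj.
  exact: good_string_plus.
exact: good_string_minus.
Qed.
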